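(* Suppose that there exists $\gamma_0\in(0,1/2)$ such that $$\lim_{n\to\infty}\alpha_n=1\quad\text{and}\quad\liminf_{n\to\infty}n^{\gamma_0}(1-\alpha_n)>0 .$$ If the offered load is $(m,\Delta)$-bounded on an interval $[a,b]\subset[0,T]$ and $\sigma(a,b,m,\Delta)<\sigma<b-a$, then there exist $c>0$ and a set of probability one on which the following statements hold: $$\lim_{n\to\infty}\ \sup_{t\in[a+\sigma,b]}|\ell_n(t)-m\Delta|=0,$$ $$\lim_{n\to\infty}\ \sup_{t\in[a+\sigma,b]}n^{\gamma}\,|1-q_n(t,i)|=0\quad\text{for all } i\le m\Delta \text{ and all }\gamma\in[0,1/2),$$ $$\limsup_{n\to\infty}\ \sup_{t\in[a+\sigma,b]}\ \sum_{i>(m+1)\Delta}q_n(t,i)\,e^{\mu[t-(a+\sigma)]}\le c .$$ The constant $c$ can be taken equal to $u(a+\sigma)$.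
   Context: Conventions: $\mathbb{N}=\{0,1,2,\dots\}$; $[x]^+=\max\{x,0\}$; $f(t^-)$ is the left limit of $f$ at $t$; $\mathbf{1}\{\cdot\}$ is the indicator. Model (exponential service times, time-varying arrivals, refined learning scheme). Fix $T>0$, $\mu>0$, an integer $\Delta\ge1$, parameters $\alpha_n\in(0,1)$ for $n\ge1$, and a bounded measurable function $\lambda:[0,T]\to[0,\infty)$; put $\rho(t)=\lambda(t)/\mu$ (the offered load). System $n$ has $n$ server pools; $q_n(t,i)$ is the fraction of pools with at least $i$ tasks at time $t$ and $\ell_n(t)$ is the threshold. Let $Q=\{q\in[0,1]^{\mathbb{N}}: q(i+1)\le q(i)\le q(0)=1 \text{ for all } i\ge 0\}$. Primitives: (1) independent unit-rate Poisson processes $\mathcal{N}_i$, $i\ge0$; (2) i.i.d. random variables $U_j$, $j\ge1$, uniform on $[0,1)$; (3) for each $n\ge1$, random initial conditions $q_n(0)\in Q$ with $nq_n(0,i)\in\mathbb{N}$ for all $i$, and $\ell_n(0)\in\{k\Delta:k\in\mathbb{N}\}$. There are a deterministic $q(0)\in Q$ with $q_n(0,i)\to q(0,i)$ for all $i$ almost surely, and $B\in\mathbb{N}$ with $q_n(0,B+1)=0$ and $\ell_n(0)\le B$ for all $n$ almost surely. The three families live on three probability spaces and $(\Omega,\mathcal{F},\mathbb{P})$ is the completion of the product space. For $q\in Q$ and $i\ge1$ let $I_i(q)=[1-q(i-1),1-q(i))$; for $1\le i\le j$ let $J_i(q,j)=\left[\frac{1-q(i-1)}{1-q(j)},\frac{1-q(i)}{1-q(j)}\right)$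 if $q(j)<1$ and $J_i(q,j)=\emptyset$ if $q(j)=1$. For $\ell\in\mathbb{N}$, $h=\ell+\Delta$ and $i,j\ge1$ let $r_{ij}(q,\ell)$ equal $\mathbf{1}\{U_j\in J_i(q,\ell)\}$ if $i-1<\ell$; $\mathbf{1}\{q(\ell)=1,\,U_j\in J_i(q,h)\}$ if $\ell\le i-1<h$; and $\mathbf{1}\{q(h)=1,\,U_j\in I_i(q)\}$ if $i-1\ge h$ (the $j$-th arriving task is sent to a pool with exactly $i-1$ tasks iff $r_{ij}=1$). Let $\mathcal{N}_n^\lambda(t)=\mathcal{N}_0\left(n\int_0^t\lambda(s)\,ds\right)$, with jump times $\tau_{n,1}<\tau_{n,2}<\cdots$. There is a set $\Gamma_0$ of probability one on which, for every $n$, the following equations have a unique càdlàg solution $q_n:[0,T]\to Q$, $\ell_n:[0,T]\to\mathbb{N}$ with the given initial conditions; these define $q_n,\ell_n$ (set identically $0$ off $\Gamma_0$): $$q_n(t,i)=q_n(0,i)+\mathcal{A}_n(t,i)-\mathcal{D}_n(t,i),\qquad \mathcal{A}_n(t,0)=\mathcal{D}_n(t,0)=0,$$ and for $i\ge1$ $$\mathcal{A}_n(t,i)=\frac1n\sum_{j=1}^{\mathcal{N}_n^\lambda(t)}r_{ij}\left(q_n(\tau_{n,j}^-),\ell_n(\tau_{n,j}^-)\right),\qquad \mathcal{D}_n(t,i)=\frac1n\mathcal{N}_i\left(n\int_0^t\mu i\,[q_n(s,i)-q_n(s,i+1)]\,ds\right),$$ $$\ell_n(t)=\ell_n(0)+\sum_{k=1}^{\mathcal{N}_n^\lambda(t)}\Delta\left[\mathbf{1}_{A_{n,k}}-\mathbf{1}_{B_{n,k}}\right],$$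 where $A_{n,k}=\{q_n(\tau_{n,k}^-,\ell_n(\tau_{n,k}^-))=1 \text{ and } nq_n(\tau_{n,k}^-,\ell_n(\tau_{n,k}^-)+\Delta)\ge n-1\}$ and $B_{n,k}=\{q_n(\tau_{n,k}^-,\ell_n(\tau_{n,k}^-))\le\alpha_n\}$. Define $u(0)=\sum_{i\ge1}q(0,i)$ and $u(t)=u(0)e^{-\mu t}+\int_0^t\rho(s)\mu e^{-\mu(t-s)}\,ds$ for $t\in[0,T]$. Definition of $(m,\Delta)$-bounded. Let $m\ge0$ be an integer and $[a,b]\subset[0,T]$; let $\rho_{\min}=\inf_{[a,b]}\rho$ and $\rho_{\max}=\sup_{[a,b]}\rho$. The offered load is $(m,\Delta)$-bounded on $[a,b]$ if $m\Delta<\rho_{\min}\le\rho_{\max}<(m+1)\Delta$ and $b-a>\sigma(a,b,m,\Delta)$, where $$\sigma(a,b,m,\Delta)=\frac1\mu\log\left(\frac{\rho_{\min}}{\rho_{\min}-m\Delta}\right)+\frac1\mu\left[\log\left(\frac{u(a)-\rho_{\max}}{(m+1)\Delta-\rho_{\max}}\right)\right]^+\ \text{ if } u(a)>\rho_{\max},$$ and $\sigma(a,b,m,\Delta)=\frac1\mu\log\left(\frac{\rho_{\min}}{\rho_{\min}-m\Delta}\right)$ if $u(a)\le\rho_{\max}$. *)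

(* Defs.v *)
From HB Require Import structures.
From mathcomp Require Export all_boot all_order all_algebra.
From mathcomp Require Export all_classical all_reals all_analysis.
Export numFieldNormedType.Exports.

Set Implicit Arguments.
Unset Strict Implicit.
Unset Printing Implicit Defensive.

Import Order.TTheory GRing.Theory Num.Theory.

Local Open Scope classical_set_scope.
Local Open Scope ring_scope.

Section primitives.
Context {R : realType}.

Definition mutually_independent d (T : measurableType d)
    (P : probability T R) (I : choiceType) (F : I -> set (set T)) : Prop :=
  forall (s : seq I) (E : I -> set T), uniq s ->
    (forall i, i \in s -> F i (E i)) ->
    P (\big[setI/setT]_(i <- s) E i) = (\prod_(i <- s) P (E i))%E.

Definition sigma_var d (T : measurableType d) d' (T' : measurableType d')
    (X : T -> T') : set (set T) :=
  [set X @^-1` B | B in measurable].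

Definition sigma_process d (T : measurableType d) (N : R -> T -> nat)
    : set (set T) :=
  <<s \bigcup_(t in [set t : R | 0 <= t]) sigma_var (N t) >>.

(* The law of the increments is only prescribed for s < t because the library's
   poisson_pmf takes the junk value 1 at rate 0. *)
Record unit_poisson_process d (T : measurableType d) (P : probability T R)
    (N : R -> T -> nat) : Prop := {
  poisson_measurable : forall t : R, 0 <= t -> measurable_fun [set: T] (N t) ;
  poisson_start : forall w, N 0 w = 0%N ;
  poisson_monotone : forall w (s t : R), 0 <= s -> s <= t -> (N s w <= N t w)%N ;
  poisson_right_continuous : forall w (t : R), 0 <= t ->
    N s w @[s --> t^'+] --> N t w ;
  poisson_increment_law : forall (s t : R) (k : nat), 0 <= s -> s < t ->
    P [set w | (N t w - N s w)%N = k] = (poisson_pmf (t - s) k)%:E ;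
  poisson_independent_increments : forall t : nat -> R,
    0 <= t 0%N -> (forall k, t k <= t k.+1) ->
    mutually_independent P
      (fun k : nat => sigma_var (fun w => (N (t k.+1) w - N (t k) w)%N)) }.

Definition independent_unit_poisson d (T : measurableType d)
    (P : probability T R) (N : nat -> R -> T -> nat) : Prop :=
  (forall i, unit_poisson_process P (N i)) /\
  mutually_independent P (fun i : nat => sigma_process (N i)).

(* Only the variables U j with j >= 1 are used. *)
Definition iid_uniform d (T : measurableType d) (P : probability T R)
    (U : nat -> {RV P >-> R}) : Prop :=
  (forall j, (0 < j)%N -> forall A : set R, measurable A ->
     distribution P (U j) A = uniform_prob (@ltr01 R) A) /\
  mutually_independent P (fun j : nat => sigma_var (U j.+1 : T -> R)).

Definition occupancy : set (nat -> R) :=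
  [set q | q 0%N = 1 /\ forall i, [/\ 0 <= q i <= 1 & q i.+1 <= q i]].

Record initial_conditions d (T : measurableType d) (P : probability T R)
    (Delta B : nat) (qn0 : nat -> nat -> {RV P >-> R})
    (ln0 : nat -> {RV P >-> nat}) (q0 : nat -> R) : Prop := {
  init_occupancy : forall n w, (0 < n)%N -> occupancy (fun i => qn0 n i w) ;
  init_lattice : forall n w i, (0 < n)%N ->
    exists k : nat, n%:R * qn0 n i w = k%:R ;
  init_threshold : forall n w, (0 < n)%N ->
    exists k : nat, ln0 n w = (k * Delta)%N ;
  init_limit_occupancy : occupancy q0 ;
  init_cvg : {ae P, forall w, forall i, qn0 n i w @[n --> \oo] --> q0 i} ;
  init_bounded : {ae P, forall w, forall n, (0 < n)%N ->
    qn0 n B.+1 w = 0 /\ (ln0 n w <= B)%N} }.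

End primitives.

Section dynamics.
Context {R : realType}.

Definition cadlag (T : R) (X : ptopologicalType) (f : R -> X) : Prop :=
  (forall t : R, 0 <= t -> t < T -> f s @[s --> t^'+] --> f t) /\
  (forall t : R, 0 < t -> t <= T -> cvg (f s @[s --> t^'-])).

(* I_i(q) and J_i(q, j) are only used for i >= 1, so i.-1 is a true predecessor. *)
Definition Iset (q : nat -> R) (i : nat) : set R :=
  `[1 - q i.-1, 1 - q i[.

Definition Jset (q : nat -> R) (i j : nat) : set R :=
  if q j < 1
  then `[(1 - q i.-1) / (1 - q j), (1 - q i) / (1 - q j)[%classic
  else set0.

(* r_{ij}(q, l) as a function of the value u of U_j, for i >= 1. *)
Definition route (Delta : nat) (u : R) (q : nat -> R) (l i : nat) : bool :=
  let h := (l + Delta)%N in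
  if (i.-1 < l)%N then u \in Jset q i l
  else if (i.-1 < h)%N then (q l == 1) && (u \in Jset q i h)
  else (q h == 1) && (u \in Iset q i).

Section system.
Context (T mu : R) (Delta : nat) (alpha : R) (lam : R -> R) (n : nat).
(* One realization of the primitives and of the state. *)
Context (N : nat -> R -> nat) (U : nat -> R).
Context (q : R -> nat -> R) (l : R -> nat).

Definition arrival_count (t : R) : nat :=
  N 0%N (n%:R * \int[lebesgue_measure]_(s in `[0, t]) lam s).

(* The j-th jump time tau_{n,j} for j >= 1; meaningful when
   j <= arrival_count T. *)
Definition arrival_time (j : nat) : R :=
  inf [set t : R | 0 <= t <= T /\ (j <= arrival_count t)%N].

Definition q_before (j i : nat) : R :=
  lim (q s i @[s --> (arrival_time j)^'-]).

Definition l_before (j : nat) : nat :=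
  lim (l s @[s --> (arrival_time j)^'-]).

Definition arrivals (t : R) (i : nat) : R :=
  if i is 0%N then 0 else
  n%:R^-1 * \sum_(1 <= j < (arrival_count t).+1)
    (route Delta (U j) (q_before j) (l_before j) i)%:R.

Definition departures (t : R) (i : nat) : R :=
  if i is 0%N then 0 else
  n%:R^-1 * (N i (n%:R * \int[lebesgue_measure]_(s in `[0, t])
                    (mu * i%:R * (q s i - q s i.+1))))%:R.

Definition raise_threshold (k : nat) : bool :=
  (q_before k (l_before k) == 1) &&
  (n%:R - 1 <= n%:R * q_before k (l_before k + Delta)%N).

Definition lower_threshold (k : nat) : bool :=
  q_before k (l_before k) <= alpha.

Record system_solution (qn0 : nat -> R) (ln0 : nat) : Prop := {
  sol_occupancy : forall t : R, 0 <= t <= T -> occupancy (q t) ;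
  sol_q_cadlag : forall i, cadlag T (fun t => q t i) ;
  sol_l_cadlag : cadlag T l ;
  sol_q : forall (t : R) i, 0 <= t <= T ->
    q t i = qn0 i + arrivals t i - departures t i ;
  sol_l : forall t : R, 0 <= t <= T ->
    (l t)%:Z = ln0%:Z + \sum_(1 <= k < (arrival_count t).+1)
      Delta%:Z * ((raise_threshold k)%:Z - (lower_threshold k)%:Z) }.

End system.

Definition offered_load (mu : R) (lam : R -> R) (t : R) : R := lam t / mu.

(* u(0) is a real limit of partial sums; it exists under
   [initial_conditions], which forces q0 i = 0 for i > B. *)
Definition fluid_mass (mu : R) (lam : R -> R) (q0 : nat -> R) (t : R) : R :=
  limn (fun k => \sum_(1 <= i < k) q0 i) * expR (- (mu * t)) +
  \int[lebesgue_measure]_(s in `[0, t])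
    (offered_load mu lam s * mu * expR (- (mu * (t - s)))).

Definition load_min (mu : R) (lam : R -> R) (a b : R) : R :=
  inf (offered_load mu lam @` `[a, b]).

Definition load_max (mu : R) (lam : R -> R) (a b : R) : R :=
  sup (offered_load mu lam @` `[a, b]).

Definition settling_time (mu : R) (lam : R -> R) (q0 : nat -> R)
    (a b : R) (m Delta : nat) : R :=
  let rmin := load_min mu lam a b in
  let rmax := load_max mu lam a b in
  let ua := fluid_mass mu lam q0 a in
  let base := mu^-1 * ln (rmin / (rmin - (m * Delta)%:R)) in
  if rmax < ua then
    base + mu^-1 *
      Num.max (ln ((ua - rmax) / ((m.+1 * Delta)%:R - rmax))) 0
  else base.

Definition load_bounded (mu : R) (lam : R -> R) (q0 : nat -> R)
    (a b : R) (m Delta : nat) : Prop :=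
  [/\ (m * Delta)%:R < load_min mu lam a b,
      load_min mu lam a b <= load_max mu lam a b,
      load_max mu lam a b < (m.+1 * Delta)%:R
    & settling_time mu lam q0 a b m Delta < b - a].

End dynamics.

(* Main.v *)
Require Import Defs.
From mathcomp Require Import all_boot all_order all_algebra.
From mathcomp Require Import all_classical all_reals all_analysis.
From mathcomp Require Import measurable_realfun ring lra zify.

(** The state of system n is a deterministic function of the Poisson paths, of
    the routing variables and of the initial state, so the proof splits into
    three almost sure facts about these primitives and an analysis of one
    realization.

    Randomness.  For x in [0, C n] the deviation |N_i(x) - x| is o(n^(1-gamma))
    for every gamma < 1/2 ([ae_subdiffusive]: Chernoff bounds at integer times,
    Borel-Cantelli, and monotone interpolation).  The arrival process has no
    double jumps ([ae_unit_jumps]), so arrivals can be treated one at a time.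
    The routing variables lie in [0, 1[; beyond that, it only matters how many
    tasks enter a block of levels, never how they are spread inside it.

    Dynamics.  Let v be the mass of the levels a + 1, ..., b.  Up to noise, v
    grows by the tasks sent to these levels and decreases at rate
    mu (v + a q(a+1) - b q(b+1)) ([band_increment]).  Each step below
    integrates such a balance with [feedback_comparison]: if g gains at most
    eps minus mu times its integral over every window, then g exceeds a
    nonnegative bound on its initial value by at most eps, as one sees by
    starting the window at the last time when g was below that bound.

    - After finitely many arrivals some pool always has fewer than l + Delta
      tasks ([invariant]), so no task is ever sent above the level l + Delta.
    - The total mass stays below the fluid mass u plus o(1)
      ([total_mass_upper]).  By the choice of sigma, u stays away from
      (m+1) Delta from a time s0 < a + sigma on ([settling_schedule]).  Hence
      the level (m+1) Delta is never nearly full, the threshold can not pass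
      m Delta upwards, and every arrival lowers it while it is above m Delta:
      it is at most m Delta from a time s1 close to s0 ([threshold_descends]).
    - From then on, as long as the first m Delta levels are not full, every
      task is sent to one of them ([full_routing]).  Their mass v then
      satisfies v' >= mu (rmin - v), and reaches m Delta within the time
      log(rmin / (rmin - m Delta)) / mu left before a + sigma ([level_fills]).
    - Once these levels have been full, the arrival rate exceeds the largest
      possible departure rate mu m Delta, so v loses at most the noise, which
      is o(n^(-gamma)) ([level_stays_full]).  As 1 - alpha_n is at least of
      order n^(-gamma0), the loss is too small to trigger a decrease of the
      threshold, which therefore stays at m Delta ([threshold_settles]).
    - While the threshold is m Delta, no task is sent above (m+1) Delta; the
      mass there decays at rate at least mu from at most u(a + sigma) + o(1)
      ([upper_band_decays]).

    [settled_system] collects these steps for one system with explicit error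
    terms and [eventually_settled] lets n grow. *)

Set Implicit Arguments.
Unset Strict Implicit.
Unset Printing Implicit Defensive.

Import Order.TTheory GRing.Theory Num.Theory.

Local Open Scope classical_set_scope.
Local Open Scope ring_scope.

(** * Integrals of bounded measurable functions *)
Section interval_integrals.
Context {R : realType}.
Implicit Types (T r s t c : R) (f g : R -> R).

Definition bounded_measurable T f : Prop :=
  measurable_fun `[0, T] f /\
  exists C : R, forall t, 0 <= t <= T -> `|f t| <= C.

(** Half-open intervals make consecutive windows add up, and a pointwise bound
    is never needed at the left end of a window. *)
Definition oint f r s : R := \int[lebesgue_measure]_(x in `]r, s]) f x.

Lemma bounded_measurable_cst T c : bounded_measurable T (fun=> c).
Proof. by split; [exact: measurable_cst | exists `|c|]. Qed.

Lemma bounded_measurableD T f g : bounded_measurable T f ->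
  bounded_measurable T g -> bounded_measurable T (fun x => f x + g x).
Proof.
move=> [mf [C fC]] [mg [D gD]]; split; first exact: measurable_funD.
by exists (C + D) => t tT; rewrite (le_trans (ler_normD _ _))// lerD// (fC, gD).
Qed.

Lemma bounded_measurableM T f g : bounded_measurable T f ->
  bounded_measurable T g -> bounded_measurable T (fun x => f x * g x).
Proof.
move=> [mf [C fC]] [mg [D gD]]; split; first exact: measurable_funM.
by exists (C * D) => t tT; rewrite normrM ler_pM// (fC, gD).
Qed.

Lemma bounded_measurableZ T c f : bounded_measurable T f ->
  bounded_measurable T (fun x => c * f x).
Proof.
move=> [mf [C fC]]; split; first exact: measurable_funM.
by exists (`|c| * C) => t tT; rewrite normrM ler_wpM2l// fC.
Qed.

Lemma bounded_measurableB T f g : bounded_measurable T f ->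
  bounded_measurable T g -> bounded_measurable T (fun x => f x - g x).
Proof.
move=> bf bg; have := bounded_measurableD bf (bounded_measurableZ (-1) bg).
by under [fun x => _ - _]eq_fun do rewrite -mulN1r.
Qed.

Lemma bounded_measurable_sum T n (F : nat -> R -> R) :
  (forall i, (i < n)%N -> bounded_measurable T (F i)) ->
  bounded_measurable T (fun x => \sum_(0 <= i < n) F i x).
Proof.
elim: n => [|n IH] bF.
  by under eq_fun do rewrite big_geq//; exact: bounded_measurable_cst.
under eq_fun do rewrite big_nat_recr//=.
by apply: bounded_measurableD; [apply: IH => i /ltnW/bF | exact: bF].
Qed.

Lemma bounded_measurable_continuous T f : continuous f -> bounded_measurable T f.
Proof.
move=> cf; split.
  by apply: measurable_funTS; exact: continuous_measurable_fun.
have cK : compact (f @` `[0, T]%classic).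
  apply: continuous_compact; last exact: segment_compact.
  exact: continuous_subspaceT.
have [M [_ HM]] := compact_bounded cK.
exists (M + 1) => t tT; apply: (HM (M + 1)); first by rewrite ltrDl.
by exists t => //=; rewrite in_itv.
Qed.

Lemma bounded_measurable_integrable T f (b1 b2 : bool) r s :
  bounded_measurable T f -> 0 <= r -> s <= T ->
  lebesgue_measure.-integrable [set` Interval (BSide b1 r) (BSide b2 s)]
    (EFin \o f).
Proof.
move=> [mf [C fC]] r0 sT.
have sub : [set` Interval (BSide b1 r) (BSide b2 s)] `<=` `[0, T]%classic.
  move=> x /=; rewrite !itv_boundlr /= !bnd_simp => /andP[rx xs].
  have rx' : r <= x by case: b1 rx; rewrite bnd_simp// => /ltW.
  have xs' : x <= s by case: b2 xs; rewrite bnd_simp// => /ltW.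
  by rewrite (le_trans r0 rx') (le_trans xs' sT).
apply: measurable_bounded_integrable => //=.
- rewrite lebesgue_measure_itv/=; case: ifP => _; rewrite ?ltry//.
- exact: measurable_funS sub mf.
- exists C; split; first exact: num_real.
  move=> M CM x /sub/=; rewrite in_itv/= => /fC; lra.
Qed.

Section oint_theory.
Variable T : R.

Let bmi f (b1 b2 : bool) r s := @bounded_measurable_integrable T f b1 b2 r s.

Lemma ointD f g r s : bounded_measurable T f -> bounded_measurable T g ->
  0 <= r -> s <= T -> oint (fun x => f x + g x) r s = oint f r s + oint g r s.
Proof. by move=> bf bg r0 sT; rewrite /oint RintegralD//; exact: bmi. Qed.

Lemma ointB f g r s : bounded_measurable T f -> bounded_measurable T g ->
  0 <= r -> s <= T -> oint (fun x => f x - g x) r s = oint f r s - oint g r s.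
Proof. by move=> bf bg r0 sT; rewrite /oint RintegralB//; exact: bmi. Qed.

Lemma ointZ c f r s : bounded_measurable T f ->
  0 <= r -> s <= T -> oint (fun x => c * f x) r s = c * oint f r s.
Proof. by move=> bf r0 sT; rewrite /oint RintegralZl//; exact: bmi. Qed.

Lemma oint_cst c r s : r <= s -> oint (fun=> c) r s = c * (s - r).
Proof.
move=> rs; rewrite /oint Rintegral_cst//= lebesgue_measure_itv/= lte_fin.
by case: ltgtP rs => //= -> _; rewrite subrr.
Qed.

Lemma oint_sum n (F : nat -> R -> R) r s :
  (forall i, (i < n)%N -> bounded_measurable T (F i)) -> 0 <= r -> r <= s ->
  s <= T -> oint (fun x => \sum_(0 <= i < n) F i x) r s =
    \sum_(0 <= i < n) oint (F i) r s.
Proof.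
move=> bF r0 rs sT; elim: n bF => [|n IH] bF.
  by under eq_fun do rewrite big_geq//; rewrite oint_cst// mul0r big_geq.
under eq_fun do rewrite big_nat_recr//=.
rewrite ointD// ?IH ?big_nat_recr//; last exact: bF.
- by move=> i /ltnW/bF.
- by apply: bounded_measurable_sum => i /ltnW/bF.
Qed.

Lemma le_oint f g r s : bounded_measurable T f -> bounded_measurable T g ->
  0 <= r -> s <= T -> (forall x, r < x <= s -> f x <= g x) ->
  oint f r s <= oint g r s.
Proof.
move=> bf bg r0 sT fg; apply: le_Rintegral => //.
- exact: bmi.
- exact: bmi.
Qed.

Lemma eq_oint f g r s : (forall x, r < x <= s -> f x = g x) ->
  oint f r s = oint g r s.
Proof.
by move=> fg; apply: eq_Rintegral => x; rewrite inE/= in_itv/=; exact: fg.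
Qed.

Lemma oint_closedB f r s : bounded_measurable T f -> 0 <= r -> r <= s ->
  s <= T -> \int[lebesgue_measure]_(x in `[0, s]) f x -
            \int[lebesgue_measure]_(x in `[0, r]) f x = oint f r s.
Proof. by move=> bf r0 rs sT; rewrite Rintegral_itvB//; exact: bmi. Qed.

Lemma oint_split f r s t : bounded_measurable T f -> 0 <= r -> r <= s ->
  s <= t -> t <= T -> oint f r t = oint f r s + oint f s t.
Proof.
move=> bf r0 rs st tT.
rewrite -!oint_closedB//; [ring|lra..].
Qed.

Lemma oint_self f r : oint f r r = 0.
Proof. by rewrite /oint set_itvoc0 Rintegral_set0. Qed.

Lemma oint_ge0 f r s : (forall x, r < x <= s -> 0 <= f x) -> 0 <= oint f r s.
Proof.
by move=> f0; apply: Rintegral_ge0 => x /=; rewrite in_itv/=; exact: f0.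
Qed.

Lemma integral_closed0 f :
  \int[lebesgue_measure]_(x in `[0, (0:R)]) f x = 0.
Proof. by rewrite set_itv1 Rintegral_set1. Qed.

End oint_theory.

Lemma oint_expR (k c : R) r s : 0 <= r -> r <= s ->
  oint (fun x => k * expR (k * (x - c))) r s =
  expR (k * (s - c)) - expR (k * (r - c)).
Proof.
move=> r0; rewrite le_eqVlt => /predU1P[->|rs].
  by rewrite oint_self subrr.
have dE (x : R) : is_derive x (1 : R) (fun x => expR (k * (x - c)))
    (k * expR (k * (x - c))).
  have h : is_derive x (1 : R) (fun x : R => k * (x - c)) k.
    by apply: is_derive_eq; rewrite /GRing.scale/=; ring.
  have := @is_derive1_comp R expR (fun x : R => k * (x - c)) x _ k
    (is_derive_expR _) h.
  by rewrite mulrC.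
have cE : continuous (fun x : R => expR (k * (x - c))).
  by move=> x; apply/differentiable_continuous/derivable1_diffP; case: (dE x).
have cf : continuous (fun x : R => k * expR (k * (x - c))).
  move=> x; apply: cvgM; first exact: cvg_cst.
  exact: cE.
rewrite /oint Rintegral_itv_obnd_cbnd; last first.
  by apply: (@bounded_measurable_integrable s) => //;
    exact: bounded_measurable_continuous.
rewrite /Rintegral.
rewrite (@continuous_FTC2 _ _ (fun x => expR (k * (x - c))))//=.
- exact: continuous_subspaceT.
- split => [x _| |].
  + by case: (dE x).
  + by apply: cvg_at_right_filter; exact: cE.
  + by apply: cvg_at_left_filter; exact: cE.
- by move=> x _; rewrite derive1E; apply: derive_val.
Qed.

End interval_integrals.

(** * Comparison under noisy feedback *)
Section comparison.
Context {R : realType}.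

(** The hypothesis integrates g' <= - mu g, up to a noise of which nothing is
    known except that it totals at most eps over each window.  After the last
    time at which g <= eta, g is positive, so the feedback term can only help and
    the gain is at most eps.  Unlike in Gronwall's lemma, no constant multiplies
    eps. *)
Lemma feedback_comparison (T mu : R) (g : R -> R) (r0 r1 eta eps : R) :
  bounded_measurable T g -> 0 < mu -> 0 <= r0 -> r1 <= T -> 0 <= eta ->
  (forall r s, r0 <= r -> r <= s -> s <= r1 ->
    g s - g r <= eps - mu * oint g r s) ->
  g r0 <= eta -> forall t, r0 <= t <= r1 -> g t <= eta + eps.
Proof.
move=> bg mu0 r00 r1T eta0 gdec g0 t /andP[r0t tr1].
rewrite leNgt; apply/negP => gt.
have [_ [C0 gC0]] := bg.
pose C := `|C0|.
have C_ge0 : 0 <= C by exact: normr_ge0.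
have gC x : 0 <= x <= T -> `|g x| <= C.
  by move=> xT; rewrite (le_trans (gC0 _ xT))// ler_norm.
pose S := [set x | r0 <= x <= t /\ g x <= eta].
have supS : has_sup S.
  split; first by exists r0; split => //; rewrite lexx.
  by exists t => x [/andP[]].
have r0S : S r0 by split => //; rewrite lexx.
have s0_ge : r0 <= sup S by apply: sup_upper_bound.
have s0_le : sup S <= t by apply: ge_sup => // [|x [/andP[]//]]; exists r0.
pose d := g t - eta - eps.
have d_gt0 : 0 < d by rewrite /d; lra.
(* g may jump, so the last time at which g <= eta is only approached, by x; the
   margin e absorbs the feedback between x and this time. *)
pose e := d / (mu * (C + 1)).
have C1 : 0 < C + 1 by lra.
have e_gt0 : 0 < e by rewrite /e divr_gt0// mulr_gt0.
have [x [/andP[r0x xt] gx] xs0] := sup_adherent e_gt0 supS.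
have x_le : x <= sup S by apply: sup_upper_bound => //; split => //; apply/andP.
have dec := gdec x t r0x xt tr1.
have split_int : oint g x t = oint g x (sup S) + oint g (sup S) t.
  by apply: (oint_split bg) => //; lra.
have tail_ge0 : 0 <= oint g (sup S) t.
  apply: oint_ge0 => y /andP[sy yt]; rewrite leNgt; apply/negP => gy.
  have : y <= sup S.
    by apply: sup_upper_bound => //; split; [apply/andP; split; lra|lra].
  lra.
have head_ge : - C * (sup S - x) <= oint g x (sup S).
  rewrite -oint_cst//; apply: (@le_oint _ T) => //; try lra.
    exact: bounded_measurable_cst.
  move=> y /andP[xy ys]; have /gC : 0 <= y <= T by apply/andP; split; lra.
  by rewrite ler_norml => /andP[].
have muCe : mu * (C * e) + mu * e = d.
  by rewrite /e; field; rewrite (gt_eqF mu0) (gt_eqF C1).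
have : mu * (C * (sup S - x)) <= mu * (C * e).
  by rewrite ler_pM2l// ler_wpM2l//; lra.
have : 0 < mu * e by rewrite mulr_gt0.
have : mu * (- C * (sup S - x)) <= mu * oint g x t.
  by rewrite ler_pM2l// split_int; lra.
rewrite /d in muCe; move: dec gx muCe; set X := mu * oint _ _ _.
set Y := mu * (C * e); set Z := mu * e.
rewrite mulNr mulrN; set W := mu * (C * (_ - _)).
by move=> *; lra.
Qed.

(** Halving the interval k times divides the total second-order defect of an
    additive function by 2^k.  This takes the place of differentiation for
    integrals whose integrand is merely measurable. *)
Lemma additive_quadratic_ge0 (D : R -> R -> R) (a b C : R) :
  (forall r s t, a <= r -> r <= s -> s <= t -> t <= b ->
     D r t = D r s + D s t) ->
  (forall r s, a <= r -> r <= s -> s <= b -> - C * (s - r) ^+ 2 <= D r s) ->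
  forall r s, a <= r -> r <= s -> s <= b -> 0 <= D r s.
Proof.
move=> addD quadD.
have halve (k : nat) : forall r s, a <= r -> r <= s -> s <= b ->
    - (C * (s - r) ^+ 2) / 2 ^+ k <= D r s.
  elim: k => [|k IH] r s ar rs sb.
    by rewrite expr0 divr1 -mulNr; exact: quadD.
  pose c := (r + s) / 2.
  have := IH r c; have := IH c s; rewrite (addD r c s)//; try (rewrite /c; lra).
  have -> : s - c = (s - r) / 2 by rewrite /c; field.
  have -> : c - r = (s - r) / 2 by rewrite /c; field.
  have ex : - (C * ((s - r) / 2) ^+ 2) / 2 ^+ k *+ 2 =
      - (C * (s - r) ^+ 2) / 2 ^+ k.+1.
    by rewrite [2 ^+ k.+1]exprS invfM -mulr_natr; set z := (2 ^+ k)^-1; field.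
  move=> /(_ _ _ _)h1 /(_ _ _ _)h2.
  have {}h1 : - (C * ((s - r) / 2) ^+ 2) / 2 ^+ k <= D c s
    by apply: h1; rewrite /c; lra.
  have {}h2 : - (C * ((s - r) / 2) ^+ 2) / 2 ^+ k <= D r c
    by apply: h2; rewrite /c; lra.
  by rewrite -ex mulr2n; apply: lerD.
move=> r s ar rs sb; rewrite leNgt; apply/negP => D_lt0.
pose X := C * (s - r) ^+ 2.
pose k := Num.bound `|X / - D r s|.
have Xk : X < - D r s * 2 ^+ k.
  rewrite -ltr_pdivrMl ?oppr_gt0// mulrC.
  have Xn : X / - D r s < k%:R.
    exact: le_lt_trans (ler_norm _) (archi_boundP (normr_ge0 _)).
  rewrite (lt_le_trans Xn)// -natrX ler_nat; exact: ltnW (ltn_expl _ _).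
have := halve k r s ar rs sb; rewrite -/X ler_pdivrMr ?exprn_gt0//.
rewrite mulNr in Xk; lra.
Qed.

End comparison.

(** * The fluid mass *)
Section fluid.
Context {R : realType}.
Variables (T mu : R) (lam : R -> R) (q0 : nat -> R).
Hypotheses (T_ge0 : 0 <= T) (mu_gt0 : 0 < mu) (lamM : bounded_measurable T lam)
  (lam_ge0 : forall t, 0 <= t <= T -> 0 <= lam t).

Local Notation u := (fluid_mass mu lam q0).
Local Notation u0 := (limn (fun k => \sum_(1 <= i < k) q0 i)).
Hypothesis u0_ge0 : 0 <= u0.

Let kernel t x : R := lam x * expR (- (mu * (t - x))).

Let bexp c : bounded_measurable T (fun x => expR (- (mu * (c - x)))).
Proof.
apply: bounded_measurable_continuous => x.
apply: continuous_comp; last exact: continuous_expR.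
apply: cvgN; apply: cvgM; first exact: cvg_cst.
by apply: cvgB; [exact: cvg_cst|exact: cvg_id].
Qed.

Let bkernel t : bounded_measurable T (kernel t).
Proof. exact: bounded_measurableM. Qed.

Lemma fluid_massE t : 0 <= t <= T ->
  u t = u0 * expR (- (mu * t)) + oint (kernel t) 0 t.
Proof.
move=> /andP[t0 tT]; rewrite /fluid_mass; congr (_ + _).
rewrite -(@oint_closedB _ T (kernel t))// integral_closed0 subr0.
apply: eq_Rintegral => x _.
by rewrite /offered_load divfK ?gt_eqF.
Qed.

Lemma fluid_mass_step r s : 0 <= r -> r <= s -> s <= T ->
  u s = expR (- (mu * (s - r))) * u r +
    oint (fun x => lam x * expR (- (mu * (s - x)))) r s.
Proof.
move=> r0 rs sT; rewrite !fluid_massE; try (apply/andP; split; lra).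
rewrite (oint_split (bkernel s) _ r0)// mulrDr addrA; congr (_ + _ + _).
  by rewrite mulrCA -expRD; congr (_ * expR _); ring.
rewrite -(@ointZ _ T)//; last lra.
by apply: eq_oint => x _; rewrite /kernel mulrCA -expRD; congr (_ * expR _); ring.
Qed.

Lemma fluid_mass_ge0 t : 0 <= t <= T -> 0 <= u t.
Proof.
move=> tT; rewrite fluid_massE// addr_ge0 ?mulr_ge0 ?expR_ge0//.
apply: oint_ge0 => x xt; rewrite mulr_ge0 ?expR_ge0// lam_ge0//; lra.
Qed.

(** Measurable because t |-> u(t) e^(mu t) is nondecreasing; clamping the time to
    [0, T] extends this monotone function to the whole line. *)
Lemma bounded_measurable_fluid_mass : bounded_measurable T u.
Proof.
have uE (t : R) : t \in `[0, T] -> u t =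
    expR (- (mu * t)) * (u0 + oint (kernel 0) 0 t).
  rewrite in_itv/= => tT; rewrite fluid_massE// mulrDr; congr (_ + _).
    by rewrite mulrC.
  case/andP: tT => t0 tT; rewrite -(@ointZ _ T)//.
  by apply: eq_oint => x _; rewrite /kernel mulrCA -expRD; congr (_ * expR _); ring.
pose E t := oint (kernel 0) 0 (Num.min (Num.max t 0) T).
have E_nd : nondecreasing_fun E.
  move=> s t st; rewrite /E.
  set s' := Num.min _ _; set t' := Num.min _ _.
  have s'0 : 0 <= s' by rewrite /s' le_min T_ge0 le_max lexx orbT.
  have s't' : s' <= t'.
    rewrite /s' /t' le_min !ge_min lexx orbT andbT ge_max !le_max st lexx.
    by rewrite orbT.
  have t'T : t' <= T by rewrite /t' ge_min lexx orbT.
  rewrite (@oint_split _ T (kernel 0) 0 s' t')// lerDl.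
  apply: oint_ge0 => x /andP[sx xt]; rewrite mulr_ge0 ?expR_ge0// lam_ge0//; lra.
have [_ [M lamle]] := lamM.
have M0 : 0 <= M by apply: le_trans (lamle 0 _); rewrite ?lexx.
split.
  apply: (@eq_measurable_fun _ _ _ _ _
    (fun t => expR (- (mu * t)) * (u0 + E t))).
    move=> t; rewrite inE/= => tT; rewrite uE//; move: tT; rewrite in_itv/=.
    move=> /andP[t0 tT]; rewrite /E max_l// min_l//.
  apply: measurable_funM.
    apply: measurable_funTS; apply: continuous_measurable_fun => x.
    apply: continuous_comp; last exact: continuous_expR.
    by apply: cvgN; apply: cvgM; [exact: cvg_cst|exact: cvg_id].
  apply: measurable_funD; first exact: measurable_cst.
  exact: nondecreasing_measurable.
exists (u0 + M * T) => t tT; rewrite ger0_norm ?fluid_mass_ge0//.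
case/andP: (tT) => t0 tT'.
rewrite fluid_massE//; apply: lerD.
  rewrite ler_piMr// -expR0 ler_expR oppr_le0 mulr_ge0// ltW//.
apply: (@le_trans _ _ (oint (fun=> M) 0 t)).
  apply: (@le_oint _ T) => //; first exact: bounded_measurable_cst.
  move=> x /andP[x0 xt].
  have xT : 0 <= x <= T by apply/andP; split; lra.
  have lx : lam x <= M by rewrite (le_trans (ler_norm _))// lamle.
  rewrite /kernel (le_trans _ lx)// ler_piMr ?lam_ge0//.
  by rewrite -expR0 ler_expR oppr_le0 mulr_ge0 ?subr_ge0 ?(ltW mu_gt0).
by rewrite oint_cst// subr0 ler_wpM2l.
Qed.

(** One half of the equation u' = lam - mu u.  By [fluid_mass_step] it holds over
    a window of length h with a defect of order h^2, uniformly in the window;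
    [additive_quadratic_ge0] removes the defect. *)
Lemma fluid_mass_drift r s : 0 <= r -> r <= s -> s <= T ->
  oint (fun x => lam x - mu * u x) r s <= u s - u r.
Proof.
have bu := bounded_measurable_fluid_mass.
have bmu : bounded_measurable T (fun x => mu * u x) by exact: bounded_measurableZ.
have bd : bounded_measurable T (fun x => lam x - mu * u x).
  exact: bounded_measurableB.
have [_ [U uU]] := bu.
have [_ [M lamle]] := lamM.
have M0 : 0 <= M by apply: le_trans (lamle 0 _); rewrite ?lexx.
have U0 : 0 <= U by apply: le_trans (uU 0 _); rewrite ?lexx.
move=> r0 rs sT; rewrite -subr_ge0.
pose D r s := u s - u r - oint (fun x => lam x - mu * u x) r s.
apply: (@additive_quadratic_ge0 _ D 0 T (mu * M + mu ^+ 2 * U)) => //.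
  move=> a b c a0 ab bc cT; rewrite /D (oint_split bd a0 ab bc cT); ring.
move=> {r s r0 rs sT} r s r0 rs sT; rewrite /D.
set h := s - r.
have h0 : 0 <= h by rewrite /h; lra.
have rT : r <= T by lra.
have ur0 : 0 <= u r by rewrite fluid_mass_ge0// r0.
have urU : u r <= U.
  by rewrite (le_trans (ler_norm _))// uU// r0.
have expge c : 1 - mu * c <= expR (- (mu * c)).
  by rewrite (le_trans _ (expR_ge1Dx _)).
have arr : (1 - mu * h) * oint lam r s <=
    oint (fun x => lam x * expR (- (mu * (s - x)))) r s.
  rewrite -(@ointZ _ T)//; apply: (@le_oint _ T) => //.
  - exact: bounded_measurableZ.
  - exact: bkernel.
  - move=> x /andP[rx xs]; rewrite mulrC ler_wpM2l//.
      by rewrite lam_ge0//; lra.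
    rewrite (le_trans _ (expge _))// lerD2l lerN2 ler_pM2l// /h; lra.
have lamh : oint lam r s <= M * h.
  rewrite -oint_cst//; apply: (@le_oint _ T) => //.
    exact: bounded_measurable_cst.
  move=> x /andP[rx xs]; rewrite (le_trans (ler_norm _))// lamle//; lra.
have lam0 : 0 <= oint lam r s.
  by apply: oint_ge0 => x /andP[rx xs]; rewrite lam_ge0//; lra.
have uh : (1 - mu * h) * u r * h <= oint u r s.
  rewrite -oint_cst//; apply: (@le_oint _ T) => //.
    exact: bounded_measurable_cst.
  move=> x /andP[rx xs]; rewrite (@fluid_mass_step r x)//; try lra.
  have : (1 - mu * h) * u r <= expR (- (mu * (x - r))) * u r.
    rewrite ler_wpM2r// (le_trans _ (expge _))// lerD2l lerN2 ler_pM2l// /h; lra.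
  move=> h1; apply: (le_trans h1); rewrite lerDl; apply: oint_ge0 => y /andP[ry yx].
  by rewrite mulr_ge0 ?expR_ge0// lam_ge0//; lra.
rewrite (ointB lamM bmu)// (ointZ _ bu)// (@fluid_mass_step r s)// -/h.
have e1 : (1 - mu * h) * u r <= expR (- (mu * h)) * u r.
  by rewrite ler_wpM2r.
have e2 : mu * ((1 - mu * h) * u r * h) <= mu * oint u r s by rewrite ler_pM2l.
have e3 : (mu * h) * oint lam r s <= (mu * h) * (M * h).
  by rewrite ler_wpM2l// mulr_ge0// ltW.
have e4 : mu ^+ 2 * h ^+ 2 * u r <= mu ^+ 2 * h ^+ 2 * U.
  by rewrite ler_wpM2l// mulr_ge0// exprn_ge0// ltW.
nra.
Qed.

Lemma fluid_mass_upper (rmax : R) r t : 0 <= r -> r <= t -> t <= T ->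
  (forall x, r <= x <= t -> lam x <= rmax * mu) ->
  u t <= rmax + (u r - rmax) * expR (- (mu * (t - r))).
Proof.
move=> r0 rt tT lammax; rewrite (@fluid_mass_step r t)//.
have : oint (fun x => lam x * expR (- (mu * (t - x)))) r t <=
    oint (fun x => rmax * (mu * expR (mu * (x - t)))) r t.
  have bE : bounded_measurable T (fun x => rmax * (mu * expR (mu * (x - t)))).
    do 2 apply: bounded_measurableZ.
    have := bexp t; congr bounded_measurable; apply/funext => x.
    by congr expR; ring.
  apply: (@le_oint _ T) => //; first exact: bkernel.
  move=> x /andP[rx xt]; rewrite mulrA (_ : - _ = mu * (x - t)); last ring.
  by rewrite ler_wpM2r ?expR_ge0// lammax//; lra.
rewrite (@ointZ _ T)//; last first.
  apply: bounded_measurableZ.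
  have := bexp t; congr bounded_measurable; apply/funext => x.
  by congr expR; ring.
rewrite oint_expR// subrr mulr0 expR0 (_ : mu * (r - t) = - (mu * (t - r))); last ring.
move=> h; lra.
Qed.

Lemma fluid_mass_lower (rmin : R) r t : 0 <= r -> r <= t -> t <= T ->
  (forall x, r <= x <= t -> rmin * mu <= lam x) ->
  rmin * (1 - expR (- (mu * (t - r)))) <= u t.
Proof.
move=> r0 rt tT lammin; rewrite (@fluid_mass_step r t)//.
have : oint (fun x => rmin * (mu * expR (mu * (x - t)))) r t <=
   oint (fun x => lam x * expR (- (mu * (t - x)))) r t.
  have bE : bounded_measurable T (fun x => rmin * (mu * expR (mu * (x - t)))).
    do 2 apply: bounded_measurableZ.
    have := bexp t; congr bounded_measurable; apply/funext => x.
    by congr expR; ring.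
  apply: (@le_oint _ T) => //; first exact: bkernel.
  move=> x /andP[rx xt]; rewrite mulrA (_ : - _ = mu * (x - t)); last ring.
  by rewrite ler_wpM2r ?expR_ge0// lammin//; lra.
rewrite (@ointZ _ T)//; last first.
  apply: bounded_measurableZ.
  have := bexp t; congr bounded_measurable; apply/funext => x.
  by congr expR; ring.
rewrite oint_expR// subrr mulr0 expR0 (_ : mu * (r - t) = - (mu * (t - r))); last ring.
have : 0 <= expR (- (mu * (t - r))) * u r.
  by rewrite mulr_ge0 ?expR_ge0// fluid_mass_ge0//; lra.
move=> h1 h2; lra.
Qed.

End fluid.

(** * Almost sure properties of the primitives *)
Section almost_everywhere_products.
Context {R : realType} {d1 d2 : measure_display}.
Context {O1 : measurableType d1} {O2 : measurableType d2}.
Variables (P1 : {measure set O1 -> \bar R}) (P2 : probability O2 R).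

Lemma ae_fst (Q : O1 -> Prop) : {ae P1, forall x, Q x} ->
  {ae (P1 \x P2)%E, forall w, Q w.1}.
Proof.
move=> [A [mA PA QA]]; exists (A `*` setT); split.
- exact: measurableX.
- transitivity (P1 A * P2 setT)%E; first exact: product_measure1E.
  by rewrite [P1 A]PA mul0e.
- by move=> w Qw; split => //; exact: QA.
Qed.

Lemma ae_snd (Q : O2 -> Prop) : {ae P2, forall x, Q x} ->
  {ae (P1 \x P2)%E, forall w, Q w.2}.
Proof.
move=> [A [mA PA QA]]; exists (setT `*` A); split.
- exact: measurableX.
- transitivity (P1 setT * P2 A)%E; first exact: product_measure1E.
  by rewrite [P2 A]PA mule0.
- by move=> w Qw; split => //; exact: QA.
Qed.

End almost_everywhere_products.

Section poisson_tails.
Context {R : realType} {d : measure_display} {O : measurableType d}.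
Variable P : probability O R.

Lemma sum_poisson_pmf (r : R) : 0 < r ->
  (\sum_(k <oo) (poisson_pmf r k)%:E = 1)%E.
Proof.
move=> r0; rewrite nneseries_esumT; last first.
  by move=> k; rewrite lee_fin poisson_pmf_ge0.
have : (poisson_prob r 0 setT = 1)%E := probability_setT (poisson_prob r 0).
by rewrite /poisson_prob r0.
Qed.

(** Exponential tilting: multiplied by e^(theta k), the Poisson weights of mean r
    become, up to a constant, those of mean r e^theta, which sum to one.
    A positive theta bounds the upper tail and a negative one the lower tail. *)
Lemma poisson_chernoff (X : O -> nat) (r theta y : R) :
  measurable_fun [set: O] X -> 0 < r ->
  (forall k, P [set w | X w = k] = (poisson_pmf r k)%:E) ->
  (P [set w | (theta * y <= theta * (X w)%:R)%R] <=
    (expR (r * (expR theta - 1) - theta * y))%:E)%E.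
Proof.
move=> mX r0 lawX.
pose A k := [set w | X w = k /\ theta * y <= theta * k%:R].
have mXk k : measurable [set w | X w = k].
  by rewrite -[X in measurable X]setTI; exact: (mX measurableT [set k]).
have mA k : measurable (A k).
  have [le|nle] := pselect (theta * y <= theta * k%:R).
    rewrite (_ : A k = [set w | X w = k]); first exact: mXk.
    by apply/seteqP; split => w //= [].
  by rewrite (_ : A k = set0)//; apply/seteqP; split => w //= [].
have AE : [set w | theta * y <= theta * (X w)%:R] = \bigcup_k A k.
  apply/seteqP; split => [w /= h|w [k _ [/= -> //]]].
  by exists (X w).
rewrite AE; apply: (@le_trans _ _ (\sum_(k <oo) P (A k))%E).
  by apply: measure_sigma_subadditive => //; exact: bigcup_measurable.
pose c := expR (r * (expR theta - 1) - theta * y).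
have re0 : 0 < r * expR theta by rewrite mulr_gt0 ?expR_gt0.
apply: (@le_trans _ _
  (\sum_(k <oo) (c%:E * (poisson_pmf (r * expR theta) k)%:E))%E); last first.
  rewrite nneseriesZl; last by move=> k _; rewrite lee_fin poisson_pmf_ge0.
  by rewrite sum_poisson_pmf// mule1.
apply: lee_nneseries => // k _.
have [le|nle] := pselect (theta * y <= theta * k%:R); last first.
  rewrite (_ : A k = set0) ?measure0; last first.
    by apply/seteqP; split => w //= [].
  by rewrite -EFinM lee_fin mulr_ge0 ?expR_ge0 ?poisson_pmf_ge0.
apply: (@le_trans _ _ (P [set w | X w = k])).
  by apply: le_measure; rewrite ?inE// => w [].
rewrite lawX -EFinM lee_fin /poisson_pmf r0 re0 /c exprMn -expRM_natr.
rewrite mulrCA -!mulrA ler_wpM2l ?exprn_ge0 ?(ltW r0)//.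
rewrite [leRHS]mulrCA ler_wpM2l ?invr_ge0//.
by rewrite -!expRD ler_expR; lra.
Qed.

Lemma expR_le_quadratic (x : R) : `|x| <= 2^-1 -> expR x - 1 - x <= 2 * x ^+ 2.
Proof.
rewrite ler_norml => /andP[x1 x2].
have : (expR x)^-1 >= 1 - x by rewrite -expRN expR_ge1Dx.
rewrite -[X in X <= _]invrK lef_pV2 ?posrE ?expR_gt0 ?invr_gt0//; last lra.
move=> h; have -> : expR x - 1 - x = expR x - (1 + x) by ring.
rewrite lerBlDr (le_trans h)// -[leRHS]mul1r -ler_pdivrMr; last by nra.
rewrite -invfM -[leRHS]invr1 lef_pV2 ?posrE//; nra.
Qed.

(** For theta = r^(-1/2) or - r^(-1/2) the second-order term
    r (e^theta - 1 - theta) of the Chernoff exponent is at most 2. *)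
Lemma poisson_deviation (X : O -> nat) (r z : R) :
  measurable_fun [set: O] X -> 4 <= r -> 0 <= z ->
  (forall k, P [set w | X w = k] = (poisson_pmf r k)%:E) ->
  (P [set w | (Num.sqrt r * z <= `|(X w)%:R - r|)%R] <=
    (2 * expR (2 - z))%:E)%E.
Proof.
move=> mX r4 z0 lawX.
have r0 : 0 < r by lra.
have sr0 : 0 < Num.sqrt r by rewrite sqrtr_gt0.
have sr2 : Num.sqrt r ^+ 2 = r by rewrite sqr_sqrtr// ltW.
have sr_ge2 : 2 <= Num.sqrt r.
  rewrite -(@ler_pXn2r _ 2)// ?nnegrE ?ler0n ?(ltW sr0)// sr2; lra.
pose th := (Num.sqrt r)^-1.
have th_le : `|th| <= 2^-1.
  by rewrite ger0_norm ?invr_ge0 ?(ltW sr0)// lef_pV2 ?posrE//.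
have th0 : 0 < th by rewrite invr_gt0.
have ths : th * Num.sqrt r = 1 by rewrite mulVf// gt_eqF.
have rth : r * th ^+ 2 = 1 by rewrite -sr2 -exprMn mulrC ths expr1n.
pose Up := [set w | th * (r + Num.sqrt r * z) <= th * (X w)%:R].
pose Dn := [set w | - th * (r - Num.sqrt r * z) <= - th * (X w)%:R].
have mset (a b : R) : measurable [set w | a <= b * (X w)%:R].
  rewrite -[X in measurable X]setTI.
  exact: (mX measurableT [set k : nat | a <= b * k%:R]).
have mU : measurable Up by exact: mset.
have mD : measurable Dn by exact: mset.
have sub : [set w | Num.sqrt r * z <= `|(X w)%:R - r| ] `<=` Up `|` Dn.
  move=> w /=; rewrite ler_normr => /orP[h|h]; [left|right].
    by rewrite /Up/= ler_pM2l//; lra.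
  by rewrite /Dn/= !mulNr lerN2 ler_pM2l//; lra.
have mE : measurable [set w | Num.sqrt r * z <= `|(X w)%:R - r| ].
  rewrite -[X in measurable X]setTI.
  exact: (mX measurableT [set k : nat | Num.sqrt r * z <= `|k%:R - r|]).
apply: (@le_trans _ _ (P (Up `|` Dn))).
  by apply: le_measure; rewrite ?inE//; exact: measurableU.
apply: (le_trans (measureU2 P mU mD)).
have bound (t y : R) : `|t| <= 2^-1 -> r * t ^+ 2 = 1 -> t * y = t * r + z ->
    (P [set w | (t * y <= t * (X w)%:R)%R] <= (expR (2 - z))%:E)%E.
  move=> t2 rt ty; apply: (le_trans (poisson_chernoff _ _ mX r0 lawX)).
  rewrite lee_fin ler_expR ty.
  have := expR_le_quadratic t2 => h.
  have : r * (expR t - 1 - t) <= r * (2 * t ^+ 2) by rewrite ler_pM2l.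
  rewrite [leRHS]mulrCA rt; nra.
rewrite (_ : 2 * _ = expR (2 - z) + expR (2 - z)); last ring.
rewrite EFinD; apply: leeD; apply: bound => //.
- by rewrite mulrDr mulrA ths mul1r.
- by rewrite normrN.
- by rewrite sqrrN.
- by rewrite !mulNr mulrBr mulrA ths mul1r opprB addrC.
Qed.

End poisson_tails.

Section poisson_fluctuations.
Context {R : realType}.

Lemma expRN_le_inv_square (p : nat) (x : R) : (0 < p)%N -> 1 <= x ->
  expR (- (x `^ p%:R^-1)) <= ((2 * p)`!)%:R / x ^+ 2.
Proof.
move=> p0 x1; have x0 : 0 < x by lra.
pose y := x `^ p%:R^-1.
have y0 : 0 <= y by exact: powR_ge0.
have p20 : (2 * p)%N = (2 * p).-1.+1 by rewrite prednK// muln_gt0.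
have yE : y ^+ (2 * p) = x ^+ 2.
  rewrite -powR_mulrn// /y -powRrM natrM mulrC -mulrA mulfV ?mulr1.
    by rewrite powR_mulrn// ltW.
  by rewrite pnatr_eq0 -lt0n.
have h : x ^+ 2 / (2 * p)`!%:R <= expR y.
  have := expR_ge1Dxn (2 * p).-1 y0; rewrite -p20 yE; lra.
rewrite expRN -[leRHS]invrK lef_pV2 ?posrE ?expR_gt0 ?invr_gt0//.
  by rewrite invfM invrK mulrC.
by rewrite divr_gt0// ?exprn_gt0// ltr0n fact_gt0.
Qed.

(** The sum starts at 4, the smallest mean to which [poisson_deviation] applies;
   it telescopes against 1/(k+1) - 1/(k+2). *)
Lemma sum_inv_square_lty :
  (\sum_(k <oo) ((k.+4%:R : R) ^- 2)%:E < +oo)%E.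
Proof.
apply: (@le_lt_trans _ _ 1%E); last exact: ltry.
apply: lime_le.
  by apply: is_cvg_nneseries => k _ _; rewrite lee_fin invr_ge0 exprn_ge0.
apply: nearW => n; rewrite sumEFin lee_fin.
suff : \sum_(0 <= k < n) (k.+4%:R : R) ^- 2 <= 1 - n.+1%:R^-1.
  by move=> /le_trans; apply; rewrite gerBl invr_ge0.
elim: n => [|n IH]; first by rewrite big_geq// invr1 subrr.
rewrite big_nat_recr//=; apply: (le_trans (lerD IH (lexx _))).
have n1 : 0 < n.+1%:R :> R by rewrite ltr0n.
have n2 : 0 < n.+2%:R :> R by rewrite ltr0n.
have n4 : 0 < n.+4%:R :> R by rewrite ltr0n.
have e : (n.+1%:R)^-1 - (n.+2%:R)^-1 = (n.+1%:R * n.+2%:R)^-1 :> R.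
  rewrite -(natr1 n.+1); move: (n.+1%:R : R) n1 => a a0.
  by field; rewrite !gt_eqF ?addr_gt0.
suff : (n.+4%:R : R) ^- 2 <= (n.+1%:R * n.+2%:R)^-1.
  rewrite -e.
  move: (n.+4%:R ^- 2 : R) (n.+1%:R^-1 : R) (n.+2%:R^-1 : R) => z x y *; lra.
rewrite lef_pV2 ?posrE ?mulr_gt0 ?exprn_gt0// expr2.
by apply: ler_pM; rewrite ?ler0n// ler_nat; lia.
Qed.

Context {d : measure_display} {O : measurableType d}.
Variables (P : probability O R) (N : R -> O -> nat).
Hypothesis N_poisson : unit_poisson_process P N.

Let lawN (t : R) k : 0 < t -> P [set w | N t w = k] = (poisson_pmf t k)%:E.
Proof.
move=> t0; have := poisson_increment_law N_poisson k (lexx 0) t0.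
rewrite subr0 => <-; congr (P _); apply/seteqP; split => w /=;
  by rewrite (poisson_start N_poisson) subn0.
Qed.

(** Borel-Cantelli: a deviation of more than sqrt k k^(1/p) has a probability of
    order e^(- k^(1/p)), hence O(k^-2), at the integer time k. *)
Lemma poisson_integer_deviation (p : nat) : (0 < p)%N ->
  {ae P, forall w, exists k0 : nat, forall k, (k0 <= k)%N ->
    `|(N k%:R w)%:R - k%:R| <= k%:R `^ (2^-1 + p%:R^-1) :> R}.
Proof.
move=> p0.
pose F k := [set w | Num.sqrt (k.+4%:R : R) * k.+4%:R `^ p%:R^-1 <=
   `|(N k.+4%:R w)%:R - k.+4%:R|].
have mN k : measurable_fun setT (N k%:R).
  exact: poisson_measurable N_poisson _ (ler0n _ _).
have mF k : measurable (F k).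
  rewrite -[X in measurable X]setTI.
  exact: (mN k.+4 measurableT [set j : nat |
    Num.sqrt (k.+4%:R : R) * k.+4%:R `^ p%:R^-1 <= `|j%:R - k.+4%:R|]).
pose C : R := 2 * expR 2 * ((2 * p)`!)%:R.
have C0 : 0 <= C by rewrite !mulr_ge0// expR_ge0.
have PF k : (P (F k) <= (C * k.+4%:R ^- 2)%:E)%E.
  have k4 : 4 <= k.+4%:R :> R by rewrite (ler_nat _ 4).
  apply: (le_trans (poisson_deviation (mN k.+4) k4 (powR_ge0 _ _) _)).
    by move=> j; apply: lawN; rewrite ltr0n.
  rewrite lee_fin expRD mulrA /C -[leRHS]mulrA ler_wpM2l ?mulr_ge0 ?expR_ge0//.
  by apply: expRN_le_inv_square => //; lra.
have : (\sum_(k <oo) P (F k) < +oo)%E.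
  apply: (@le_lt_trans _ _ (\sum_(k <oo) (C%:E * ((k.+4%:R : R) ^- 2)%:E))%E).
    by apply: lee_nneseries => // k _; exact: PF.
  rewrite nneseriesZl //.
  by apply: lte_mul_pinfty => //; exact: sum_inv_square_lty.
move=> /(lim_sup_set_cvg0 mF) F0.
exists (lim_sup_set F); split => //.
  by apply: bigcap_measurable => // k _; exact: bigcup_measurable.
move=> w /= nQ n _; apply: contrapT => nF; apply: nQ.
exists (n + 4)%N => k nk; rewrite leNgt; apply/negP => dev.
apply: nF; exists (k - 4)%N; first by rewrite /= leq_subRL; lia.
have kE : (k - 4).+4 = k by lia.
rewrite /F /= kE ltW// -powR12_sqrt// -powRD ?dev//.
by apply/implyP => _; rewrite pnatr_eq0; lia.
Qed.

End poisson_fluctuations.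

Section sample_paths.
Context {R : realType}.

(** After division by n: the noise of a process run over a time of order n is
    o(n^(- gamma)) for every gamma < 1/2. *)
Definition subdiffusive (N : R -> nat) : Prop :=
  forall gamma C eps : R, 0 <= gamma < 2^-1 -> 0 <= C -> 0 < eps ->
  \forall n \near \oo, forall x, 0 <= x <= C * n%:R ->
    `|(N x)%:R - x| <= eps * n%:R `^ (1 - gamma).

(** For a nondecreasing N this says that N jumps by at most one, without
    mentioning left limits. *)
Definition unit_jumps (N : R -> nat) : Prop :=
  forall x, 0 < x -> exists y, 0 <= y < x /\ (N x <= (N y).+1)%N.

Lemma near_powR_ge (K d : R) : 0 < d ->
  \forall n \near \oo, K <= n%:R `^ d.
Proof.
move=> d0; near=> n.
have K0 : 0 <= `|K| by exact: normr_ge0.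
apply: (le_trans (ler_norm _)).
have -> : `|K| = (`|K| `^ d^-1) `^ d.
  by rewrite -powRrM mulVf ?gt_eqF// powRr1.
apply: ge0_ler_powR; rewrite ?nnegrE ?(ltW d0) ?powR_ge0//.
near: n; exact: nbhs_infty_ger.
Unshelve. all: by end_near. Qed.

(** By monotonicity N x lies between the values of N at the two integers around
    x.  The finitely many integers below k0 contribute a constant A, and the
    power n^d with d = (1/2 - gamma) / 2 absorbs all the constants. *)
Lemma subdiffusive_of_integers (N : R -> nat) :
  (forall s t : R, 0 <= s -> s <= t -> (N s <= N t)%N) ->
  (forall p, (0 < p)%N -> exists k0 : nat, forall k, (k0 <= k)%N ->
    `|(N k%:R)%:R - k%:R| <= k%:R `^ (2^-1 + p%:R^-1) :> R) ->
  subdiffusive N.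
Proof.
move=> Nmono devN gamma C eps /andP[g0 g2] C0 eps0.
pose d := (2^-1 - gamma) / 2.
have d0 : 0 < d by rewrite /d; lra.
pose p := Num.bound d^-1.
have dp : d^-1 < p%:R by apply: archi_boundP; rewrite invr_ge0 ltW.
have p0 : (0 < p)%N.
  by rewrite -(ltr0n R); apply: le_lt_trans dp; rewrite invr_ge0 ltW.
have pR0 : 0 < p%:R :> R by rewrite ltr0n.
have pd : p%:R^-1 <= d.
  by rewrite -[d]invrK lef_pV2 ?posrE ?invr_gt0// ltW.
pose b : R := 2^-1 + p%:R^-1.
have b0 : 0 < b by rewrite /b addr_gt0// ?invr_gt0.
have b1 : b <= 1 by rewrite /b; rewrite /d in pd; lra.
have bd : b + d <= 1 - gamma by rewrite /b; rewrite /d in pd *; lra.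
have [k0 devk] := devN p p0.
pose A : R := \sum_(0 <= k < k0) `|(N k%:R)%:R - k%:R|.
have A0 : 0 <= A by apply: sumr_ge0.
have dev k : `|(N k%:R)%:R - k%:R| <= A + k%:R `^ b.
  have [k0k|kk0] := leqP k0 k.
    by rewrite (le_trans (devk _ k0k))// lerDr.
  rewrite /A big_mkord (bigD1 (Ordinal kk0))//= -addrA lerDl.
  by rewrite addr_ge0 ?powR_ge0//; exact: sumr_ge0.
pose K := A + C + 2.
near=> n => x /andP[x0 xC].
have n1 : 1 <= n%:R :> R.
  by near: n; exact: nbhs_infty_ger.
have npd : K / eps <= n%:R `^ d by near: n; exact: near_powR_ge.
pose k := Num.truncn x.
have /andP[kx xk] := truncn_itv x0; rewrite -/k in kx xk.
have Nk : (N k%:R)%:R <= (N x)%:R :> R by rewrite ler_nat Nmono.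
have Nk1 : (N x)%:R <= (N k.+1%:R)%:R :> R by rewrite ler_nat Nmono// ltW.
have := dev k; have := dev k.+1.
have kC : k.+1%:R `^ b <= (C + 1) * n%:R `^ b.
  apply: (@le_trans _ _ (((C + 1) * n%:R) `^ b)).
    apply: ge0_ler_powR; rewrite ?nnegrE ?ler0n ?mulr_ge0 ?addr_ge0 ?(ltW b0)//.
    have : k.+1%:R <= C * n%:R + 1 by rewrite -natr1; lra.
    lra.
  rewrite powRM ?addr_ge0// ler_wpM2r ?powR_ge0// ler1_powR//; lra.
have kk1 : k%:R `^ b <= k.+1%:R `^ b.
  by apply: ge0_ler_powR; rewrite ?nnegrE ?ler0n ?(ltW b0)// ler_nat.
have nb1 : 1 <= n%:R `^ b by have := ler_powR n1 (ltW b0); rewrite powRr0.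
have Kb : K * n%:R `^ b <= eps * n%:R `^ (1 - gamma).
  apply: (@le_trans _ _ (eps * n%:R `^ (b + d))); last first.
    by rewrite ler_wpM2l ?(ltW eps0)// ler_powR.
  rewrite powRD; last by rewrite (gt_eqF (_ : 0 < b + d))// addr_gt0.
  rewrite mulrCA mulrC ler_wpM2l ?powR_ge0//.
  by rewrite -ler_pdivrMl// mulrC.
have An : A <= A * n%:R `^ b by rewrite ler_peMr.
have kkE : k.+1%:R = k%:R + 1 :> R by rewrite natr1.
rewrite !ler_norml => /andP[h1 h2] /andP[h3 h4].
by apply/andP; split; rewrite /K in Kb; lra.
Unshelve. all: by end_near. Qed.

Section of_poisson.
Context {d : measure_display} {O : measurableType d}.
Variables (P : probability O R) (N : R -> O -> nat).
Hypothesis N_poisson : unit_poisson_process P N.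

Lemma ae_subdiffusive : {ae P, forall w, subdiffusive (N ^~ w)}.
Proof.
have := ae_foralln (fun p => poisson_integer_deviation N_poisson (ltn0Sn p)).
apply: filterS => w dev; apply: subdiffusive_of_integers.
  by move=> s t; exact: (poisson_monotone N_poisson).
by move=> [|p]// _; exact: dev.
Qed.

Lemma poisson_double_jump (s h : R) : 0 <= s -> 0 < h ->
  (P [set w | (2 <= N (s + h) w - N s w)%N] <= (h ^+ 2)%:E)%E.
Proof.
move=> s0 h0.
have sh : s < s + h by rewrite ltrDl.
pose X w := (N (s + h) w - N s w)%N.
have mX : measurable_fun setT X.
  by apply: measurable_fun_subn; apply: poisson_measurable N_poisson _ _;
    rewrite // addr_ge0// ltW.
have mXA A : measurable [set w | A (X w)].
  by rewrite -[X in measurable X]setTI; exact: (mX measurableT A).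
have law k : P [set w | X w = k] = (poisson_pmf h k)%:E.
  rewrite (poisson_increment_law N_poisson k s0 sh); congr (poisson_pmf _ _)%:E.
  by rewrite addrC addKr.
have -> : [set w | (2 <= X w)%N] = ~` ([set w | X w = 0%N] `|` [set w | X w = 1%N]).
  apply/seteqP; split => w /=.
    by move=> h2 [] e; rewrite e in h2.
  by case: (X w) => [|[|]]// nh; exfalso; apply: nh; [left|right].
have m0 : measurable [set w | X w = 0%N] by exact: mXA [set 0%N].
have m1 : measurable [set w | X w = 1%N] by exact: mXA [set 1%N].
have PU : P ([set w | X w = 0%N] `|` [set w | X w = 1%N]) =
    ((poisson_pmf h 0)%:E + (poisson_pmf h 1)%:E)%E.
  rewrite -(law 0%N) -(law 1%N); apply: measureU => //.
  by apply/seteqP; split => w //= [->].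
have -> := @probability_setC _ _ _ P _ (measurableU _ _ m0 m1).
rewrite PU lee_fin /poisson_pmf h0 expr0 expr1 fact0 (_ : 1`! = 1%N)// !divr1.
have := expR_ge1Dx (- h); set e := expR (- h) => e1.
have : (1 - h) * (1 + h) <= e * (1 + h) by rewrite ler_wpM2r//; lra.
lra.
Qed.

(** Cut [0, K] into cells of length 1/(M+1).  A double jump at x puts two points
    into the cell that contains x, for every M; but the probability that some
    cell contains two points is at most K (M+1) (M+1)^-2 = K/(M+1). *)
Lemma ae_unit_jumps : {ae P, forall w, unit_jumps (N ^~ w)}.
Proof.
pose step (M j : nat) : R := j%:R / M.+1%:R.
pose F (K M j : nat) := [set w | (2 <= N (step M j + M.+1%:R^-1) w - N (step M j) w)%N].
have step0 M j : 0 <= step M j by rewrite divr_ge0.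
have h0 M : 0 < M.+1%:R^-1 :> R by rewrite invr_gt0 ltr0n.
have mF K M j : measurable (F K M j).
  have mX : measurable_fun setT
      (fun w => N (step M j + M.+1%:R^-1) w - N (step M j) w)%N.
    by apply: measurable_fun_subn; apply: poisson_measurable N_poisson _ _;
      rewrite // addr_ge0// ltW.
  rewrite -[X in measurable X]setTI; exact: (mX measurableT [set k | (2 <= k)%N]).
pose D K M := \big[setU/set0]_(j < K * M.+1) F K M j.
have mD K M : measurable (D K M) by apply: bigsetU_measurable => j _; exact: mF.
have PD K M : (P (D K M) <= (K%:R / M.+1%:R)%:E)%E.
  apply: (le_trans (Boole_inequality _ _)) => //.
  apply: (@le_trans _ _ (\sum_(j < K * M.+1) ((M.+1%:R : R)^-1 ^+ 2)%:E)%E).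
    by apply: lee_sum => j _; exact: poisson_double_jump.
  rewrite sumEFin lee_fin sumr_const card_ord -[_ *+ (K * _)]mulr_natl natrM expr2.
  by rewrite -mulrA mulVKf// pnatr_eq0.
have null K : P.-negligible (\bigcap_M D K M).
  exists (\bigcap_M D K M); split => //; first exact: bigcapT_measurable.
  apply/eqP; rewrite eq_le measure_ge0 andbT.
  apply/lee_addgt0Pr => e e0; rewrite add0e.
  pose M := Num.bound (K%:R / e).
  have KM : K%:R / e < M%:R by apply: archi_boundP; rewrite divr_ge0// ltW.
  apply: (@le_trans _ _ (P (D K M))).
    by apply: le_measure; rewrite ?inE//; [exact: bigcapT_measurable|exact: bigcap_inf].
  apply: (le_trans (PD K M)); rewrite lee_fin ler_pdivrMr// -ler_pdivrMl//.
  by rewrite mulrC (le_trans (ltW KM))// ler_nat.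
apply: negligibleS (negligible_bigcup null) => w /= bad.
move/existsNP : bad => [x /not_implyP[x0 bad]].
have big y : 0 <= y < x -> (N y w + 2 <= N x w)%N.
  by move=> yx; rewrite leqNgt; apply/negP => lt; apply: bad; exists y; split => //; lia.
pose K := Num.bound x.
have xK : x < K%:R by apply: archi_boundP; exact: ltW.
exists K => // M _.
pose m := (M.+1%:R : R).
have m0 : 0 < m by rewrite ltr0n.
have xm0 : 0 < x * m by rewrite mulr_gt0.
have exj : exists j : nat, x * m <= j.+1%:R.
  exists (Num.bound (x * m)); apply: ltW; apply: (lt_trans (archi_boundP (ltW xm0))).
  by rewrite ltr_nat.
have [j xj jmin] := ex_minnP exj.
have jx : j%:R < x * m.
  case: j xj jmin => [|j]// _ jmin; rewrite ltNge; apply/negP => /jmin.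
  by rewrite ltnn.
have jK : (j < K * M.+1)%N.
  rewrite -(ltr_nat R) natrM; apply: (lt_trans jx); by rewrite ltr_pM2r.
rewrite /D -bigcup_mkord; exists j => //=; rewrite /F /=.
have sx : step M j < x by rewrite /step ltr_pdivrMr.
have xs : x <= step M j + M.+1%:R^-1.
  by rewrite /step -{2}(mul1r M.+1%:R^-1) -mulrDl ler_pdivlMr// natr1.
have := poisson_monotone N_poisson w (ltW x0) xs.
have := big (step M j); rewrite step0 sx => /(_ isT).
lia.
Qed.

End of_poisson.

Lemma ae_uniform_unit_interval d (O : measurableType d) (P : probability O R)
  (U : nat -> {RV P >-> R}) : iid_uniform U ->
  {ae P, forall w, forall j, (0 < j)%N -> 0 <= U j w < 1}.
Proof.
move=> [lawU _]; apply: ae_foralln => j.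
case: j => [|j]; first by apply: aeW.
exists (U j.+1 @^-1` ~` `[0, 1[%classic); split.
- rewrite -[X in measurable X]setTI.
  by apply: measurable_funP => //; exact: measurableC.
- rewrite -[LHS]/(distribution P (U j.+1) (~` `[0, 1[%classic)).
  rewrite lawU//; last exact: measurableC.
  rewrite /uniform_prob integral_uniform_pdf.
  rewrite (_ : _ `&` _ = [set 1]) ?integral_set1//.
  apply/seteqP; split => [x /= []|x /= ->]; rewrite ?in_itv/=.
    by move=> /negP h1 /andP[x0 x1]; apply/eqP; move: h1; rewrite x0/= -leNgt; lra.
  by rewrite ltxx andbF ler01 lexx.
- move=> w /= nw; rewrite in_itv/= => Uw; apply: nw => _; exact: Uw.
Qed.

End sample_paths.

(** * Routing *)
Section routing.
Context {R : realType}.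
Implicit Types (q p : nat -> R) (u v : R).

(** The intervals [p i, p (i+1)[ tile [p a, p b[. *)
Lemma telescope_indicator p v a b : (a <= b)%N ->
  (forall i, p i <= p i.+1) ->
  (\sum_(a <= i < b) ((p i <= v < p i.+1)%R : nat) = (p a <= v < p b)%R)%N.
Proof.
move=> ab pS; elim: b ab => [|b IH].
  by rewrite leqn0 => /eqP ->; rewrite big_geq//; case: leP; case: ltP => //= *; exfalso; lra.
rewrite leq_eqVlt ltnS => /predU1P[->|ab].
  by rewrite big_geq//; case: leP; case: ltP => //= *; exfalso; lra.
rewrite big_nat_recr//= IH//.
have pab : p a <= p b.
  by elim: b ab {IH} => [|b IH]; [rewrite leqn0 => /eqP ->|
    rewrite leq_eqVlt ltnS => /predU1P[->//|/IH h]; exact: le_trans h (pS b)].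
have := pS b.
clear IH ab.
by case: (leP (p a)); case: (ltP v (p b)); case: (leP (p b) v);
  case: (ltP v (p b.+1)) => //= *; exfalso; lra.
Qed.

Lemma occupancy_antitone q : occupancy q -> forall i j, (i <= j)%N -> q j <= q i.
Proof.
move=> [_ qP] i; elim=> [|j IH]; first by rewrite leqn0 => /eqP ->.
rewrite leq_eqVlt ltnS => /predU1P[->//|/IH].
by apply: le_trans; case: (qP j).
Qed.

Lemma occupancy_le1 q : occupancy q -> forall i, q i <= 1.
Proof. by move=> [_ qP] i; have [/andP[]] := qP i. Qed.

Lemma occupancy_ge0 q : occupancy q -> forall i, 0 <= q i.
Proof. by move=> [_ qP] i; have [/andP[]] := qP i. Qed.

Lemma mem_Jset q u i k : u \in Jset q i.+1 k =
  (q k < 1) && (1 - q i <= u * (1 - q k) < 1 - q i.+1).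
Proof.
rewrite /Jset; case: ifPn => [qk|_] /=; last by rewrite in_set0.
by rewrite mem_setE in_itv/= ler_pdivrMr ?ltr_pdivlMr//; lra.
Qed.

Lemma mem_Iset q u i : u \in Iset q i.+1 = (1 - q i <= u < 1 - q i.+1).
Proof. by rewrite /Iset mem_setE in_itv. Qed.

Variables (Delta : nat) (u : R) (q : nat -> R) (l : nat).
Hypotheses (qocc : occupancy q) (u01 : 0 <= u < 1).

(** In each of the three regimes, distinguished by whether the levels l and
    l + Delta are full, a task is sent to a level of a fixed block: [0, l[,
    [l, l + Delta[ or [l + Delta, oo[.  The level in the block is the one whose
    interval [1 - q i, 1 - q (i+1)[ contains the rescaled u. *)
Lemma route_below i : q l < 1 -> route Delta u q l i.+1 =
  (i < l)%N && (1 - q i <= u * (1 - q l) < 1 - q i.+1).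
Proof.
move=> ql; rewrite /route /= mem_Jset ql (lt_eqF ql) /=.
have qh : q (l + Delta)%N < 1.
  by rewrite (le_lt_trans _ ql)// occupancy_antitone// leq_addr.
by case: ltnP => //= _; rewrite (lt_eqF qh)/= if_same.
Qed.

Lemma route_between i : q l = 1 -> q (l + Delta)%N < 1 ->
  route Delta u q l i.+1 = (l <= i < l + Delta)%N &&
    (1 - q i <= u * (1 - q (l + Delta)%N) < 1 - q i.+1).
Proof.
move=> ql qh; rewrite /route /= !mem_Jset ql ltxx eqxx qh (lt_eqF qh) /=.
by case: ltnP => //= _; case: ltnP.
Qed.

Lemma route_above i : q (l + Delta)%N = 1 ->
  route Delta u q l i.+1 = (l + Delta <= i)%N && (1 - q i <= u < 1 - q i.+1).
Proof.
move=> qh; have ql : q l = 1.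
  apply/eqP; rewrite eq_le occupancy_le1//= -qh occupancy_antitone//.
  exact: leq_addr.
rewrite /route /= !mem_Jset mem_Iset ql qh !ltxx eqxx /=.
by case: ltnP => li /=; case: ltnP => // hi; lia.
Qed.

Let p i := 1 - q i.
Let pS i : p i <= p i.+1.
Proof. by rewrite /p lerD2l lerN2; case: qocc => _ /(_ i)[]. Qed.

Let band_sum (lo hi L : nat) v : (lo <= hi)%N ->
  (\sum_(0 <= i < L) (((lo <= i < hi)%N && (p i <= v < p i.+1)%R) : nat) =
    ((lo <= L)%N && (p lo <= v < p (minn L hi))%R))%N.
Proof.
move=> lohi; have [loL|Llo] := leqP lo L; last first.
  rewrite big_nat big1 => [|i /andP[_ iL]] //=.
  by rewrite leqNgt (ltn_trans iL Llo).
rewrite andTb -telescope_indicator ?leq_min ?loL//.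
rewrite (big_cat_nat (n := lo))//= [X in (X + _)%N]big_nat.
rewrite [X in (X + _)%N]big1 ?add0n; last first.
  by move=> i /andP[_ ilo]; rewrite leqNgt ilo.
rewrite (big_cat_nat (n := minn L hi))/= ?leq_min ?loL ?geq_minl//.
rewrite [X in (_ + X)%N]big_nat [X in (_ + X)%N]big1 ?addn0; last first.
  move=> i /andP[]; rewrite geq_min => h iL; have -> : (i < hi)%N = false by lia.
  by rewrite andbF.
rewrite big_nat [RHS]big_nat; apply: eq_bigr => i.
by rewrite leq_min => /and3P[-> _ ->].
Qed.

Lemma sum_route_le1 L :
  (\sum_(0 <= i < L) (route Delta u q l i.+1 : nat) <= 1)%N.
Proof.
have [ql|ql] := ltP (q l) 1.
  rewrite (eq_bigr (fun i => ((0 <= i < l)%N &&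
    (p i <= u * (1 - q l) < p i.+1) : nat))); last first.
    by move=> i _; rewrite route_below.
  by rewrite band_sum// leq_b1.
have {}ql : q l = 1 by apply/eqP; rewrite eq_le ql occupancy_le1.
have [qh|qh] := ltP (q (l + Delta)%N) 1.
  under eq_bigr do rewrite route_between//.
  by rewrite band_sum ?leq_addr// leq_b1.
have {}qh : q (l + Delta)%N = 1 by apply/eqP; rewrite eq_le qh occupancy_le1.
have -> : (\sum_(0 <= i < L) (route Delta u q l i.+1 : nat) =
  \sum_(0 <= i < L) (((l + Delta <= i < maxn (l + Delta) L)%N &&
     (p i <= u < p i.+1)%R) : nat))%N.
  apply: eq_big_nat => i /andP[_ iL]; rewrite route_above//.
  by rewrite leq_max iL orbT andbT.
by rewrite band_sum ?leq_maxl// leq_b1.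
Qed.

(** The block of levels of the current regime lies below L and its intervals tile
    the whole range of the rescaled u. *)
Lemma sum_route_eq1 L : q (l + Delta)%N < 1 ->
  q l < 1 /\ (l <= L)%N \/ (l + Delta <= L)%N ->
  (\sum_(0 <= i < L) (route Delta u q l i.+1 : nat) = 1)%N.
Proof.
move=> qh cases; have q0 : q 0%N = 1 by case: qocc.
have [ql|ql] := ltP (q l) 1.
  rewrite (eq_bigr (fun i => ((0 <= i < l)%N &&
    (p i <= u * (1 - q l) < p i.+1) : nat))); last first.
    by move=> i _; rewrite route_below.
  have lL : (l <= L)%N by case: cases => [[]|]//; lia.
  rewrite band_sum// (minn_idPr lL) leq0n /p q0 subrr /=.
  have /andP[u0 u1] := u01; have d : 0 < 1 - q l by lra.
  by rewrite mulr_ge0 ?(ltW d)//= gtr_pMl ?u1.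
have {}ql : q l = 1 by apply/eqP; rewrite eq_le ql occupancy_le1.
have hL : (l + Delta <= L)%N by case: cases => [[]|]//; rewrite ql ltxx.
under eq_bigr do rewrite route_between//.
rewrite band_sum ?leq_addr// (minn_idPr hL) (leq_trans (leq_addr _ _) hL).
have /andP[u0 u1] := u01; have d : 0 < 1 - q (l + Delta)%N by lra.
by rewrite /p ql subrr /= mulr_ge0 ?(ltW d)//= gtr_pMl ?u1.
Qed.

Lemma route_eq0_above_high i : q (l + Delta)%N < 1 -> (l + Delta <= i)%N ->
  route Delta u q l i.+1 = false.
Proof.
move=> qh hi; have [ql|ql] := ltP (q l) 1.
  by rewrite route_below// ltnNge (leq_trans (leq_addr _ _) hi).
have {}ql : q l = 1 by apply/eqP; rewrite eq_le ql occupancy_le1.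
by rewrite route_between// ltnNge hi andbF.
Qed.

Lemma route_eq0_above_low i : q l < 1 -> (l <= i)%N ->
  route Delta u q l i.+1 = false.
Proof. by move=> ql li; rewrite route_below// ltnNge li. Qed.

Lemma route_eq0_flat i : q i = q i.+1 -> route Delta u q l i.+1 = false.
Proof.
move=> e; rewrite /route !mem_Jset mem_Iset e !(ltNge _ (1 - _)).
by case: (_ <= _); case: (_ <= _); case: (_ <= _) => //=;
  rewrite ?andbF ?andbT //= ?if_same.
Qed.

End routing.

(** * One-sided limits *)
Section one_sided_limits.
Context {R : realType}.

(** Two points of the lattice (1/n) Z at distance less than 1/n are equal, so a
    convergent lattice-valued function is eventually constant. *)
Lemma left_limit_lattice (n : nat) (f : R -> R) (t : R) : (0 < n)%N -> 0 < t ->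
  (forall s, 0 <= s < t -> exists z : int, n%:R * f s = z%:~R) ->
  cvg (f s @[s --> t^'-]) ->
  \forall s \near t^'-, f s = lim (f s @[s --> t^'-]).
Proof.
move=> n0 t0 fZ cf; have nR : 0 < n%:R :> R by rewrite ltr0n.
have e0 : 0 < (2 * n%:R)^-1 :> R by rewrite invr_gt0 mulr_gt0.
have fl : \forall s \near t^'-, [/\ 0 <= s, s < t &
    `|lim (f s @[s --> t^'-]) - f s| < (2 * n%:R)^-1].
  near=> s; split.
  - by near: s; apply: nbhs_left_ge.
  - by near: s; exact: nbhs_left_lt.
  - by near: s; apply/cvgr_dist_lt.
have [s0 [s00 s0t fs0]] := filter_ex fl.
have feq : \forall s \near t^'-, f s = f s0.
  apply: filterS fl => s [s_ge s_lt fs].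
  have [z1 e1] := fZ s (introT andP (conj s_ge s_lt)).
  have [z2 e2] := fZ s0 (introT andP (conj s00 s0t)).
  have : `|n%:R * f s - n%:R * f s0| < 1.
    rewrite -mulrBr normrM ger0_norm ?ltW// -ltr_pdivlMl// mulr1.
    have : `|f s - f s0| < (2 * n%:R)^-1 + (2 * n%:R)^-1.
      move: fs fs0; set L := lim _; rewrite !ltr_norml => *; lra.
    by rewrite (_ : _ + _ = n%:R^-1)//; field; rewrite gt_eqF.
  rewrite e1 e2 -intrB -intr_norm ltrz1 => h.
  have /eqP : `|z1 - z2| = 0 by lia.
  rewrite normr_eq0 subr_eq0 => /eqP z12.
  by apply: (mulfI (lt0r_neq0 nR)); rewrite e1 e2 z12.
have -> : lim (f s @[s --> t^'-]) = f s0.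
  by apply: cvg_lim => //; apply: cvg_near_cst.
exact: feq.
Unshelve. all: by end_near. Qed.

Lemma left_limit_nat (f : R -> nat) (t : R) :
  cvg (f s @[s --> t^'-]) ->
  \forall s \near t^'-, f s = lim (f s @[s --> t^'-]).
Proof. by move=> cf; exact: (cf _ (discrete_set1 _)). Qed.

Lemma right_limit_nat (f : R -> nat) (t : R) k :
  f s @[s --> t^'+] --> k -> \forall s \near t^'+, f s = k.
Proof. by move=> cf; exact: (cf _ (discrete_set1 _)). Qed.

Lemma right_continuous_measurable (T : R) (f : R -> R) : 0 < T ->
  (forall t, 0 <= t -> t < T -> f s @[s --> t^'+] --> f t) ->
  measurable_fun `[0, T] f.
Proof.
move=> T0 fr.
(* f is the pointwise limit of its values at the next point of the grid
   (1/(k+1)) N, strictly to the right, which are constant between grid points *)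
pose g (k : nat) (t : R) := Num.min ((Num.truncn (k.+1%:R * t)).+1%:R / k.+1%:R) T.
apply: (@measurable_fun_cvg _ _ _ _ (fun k => f \o g k)) => [k|t /=].
  pose tr (t : R) := (Num.truncn (k.+1%:R * t))%:R : R.
  have mtr : measurable_fun setT tr.
    apply: nondecreasing_measurable => // x y xy; rewrite ler_nat truncn_le_nat.
    by rewrite (le_lt_trans _ (truncnS_gt _))// ler_wpM2l.
  move=> mT Y mY.
  have -> : `[0, T] `&` (f \o g k) @^-1` Y = `[0, T] `&` \bigcup_(j in
      [set j : nat | Y (f (Num.min (j.+1%:R / k.+1%:R) T))]) (tr @^-1` [set j%:R]).
    apply/seteqP; split => t [tT /=].
      by move=> Yt; split => //; exists (Num.truncn (k.+1%:R * t)).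
    move=> [j Yj]; rewrite /tr => /eqP; rewrite eqr_nat => /eqP e.
    by split => //=; rewrite /g e.
  apply: measurableI => //; apply: bigcup_measurable => j _.
  by rewrite -[X in measurable X]setTI; exact: mtr.
rewrite in_itv/= => /andP[t0]; rewrite le_eqVlt => /predU1P[->|tT].
  apply: cvg_near_cst; apply: nearW => k; rewrite /g /= min_r//.
  by rewrite ler_pdivlMr ?ltr0n// mulrC; apply: ltW; exact: truncnS_gt.
have ku (k : nat) : t < (Num.truncn (k.+1%:R * t)).+1%:R / k.+1%:R <= t + k.+1%:R^-1.
  rewrite ltr_pdivlMr ?ltr0n// mulrC truncnS_gt/=.
  rewrite ler_pdivrMr ?ltr0n// mulrDl mulVf ?pnatr_eq0// -natr1 lerD2r mulrC.
  by rewrite truncn_le mulr_ge0.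
have /cvg_at_rightP := fr t t0 tT; apply; split => [k|].
  by rewrite /g lt_min tT andbT; have /andP[] := ku k.
apply: (@squeeze_cvgr _ _ _ _ (fun=> t) (fun k => t + k.+1%:R^-1)).
- apply: nearW => k; have /andP[h1 h2] := ku k.
  by rewrite /g le_min (ltW h1) (ltW tT)/= ge_min h2.
- exact: cvg_cst.
- rewrite -[X in _ --> X]addr0; apply: cvgD; first exact: cvg_cst.
  exact: cvg_harmonic.
Qed.

End one_sided_limits.

(** * The path of one system *)
Lemma route_ext (R : realType) Delta (u : R) (p q : nat -> R) l i :
  p i = q i -> p i.+1 = q i.+1 -> p l = q l ->
  p (l + Delta)%N = q (l + Delta)%N ->
  route Delta u p l i.+1 = route Delta u q l i.+1.
Proof. by move=> h1 h2 h3 h4; rewrite /route /Jset /Iset h1 h2 h3 h4. Qed.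

Section system_path.
Context {R : realType}.
Variables (T mu : R) (Delta : nat) (alpha : R) (lam : R -> R) (n : nat).
Variables (N : nat -> R -> nat) (U : nat -> R).
Variables (q : R -> nat -> R) (l : R -> nat) (qn0 : nat -> R) (ln0 : nat).
Hypotheses (T_gt0 : 0 < T) (mu_gt0 : 0 < mu) (n_gt0 : (0 < n)%N).
Hypotheses (lamM : bounded_measurable T lam)
  (lam_ge0 : forall t, 0 <= t <= T -> 0 <= lam t).
Hypotheses (N_mono : forall i s t, 0 <= s -> s <= t -> (N i s <= N i t)%N)
  (N_start : forall i, N i 0 = 0%N)
  (N_right : forall x, 0 <= x -> N 0%N y @[y --> x^'+] --> N 0%N x)
  (N_jump : unit_jumps (N 0%N))
  (U01 : forall j, (0 < j)%N -> 0 <= U j < 1).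
Hypotheses (sol : system_solution T mu Delta alpha lam n N U q l qn0 ln0)
  (qn0_lattice : forall i, exists k : nat, n%:R * qn0 i = k%:R).

Local Notation Lam t := (\int[lebesgue_measure]_(s in `[0, t]) lam s).
Local Notation cnt := (arrival_count lam n N).
Local Notation qpre := (q_before T lam n N q).
Local Notation lpre := (l_before T lam n N l).
Local Notation tau := (arrival_time T lam n N).

Let nR : 0 < n%:R :> R. Proof. by rewrite ltr0n. Qed.

Let norm_scaled (x : R) : n%:R * `|x| = `|n%:R * x|.
Proof. by rewrite normrM [`|n%:R|]ger0_norm ?ltW. Qed.

Let LamB s t : 0 <= s -> s <= t -> t <= T -> Lam t = Lam s + oint lam s t.
Proof. by move=> s0 st tT; rewrite -(oint_closedB lamM s0 st tT) addrC subrK. Qed.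

Let Lam_mono s t : 0 <= s -> s <= t -> t <= T -> Lam s <= Lam t.
Proof.
move=> s0 st tT; rewrite (LamB s0 st tT) lerDl; apply: oint_ge0 => x /andP[sx xt].
by rewrite lam_ge0//; lra.
Qed.

Let Lam0 : Lam 0 = 0. Proof. exact: integral_closed0. Qed.

Let Lam_ge0 t : 0 <= t <= T -> 0 <= Lam t.
Proof. by move=> /andP[t0 tT]; rewrite -[leLHS]Lam0 Lam_mono. Qed.

Let Lam_lipschitz : exists2 M, 0 < M & forall s t, 0 <= s -> s <= t -> t <= T ->
  n%:R * Lam t <= n%:R * Lam s + M * (t - s).
Proof.
have [_ [M lamle]] := lamM.
have M0 : 0 <= M by apply: le_trans (lamle 0 _); rewrite ?lexx ?(ltW T_gt0).
exists (n%:R * (M + 1)) => [|s t s0 st tT]; first by rewrite mulr_gt0// ltr_pwDr.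
rewrite (LamB s0 st tT) mulrDr lerD2l -mulrA ler_pM2l//.
rewrite -oint_cst//; apply: (le_oint lamM) => //.
  exact: bounded_measurable_cst.
move=> x /andP[sx xt]; rewrite (le_trans (ler_norm _))// (le_trans (lamle _ _))//.
  by lra.
by rewrite lerDl.
Qed.

Lemma arrival_count_mono s t : 0 <= s -> s <= t -> t <= T -> (cnt s <= cnt t)%N.
Proof.
move=> s0 st tT; rewrite /arrival_count; apply: N_mono.
  by rewrite mulr_ge0// Lam_ge0//; lra.
by rewrite ler_pM2l// Lam_mono.
Qed.

Lemma arrival_count0 : cnt 0 = 0%N.
Proof. by rewrite /arrival_count Lam0 mulr0 N_start. Qed.

Let count_right t : 0 <= t -> t < T -> exists2 d, 0 < d &
  forall s, t <= s -> s < t + d -> s <= T -> cnt s = cnt t.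
Proof.
move=> t0 tT; have [M M0 LamM] := Lam_lipschitz.
pose x := n%:R * Lam t.
have x0 : 0 <= x by rewrite mulr_ge0// Lam_ge0//; lra.
have := right_limit_nat (N_right x0).
rewrite near_withinE => /nbhs_ballP[e /= e0 he].
exists (e / M); first exact: divr_gt0.
move=> s ts sd sT; rewrite /arrival_count -/x.
have := Lam_mono t0 ts sT; rewrite -(ler_pM2l nR) -/x => xs.
have xe := LamM t s t0 ts sT; rewrite -/x in xe.
move: xs; rewrite le_eqVlt => /predU1P[<-//|xs].
apply: he => //; rewrite /ball/= ltr0_norm ?subr_lt0// opprB.
rewrite (@le_lt_trans _ _ (M * (s - t)))//; first lra.
by rewrite -ltr_pdivlMl// mulrC; lra.
Qed.

(** Right-continuity makes the infimum defining the arrival time a minimum, and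
    unit jumps leave the count at j - 1 just before it. *)
Lemma arrival_timeP j t0 : 0 <= t0 <= T -> (0 < j <= cnt t0)%N ->
  [/\ 0 < tau j, tau j <= t0, (j <= cnt (tau j))%N,
      forall r, 0 <= r <= T -> (cnt r < j)%N -> r < tau j &
      \forall s \near (tau j)^'-, 0 <= s < tau j /\ cnt s = j.-1].
Proof.
move=> /andP[t00 t0T] /andP[j0 jt0].
pose A := [set t : R | 0 <= t <= T /\ (j <= cnt t)%N].
have At0 : A t0 by split => //; rewrite t00.
have infA : has_inf A.
  by split; [exists t0|exists 0 => x [/andP[]]].
have tau_le x : A x -> tau j <= x by move=> Ax; apply: ge_inf => //; case: infA.
have tau_ge0 : 0 <= tau j by apply: lb_le_inf; [exists t0|move=> x [/andP[]]].
have tau_t0 : tau j <= t0 by exact: tau_le.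
have tauT : tau j <= T by lra.
have jtau : (j <= cnt (tau j))%N.
  rewrite leqNgt; apply/negP => ltj.
  have lt0 : tau j < t0.
    rewrite lt_neqAle tau_t0 andbT; apply/eqP => e; move: ltj.
    by rewrite e ltnNge jt0.
  have [d d0 hd] := count_right tau_ge0 (lt_le_trans lt0 t0T).
  have [x [/andP[x0 xT] jx] xd] := inf_adherent d0 infA.
  have := hd x (tau_le x (conj (introT andP (conj x0 xT)) jx)) xd xT.
  by move=> e; move: jx; rewrite e leqNgt ltj.
have before r : 0 <= r <= T -> (cnt r < j)%N -> r < tau j.
  move=> /andP[r0 rT] rj; rewrite ltNge; apply/negP => taur.
  by move: rj; rewrite ltnNge (leq_trans jtau)// arrival_count_mono.
have tau_gt0 : 0 < tau j.
  by apply: before; rewrite ?lexx ?(ltW T_gt0)// arrival_count0.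
split => //.
pose x := n%:R * Lam (tau j).
have x0 : 0 <= x by rewrite mulr_ge0// Lam_ge0//; lra.
have {}x0 : 0 < x.
  rewrite lt_neqAle x0 andbT; apply/eqP => e; move: jtau.
  by rewrite /arrival_count -/x -e N_start leqNgt j0.
have [y [/andP[y0 yx] Nxy]] := N_jump x0.
have [M M0 LamM] := Lam_lipschitz.
have e0 : 0 < (x - y) / M by rewrite divr_gt0// subr_gt0.
near=> s.
have s0 : 0 <= s by near: s; exact: nbhs_left_ge.
have st : s < tau j by near: s; exact: nbhs_left_lt.
have se : tau j - s < (x - y) / M by near: s; exact: nbhs_left_ltBl.
split; first by rewrite s0.
have sj : (cnt s < j)%N.
  rewrite ltnNge; apply/negP => js.
  have : tau j <= s by apply: tau_le; split => //; lra.
  by rewrite leNgt st.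
have sj' : (j <= (cnt s).+1)%N.
  apply: (leq_trans jtau); apply: (leq_trans Nxy).
  rewrite ltnS /arrival_count N_mono//.
  have := LamM s (tau j) s0 (ltW st) tauT; rewrite -/x => h.
  have : M * (tau j - s) < x - y by rewrite -ltr_pdivlMl// mulrC.
  lra.
by apply/eqP; rewrite eqn_leq -ltnS prednK// sj -ltnS prednK.
Unshelve. all: by end_near. Qed.

(** [raises] and [lowers] are the threshold decisions as functions of a state p and
    a threshold k; [arrival_prestate] evaluates them at an actual time. *)
Definition raises (p : nat -> R) (k : nat) : bool :=
  (p k == 1) && (n%:R - 1 <= n%:R * p (k + Delta)%N).

Definition lowers (p : nat -> R) (k : nat) : bool := p k <= alpha.

Lemma state_lattice t i : 0 <= t <= T -> exists z : int, n%:R * q t i = z%:~R.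
Proof.
move=> tT; rewrite (sol_q sol i tT).
have nn : n%:R != 0 :> R by rewrite gt_eqF.
have [k hk] := qn0_lattice i.
case: i hk => [|i] hk.
  by exists k%:Z; rewrite /arrivals /departures addr0 subr0 hk.
rewrite /arrivals /departures mulrBr mulrDr !mulVKf// hk -natr_sum.
by eexists (k%:Z + _%:Z - _%:Z); rewrite intrB intrD -!pmulrn.
Qed.

Lemma bounded_measurable_state i : bounded_measurable T (fun t => q t i).
Proof.
split.
  by apply: right_continuous_measurable => //; case: (sol_q_cadlag sol i).
exists 1 => t tT; have qo := sol_occupancy sol tT.
by rewrite ger0_norm ?occupancy_le1 ?occupancy_ge0.
Qed.

(** Both the levels and the threshold take values in a discrete set, so their left
    limits at an arrival are attained just before it.  Hence the left limits in
    the equations can be replaced by the state at a time s of the window.  As s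
    depends on the levels to be matched, only those up to L are. *)
Lemma arrival_prestate j r t L : 0 <= r -> r <= t -> t <= T ->
  (cnt r <= j)%N -> (j < cnt t)%N ->
  exists s, [/\ r <= s <= t, cnt s = j,
    raise_threshold T Delta lam n N q l j.+1 = raises (q s) (l s),
    lower_threshold T alpha lam n N q l j.+1 = lowers (q s) (l s) &
    forall i, (i < L)%N ->
      route Delta (U j.+1) (qpre j.+1) (lpre j.+1) i.+1 =
      route Delta (U j.+1) (q s) (l s) i.+1].
Proof.
move=> r0 rt tT rj jt.
have tT' : 0 <= t <= T by rewrite tT andbT (le_trans r0).
have [tau0 taut jtau before near_tau] := arrival_timeP tT' (jt : (0 < j.+1 <= _)%N).
have tauT : tau j.+1 <= T by exact: le_trans tT.
have r_tau : r < tau j.+1 by apply: before => //; rewrite r0 (le_trans rt).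
pose L' := (maxn L (lpre j.+1 + Delta)).+1.
have L'h : (lpre j.+1 + Delta < L')%N by rewrite ltnS leq_maxr.
have L'l : (lpre j.+1 < L')%N by exact: leq_ltn_trans (leq_addr _ _) L'h.
have L'iS i : (i < L)%N -> (i.+1 < L')%N.
  by move=> iL; rewrite ltnS (leq_trans iL)// leq_maxl.
have L'i i : (i < L)%N -> (i < L')%N by move=> /L'iS /ltnW.
have near_q K : \forall s \near (tau j.+1)^'-,
    forall i, (i < K)%N -> q s i = qpre j.+1 i.
  elim: K => [|k IH]; first exact: nearW.
  have near_k : \forall s \near (tau j.+1)^'-, q s k = qpre j.+1 k.
    apply: (left_limit_lattice n_gt0 tau0) => [s /andP[s0 st]|].
      by apply: state_lattice; rewrite s0 (le_trans (ltW st)).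
    by have [_] := sol_q_cadlag sol k; apply.
  apply: filterS2 IH near_k => s IH hk i.
  by rewrite ltnS leq_eqVlt => /predU1P[->//|]; exact: IH.
have near_l : \forall s \near (tau j.+1)^'-, l s = lpre j.+1.
  by apply: left_limit_nat; have [_] := sol_l_cadlag sol; apply.
have : \forall s \near (tau j.+1)^'-, [/\ r <= s, s < tau j.+1, cnt s = j,
    forall i, (i < L')%N -> q s i = qpre j.+1 i & l s = lpre j.+1].
  near=> s; split.
  - by near: s; exact: nbhs_left_ge.
  - by near: s; exact: nbhs_left_lt.
  - suff [] : 0 <= s < tau j.+1 /\ cnt s = j by [].
    by near: s.
  - by near: s; exact: near_q.
  - by near: s.
move=> /filter_ex[s [rs st cs qs ls]].
exists s; split => //.
- by rewrite rs (le_trans (ltW st)).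
- by rewrite /raise_threshold /raises ls !qs.
- by rewrite /lower_threshold /lowers ls !qs.
- by move=> i iL; rewrite ls; apply: route_ext; rewrite qs//; [exact: L'i|exact: L'iS].
Unshelve. all: by end_near. Qed.

(** The mass of the levels a + 1, ..., b. *)
Definition band (a b : nat) (t : R) : R := \sum_(a <= i < b) q t i.+1.

Definition band_routes (a b j : nat) : nat :=
  (\sum_(a <= i < b) route Delta (U j) (qpre j) (lpre j) i.+1)%N.

(** The time at which the departures from level i + 1 read the Poisson process of
    index i + 1. *)
Definition departure_clock (t : R) (i : nat) : R :=
  n%:R * \int[lebesgue_measure]_(s in `[0, t])
    (mu * i.+1%:R * (q s i.+1 - q s i.+2)).

Let dep_rate i s : R := mu * i.+1%:R * (q s i.+1 - q s i.+2).

Let dep_rateM i : bounded_measurable T (dep_rate i).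
Proof.
by apply: bounded_measurableZ; apply: bounded_measurableB;
  exact: bounded_measurable_state.
Qed.

Let dep_rate_ge0 i s : 0 <= s <= T -> 0 <= dep_rate i s.
Proof.
move=> sT; rewrite mulr_ge0 ?mulr_ge0 ?(ltW mu_gt0)// subr_ge0.
by have [_ /(_ i.+1)[]] := sol_occupancy sol sT.
Qed.

Let dep_clockB i s t : 0 <= s -> s <= t -> t <= T ->
  departure_clock t i = departure_clock s i + n%:R * oint (dep_rate i) s t.
Proof.
move=> s0 st tT; rewrite /departure_clock -mulrDr; congr (_ * _).
by rewrite -(oint_closedB (dep_rateM i) s0 st tT) addrC subrK.
Qed.

Lemma departure_clock_mono i s t : 0 <= s -> s <= t -> t <= T ->
  departure_clock s i <= departure_clock t i.
Proof.
move=> s0 st tT; rewrite (dep_clockB i s0 st tT) lerDl mulr_ge0// oint_ge0//.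
by move=> x /andP[sx xt]; apply: dep_rate_ge0; lra.
Qed.

Lemma departure_clock_itv i t : 0 <= t <= T ->
  0 <= departure_clock t i <= n%:R * (mu * i.+1%:R * T).
Proof.
move=> /andP[t0 tT].
have e : departure_clock t i = n%:R * oint (dep_rate i) 0 t.
  rewrite (dep_clockB i (lexx 0) t0 tT) {1}/departure_clock integral_closed0.
  by rewrite mulr0 add0r.
rewrite e mulr_ge0//=; last first.
  by apply: oint_ge0 => x /andP[sx xt]; apply: dep_rate_ge0; lra.
rewrite ler_pM2l//.
apply: (@le_trans _ _ (mu * i.+1%:R * (t - 0))); last first.
  by rewrite subr0 ler_wpM2l// mulr_ge0// ltW.
rewrite -oint_cst//; apply: (le_oint (dep_rateM i)) => //.
  exact: bounded_measurable_cst.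
move=> x /andP[x0 xt]; rewrite ler_piMr// ?mulr_ge0 ?(ltW mu_gt0)//.
have xT : 0 <= x <= T by apply/andP; split; lra.
have qo := sol_occupancy sol xT.
by have := occupancy_le1 qo i.+1; have := occupancy_ge0 qo i.+2; lra.
Qed.

Lemma state_increment s t i : 0 <= s -> s <= t -> t <= T ->
  q t i.+1 - q s i.+1 =
    n%:R^-1 * \sum_((cnt s).+1 <= j < (cnt t).+1)
      (route Delta (U j) (qpre j) (lpre j) i.+1)%:R
    - n%:R^-1 * ((N i.+1 (departure_clock t i))%:R
                 - (N i.+1 (departure_clock s i))%:R).
Proof.
move=> s0 st tT; have st' := arrival_count_mono s0 st tT.
rewrite !(sol_q sol i.+1); try (apply/andP; split; lra).
rewrite /arrivals /departures -!/(departure_clock _ _).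
rewrite (big_cat_nat (n := (cnt s).+1) _ (p := (cnt t).+1))//=.
rewrite mulrDr; ring.
Qed.

Lemma state_drop s t i : 0 <= s -> s <= t -> t <= T -> cnt s = cnt t ->
  q t i <= q s i.
Proof.
move=> s0 st tT e.
have tT' : 0 <= t <= T by rewrite tT andbT (le_trans s0).
have sT' : 0 <= s <= T by rewrite s0 (le_trans st).
case: i => [|i].
  by have [-> _] := sol_occupancy sol tT'; have [-> _] := sol_occupancy sol sT'.
rewrite -subr_le0 state_increment// e big_geq// mulr0 sub0r oppr_le0.
rewrite mulr_ge0 ?invr_ge0// subr_ge0 ler_nat N_mono//.
  by have /andP[] := departure_clock_itv i sT'.
exact: departure_clock_mono.
Qed.

Lemma state_step s t i : 0 <= s -> s <= t -> t <= T -> cnt t = (cnt s).+1 ->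
  q t i.+1 <= q s i.+1 + n%:R^-1 *
    (route Delta (U (cnt s).+1) (qpre (cnt s).+1) (lpre (cnt s).+1) i.+1)%:R.
Proof.
move=> s0 st tT e.
have sT' : 0 <= s <= T by rewrite s0 (le_trans st).
rewrite -lerBlDl state_increment// e big_nat1 lerBlDr lerDl.
rewrite mulr_ge0 ?invr_ge0// subr_ge0 ler_nat N_mono//.
  by have /andP[] := departure_clock_itv i sT'.
exact: departure_clock_mono.
Qed.

Lemma threshold_const s t : 0 <= s <= T -> 0 <= t <= T -> cnt s = cnt t ->
  l s = l t.
Proof.
by move=> sT tT e; have := sol_l sol sT; rewrite e -(sol_l sol tT) => -[].
Qed.

Lemma threshold_step s t : 0 <= s <= T -> 0 <= t <= T -> cnt t = (cnt s).+1 ->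
  (l t)%:Z = (l s)%:Z + Delta%:Z *
    ((raise_threshold T Delta lam n N q l (cnt s).+1)%:Z
     - (lower_threshold T alpha lam n N q l (cnt s).+1)%:Z).
Proof.
move=> sT tT e; rewrite (sol_l sol sT) (sol_l sol tT) e.
by rewrite [in LHS]big_nat_recr//= addrA.
Qed.

Lemma bounded_measurable_band a b : bounded_measurable T (band a b).
Proof.
have -> : band a b = (fun t => \sum_(0 <= i < b - a) q t (i + a).+1).
  by apply/funext => t; rewrite /band -{1}(add0n a) big_addn.
by apply: bounded_measurable_sum => i _; exact: bounded_measurable_state.
Qed.

(** Summation by parts: a pool with i tasks is counted in i levels, and each of
    its tasks departs at rate mu. *)
Lemma band_rate a b s : (a <= b)%N ->
  \sum_(a <= i < b) dep_rate i s =
  mu * (band a b s + a%:R * q s a.+1 - b%:R * q s b.+1).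
Proof.
move=> ab; rewrite /band; elim: b ab => [|b IH].
  by rewrite leqn0 => /eqP ->; rewrite !big_geq//; ring.
rewrite leq_eqVlt ltnS => /predU1P[->|ab]; first by rewrite !big_geq//; ring.
rewrite !big_nat_recr//= IH// /dep_rate -(natr1 b); ring.
Qed.

Lemma band_routes_le1 a b j : (j < cnt T)%N -> (band_routes a b j.+1 <= 1)%N.
Proof.
move=> jT; have c0j : (cnt 0 <= j)%N by rewrite arrival_count0.
have [s [/andP[s0 sT] cs _ _ hr]] :=
  arrival_prestate b (lexx 0) (ltW T_gt0) (lexx T) c0j jT.
have sT' : 0 <= s <= T by rewrite s0.
apply: (@leq_trans (band_routes 0 b j.+1)).
  rewrite /band_routes; have [ab|ba] := leqP a b.
    by rewrite [leqRHS](big_cat_nat (n := a))//= leq_addl.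
  by rewrite big_geq// ltnW.
rewrite /band_routes (eq_big_nat _ _ (F2 := fun i =>
  route Delta (U j.+1) (q s) (l s) i.+1 : nat)); last first.
  by move=> i /andP[_ ib]; rewrite hr.
exact: (sum_route_le1 Delta _ (sol_occupancy sol sT') (U01 _)).
Qed.

Lemma band_increase a b s t : 0 <= s -> s <= t -> t <= T ->
  band a b t - band a b s <=
  n%:R^-1 * \sum_((cnt s).+1 <= j < (cnt t).+1) (band_routes a b j)%:R.
Proof.
move=> s0 st tT; have sT' : 0 <= s <= T by rewrite s0 (le_trans st).
rewrite /band -sumrB /band_routes.
under [X in _ * X]eq_bigr do rewrite natr_sum.
rewrite exchange_big/= mulr_sumr; apply: ler_sum => i _.
rewrite state_increment// lerBlDr lerDl mulr_ge0 ?invr_ge0// subr_ge0.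
rewrite ler_nat N_mono//; last exact: departure_clock_mono.
by have /andP[] := departure_clock_itv i sT'.
Qed.

Lemma sum_band_routes_le a b s t : 0 <= s -> s <= t -> t <= T ->
  n%:R^-1 * \sum_((cnt s).+1 <= j < (cnt t).+1) (band_routes a b j)%:R <=
  n%:R^-1 * ((cnt t)%:R - (cnt s)%:R) :> R.
Proof.
move=> s0 st tT.
rewrite ler_wpM2l ?invr_ge0// -natrB ?arrival_count_mono// -natr_sum ler_nat.
rewrite -[leqRHS]muln1 -subSS -sum_nat_const_nat big_nat [leqRHS]big_nat.
apply: leq_sum => -[|j] /andP[cj jt] //.
by apply: band_routes_le1; apply: leq_trans (arrival_count_mono _ tT (lexx T));
  [exact: jt|exact: le_trans st].
Qed.

Lemma band_increase_count a b s t : 0 <= s -> s <= t -> t <= T ->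
  band a b t - band a b s <= n%:R^-1 * ((cnt t)%:R - (cnt s)%:R).
Proof.
move=> s0 st tT; apply: (le_trans (band_increase a b s0 st tT)).
exact: sum_band_routes_le.
Qed.

Lemma state0 i : q 0 i = qn0 i.
Proof.
have T0 : 0 <= (0 : R) <= T by rewrite lexx ltW.
rewrite (sol_q sol i T0); case: i => [|i] /=; first by rewrite addr0 subr0.
rewrite /arrivals /departures arrival_count0 big_geq// mulr0 addr0.
by rewrite integral_closed0 mulr0 N_start mulr0 subr0.
Qed.

Lemma threshold0 : l 0 = ln0.
Proof.
have T0 : 0 <= (0 : R) <= T by rewrite lexx ltW.
by have := sol_l sol T0; rewrite arrival_count0 big_geq// addr0 => -[].
Qed.

Lemma threshold_dvd t : (exists k, ln0 = (k * Delta)%N) -> 0 <= t <= T ->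
  exists k, l t = (k * Delta)%N.
Proof.
move=> [k0 ek0] tT; have := sol_l sol tT.
rewrite -mulr_sumr ek0; set S := \sum_(_ <= _ < _) _ => e.
have : (Delta%:Z %| (l t)%:Z)%Z.
  by rewrite e PoszM; apply: rpredD; [exact: dvdz_mull|exact: dvdz_mulr].
by rewrite dvdzE /= => /dvdnP.
Qed.

(** Passage from a time s just before an arrival to any later time t before the
    next one.  Departures in between only decrease the levels, whence the
    inequality. *)
Definition arrival_step (L : nat) (s t : R) : Prop :=
  [/\ cnt t = (cnt s).+1,
      (l t)%:Z = (l s)%:Z + Delta%:Z *
        ((raises (q s) (l s))%:Z - (lowers (q s) (l s))%:Z) &
      forall i, (i < L)%N -> q t i.+1 <= q s i.+1 + n%:R^-1 *
        (route Delta (U (cnt s).+1) (q s) (l s) i.+1)%:R].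

Lemma arrival_step_exists r t L : 0 <= r -> r <= t -> t <= T ->
  (cnt r < cnt t)%N ->
  exists s, [/\ r <= s <= t, cnt t = (cnt s).+1 & arrival_step L s t].
Proof.
move=> r0 rt tT rct; have ct : cnt t = (cnt t).-1.+1 by rewrite prednK// (leq_trans _ rct).
have h1 : (cnt r <= (cnt t).-1)%N by rewrite -ltnS -ct.
have h2 : ((cnt t).-1 < cnt t)%N by rewrite {2}ct.
have [s [/andP[rs st] cs hra hlo hro]] := arrival_prestate L r0 rt tT h1 h2.
have ets : cnt t = (cnt s).+1 by rewrite cs -ct.
have s0 : 0 <= s by exact: le_trans rs.
exists s; split; rewrite ?rs//; split => //.
- rewrite (@threshold_step s t) ?s0 ?tT ?(le_trans st)// ?(le_trans s0)//.
  by rewrite cs hra hlo.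
- by move=> i iL; rewrite cs -hro// -cs; exact: state_step.
Qed.

(** Induction over the arrivals.  A step goes from the state that an arrival sees to
    all the times before the next arrival, so no limit is ever taken. *)
Lemma arrival_induction (r0 r1 : R) (L : nat) (Q : R -> Prop) :
  0 <= r0 -> r1 <= T ->
  (forall t, r0 <= t <= r1 -> cnt t = cnt r0 -> Q t) ->
  (forall s t, r0 <= s -> s <= t -> t <= r1 -> arrival_step L s t ->
    Q s -> Q t) ->
  forall t, r0 <= t <= r1 -> Q t.
Proof.
move=> r00 r1T base step.
suff H c : forall t, r0 <= t <= r1 -> cnt t = (cnt r0 + c)%N -> Q t.
  move=> t tr; have /andP[r0t tr1] := tr.
  apply: (H (cnt t - cnt r0)%N) => //.
  by rewrite subnKC// arrival_count_mono// (le_trans tr1).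
elim: c => [|c IH] t tr ct; first by apply: base => //; rewrite ct addn0.
have /andP[r0t tr1] := tr.
have rct : (cnt r0 < cnt t)%N by rewrite ct addnS ltnS leq_addr.
have [s [/andP[rs st] cs stp]] :=
  arrival_step_exists L r00 r0t (le_trans tr1 r1T) rct.
apply: (step s t) => //; apply: IH; first by rewrite rs (le_trans st).
by apply: succn_inj; rewrite -cs ct addnS.
Qed.

Lemma threshold_cases L s t : alpha < 1 -> arrival_step L s t ->
  [\/ raises (q s) (l s) /\ l t = (l s + Delta)%N,
      lowers (q s) (l s) /\ l s = (l t + Delta)%N |
      [/\ ~~ raises (q s) (l s), ~~ lowers (q s) (l s) & l t = l s]].
Proof.
move=> alpha_lt1 [_ + _]; have [ra|nra] := boolP (raises (q s) (l s)).
  have -> : lowers (q s) (l s) = false.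
    by case/andP: ra => /eqP ql _; rewrite /lowers ql leNgt alpha_lt1.
  rewrite /= => e; apply: Or31; split => //.
  by move: (l s) (l t) e; clear; lia.
have [lo|nlo] := boolP (lowers (q s) (l s)) => /= e.
  by apply: Or32; split => //; move: (l s) (l t) e; clear; lia.
by apply: Or33; split => //; move: (l s) (l t) e; clear; lia.
Qed.

(** ** Bounds on the occupied levels *)

Section invariants.
Variables (B K : nat).
Hypotheses (Delta_gt0 : (0 < Delta)%N) (n_gt1 : (1 < n)%N)
  (alpha_gap : alpha + n%:R^-1 < 1)
  (qn0_B : qn0 B.+1 = 0) (ln0_B : (ln0 <= B)%N)
  (ln0_dvd : exists k, ln0 = (k * Delta)%N)
  (mass_K : B%:R + n%:R^-1 * (cnt T)%:R <= K%:R :> R).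

Let alpha_lt1 : alpha < 1.
Proof. by apply: lt_trans alpha_gap; rewrite ltrDl invr_gt0 nR. Qed.

Let occ t (tT : 0 <= t <= T) := sol_occupancy sol tT.

Lemma band_start b : band 0 b 0 <= B%:R.
Proof.
have T0 : 0 <= (0 : R) <= T by rewrite lexx ltW.
have q0S i : q 0 i.+1 <= (i < B)%N%:R.
  case: ltnP => iB; first exact: occupancy_le1 (occ T0) _.
  by apply: (le_trans (occupancy_antitone (occ T0) (iB : (B.+1 <= i.+1)%N))); rewrite state0 qn0_B.
apply: (@le_trans _ _ (minn b B)%:R); last by rewrite ler_nat geq_minr.
rewrite /band; elim: b => [|b IH]; first by rewrite big_geq// min0n.
rewrite big_nat_recr//=; apply: (le_trans (lerD IH (q0S b))).
by rewrite -natrD ler_nat; clear; case: ltnP => h /=; lia.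
Qed.

Lemma mass_le b t : 0 <= t <= T -> band 0 b t <= K%:R.
Proof.
move=> /andP[t0 tT]; apply: le_trans mass_K.
have := band_increase_count 0 b (lexx 0) t0 tT; rewrite arrival_count0 subr0.
have h : n%:R^-1 * (cnt t)%:R <= n%:R^-1 * (cnt T)%:R :> R.
  by rewrite ler_wpM2l ?invr_ge0// ler_nat arrival_count_mono.
have := band_start b; lra.
Qed.

Lemma level_le_band c t : 0 <= t <= T -> c%:R * q t c <= band 0 c t.
Proof.
move=> tT; rewrite -[c in c%:R]subn0 mulr_natl -sumr_const_nat /band.
rewrite big_nat [leRHS]big_nat; apply: ler_sum => i /andP[_ ic].
exact: (occupancy_antitone (occ tT) ic).
Qed.

(** All levels up to c are at least half full, so the mass K bounds c / 2. *)
Lemma full_level_le c t : 0 <= t <= T -> n%:R - 1 <= n%:R * q t c ->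
  (c <= 2 * K)%N.
Proof.
move=> tT full; have := le_trans (level_le_band c tT) (mass_le c tT) => h.
have n2 : 2 <= n%:R :> R by rewrite (ler_nat _ 2).
have qhalf : 2^-1 <= q t c.
  rewrite -(ler_pM2l nR); apply: le_trans full; lra.
have c0 : 0 <= c%:R :> R by exact: ler0n.
have h2 : c%:R * 2^-1 <= c%:R * q t c by exact: ler_wpM2l.
rewrite -(ler_nat R) natrM.
by move: h h2; set x := c%:R * q t c; lra.
Qed.

(** A threshold is raised only when the level it is raised to is nearly full, hence
    at most 2 K; the initial one is at most B. *)
Definition level_bound : nat := maxn B (2 * K).

Lemma threshold_le t : 0 <= t <= T -> (l t <= level_bound)%N.
Proof.
apply: (arrival_induction (L := 0) (Q := fun t => (l t <= level_bound)%N)) => //.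
  move=> t' tT' e; rewrite -(@threshold_const 0)// ?lexx ?(ltW T_gt0)//.
  by rewrite threshold0 (leq_trans ln0_B)// leq_maxl.
move=> s t' s0 st tT stp IH.
have [[/andP[_ full] ->]|[_ e]|[_ _ ->]//] := threshold_cases alpha_lt1 stp.
  have sT : 0 <= s <= T by rewrite s0 (le_trans st).
  by rewrite (leq_trans (full_level_le sT full))// leq_maxr.
by apply: leq_trans IH; rewrite e leq_addr.
Qed.

(** Tasks are sent to levels up to l + Delta or, during the first [level_bound]
    arrivals, at most one level above the occupied ones. *)
Definition top_level : nat := (B + level_bound + Delta)%N.

Let zero_above t c c' : 0 <= t <= T -> q t c = 0 -> (c <= c')%N -> q t c' = 0.
Proof.
move=> tT qc cc'; apply/eqP; rewrite eq_le (occupancy_ge0 (occ tT)) andbT -qc.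
exact: (occupancy_antitone (occ tT) cc').
Qed.

(* The two phases of a path.  The start-up lasts as long as the level l + Delta
   has been full at every arrival: each arrival has then raised the threshold by
   Delta, and the highest occupied level by at most one. *)
Let high_open t := q t (l t + Delta)%N < 1 /\ q t top_level.+1 = 0.

Let start_up t := (cnt t * Delta <= l t)%N /\ q t (B + cnt t).+1 = 0.

Let start_up_top t : 0 <= t <= T -> start_up t ->
  (cnt t <= level_bound)%N /\ q t top_level.+1 = 0.
Proof.
move=> tT [cl qz].
have ch : (cnt t <= level_bound)%N.
  apply: leq_trans (threshold_le tT); apply: leq_trans cl.
  exact: leq_pmulr.
split => //; apply: zero_above qz _ => //.
by rewrite ltnS /top_level -addnA leq_add2l (leq_trans ch)// leq_addr.
Qed.

Let step_zero L s t c : 0 <= s -> s <= t -> t <= T -> arrival_step L s t ->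
  (c < L)%N ->
  route Delta (U (cnt s).+1) (q s) (l s) c.+1 = false -> q t c.+1 <= q s c.+1.
Proof. by move=> s0 st tT [_ _ +] cL r => /(_ c cL); rewrite r mulr0 addr0. Qed.

Let step_le L s t c : 0 <= s -> s <= t -> t <= T -> arrival_step L s t ->
  (c < L)%N -> q t c.+1 <= q s c.+1 + n%:R^-1.
Proof.
move=> s0 st tT [_ _ /(_ c)] h cL; apply: le_trans (h cL) _.
by rewrite lerD2l ler_piMr ?invr_ge0// lern1 leq_b1.
Qed.

(* If the threshold is raised, l + Delta becomes the new threshold and the level
   above it is at most as full as l + Delta was.  If it is lowered, the level
   l + Delta of the new threshold is the old threshold level, at most alpha
   full before the arrival.  If it stays, either the task went to a level up to
   l, or the level l + Delta was missing at least two pools. *)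
Let high_open_step s t : 0 <= s -> s <= t -> t <= T ->
  arrival_step top_level.+2 s t ->
  q s (l s + Delta)%N < 1 -> q s top_level.+1 = 0 -> high_open t.
Proof.
move=> s0 st tT stp qh qtop.
have sT : 0 <= s <= T by rewrite s0 (le_trans st).
have tT' : 0 <= t <= T by rewrite tT (le_trans s0).
have qs := occ sT; have qt := occ tT'.
have lH := threshold_le sT.
have htop : (l s + Delta <= top_level)%N.
  by rewrite /top_level leq_add2r (leq_trans lH)// leq_addl.
have above c : (l s + Delta <= c)%N -> (c < top_level.+2)%N -> q t c.+1 <= q s c.+1.
  move=> hc cL; apply: (step_zero s0 st tT stp cL).
  exact: (route_eq0_above_high _ qs qh hc).
split; last first.
  apply/eqP; rewrite eq_le (occupancy_ge0 qt) andbT -qtop.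
  exact: above.
have [h ldec] : exists h, (l s + Delta)%N = h.+1 by exists (l s + Delta).-1; rewrite prednK// addn_gt0 Delta_gt0 orbT.
have hL : (h < top_level.+2)%N by rewrite -ldec (leq_trans htop)// leqW.
have [[ra lt_]|[lo e]|[nra nlo lt_]] := threshold_cases alpha_lt1 stp.
- rewrite lt_; apply: (le_lt_trans _ qh).
  apply: (@le_trans _ _ (q t (l s + Delta).+1)).
    by apply: occupancy_antitone => //; rewrite -addn1 leq_add2l.
  apply: (le_trans (above _ (leqnn _) _)); first by rewrite ltnS leqW.
  exact: occupancy_antitone.
- rewrite -e; move: lo; rewrite /lowers.
  have [k ek] : exists k, l s = k.+1.
    by exists (l s).-1; rewrite prednK// e addn_gt0 Delta_gt0 orbT.
  rewrite ek => qk; apply: le_lt_trans alpha_gap.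
  have kL : (k < top_level.+2)%N.
    by rewrite -ek (leq_trans (leq_addr Delta _))// (leq_trans htop)// ltnW.
  by apply: (le_trans (step_le s0 st tT stp kL)); rewrite lerD2r.
- rewrite lt_ ldec; have [ql|ql] := ltP (q s (l s)) 1.
    apply: (le_lt_trans _ qh); rewrite ldec.
    apply: (step_zero s0 st tT stp) => //.
    apply: (route_eq0_above_low _ _ qs ql).
    by rewrite -ltnS -ldec -addn1 leq_add2l.
  move: nra; rewrite /raises eq_le ql (occupancy_le1 qs)/= -ltNge => nfull.
  apply: (le_lt_trans (step_le s0 st tT stp hL)).
  by rewrite -ldec -ltrBrDr -(ltr_pM2l nR) mulrBr mulr1 mulfV// gt_eqF// nR.
Qed.

(** The start-up phase ends within [level_bound] arrivals, since each of them
    raises the threshold, which is at most [level_bound].  The second phase, in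
    which some pool has fewer than l + Delta tasks, is never left. *)
Lemma invariant t : 0 <= t <= T -> q t top_level.+1 = 0 /\
  ((level_bound < cnt t)%N -> q t (l t + Delta)%N < 1).
Proof.
move=> tT; suff [su|[h1 h2]] : start_up t \/ high_open t.
- by have [ch ->] := start_up_top tT su; split => //; rewrite ltnNge ch.
- by [].
move: t tT; apply: (arrival_induction (L := top_level.+2)
  (Q := fun t => start_up t \/ high_open t)) => //.
  move=> t tT e; left; rewrite /start_up e arrival_count0 mul0n addn0; split => //.
  have /andP[t0 tT'] := tT.
  apply/eqP; rewrite eq_le (occupancy_ge0 (occ tT)) andbT.
  by rewrite (le_trans (state_drop _ (lexx 0) t0 tT' _))// ?state0 ?qn0_B.
move=> s t s0 st tT stp; have sT : 0 <= s <= T by rewrite s0 (le_trans st).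
have tT' : 0 <= t <= T by rewrite tT (le_trans s0).
move=> [su|[qh qtop]]; last by right; exact: high_open_step stp qh qtop.
have [ch qtop] := start_up_top sT su.
have [qh|qh] := ltP (q s (l s + Delta)%N) 1.
  by right; exact: high_open_step stp qh qtop.
have qs := occ sT.
have {}qh : q s (l s + Delta)%N = 1 by apply/eqP; rewrite eq_le qh occupancy_le1.
have ql : q s (l s) = 1.
  apply/eqP; rewrite eq_le (occupancy_le1 qs)/= -qh.
  exact: (occupancy_antitone qs (leq_addr _ _)).
have ra : raises (q s) (l s).
  by rewrite /raises ql qh eqxx mulr1 /= gerBl ler01.
left; have [cst lst _] := stp; case: su => cl qz; split.
  have [[_ ->]|[lo _]|[/negP//]] := threshold_cases alpha_lt1 stp.
    by rewrite cst mulSn addnC leq_add2r.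
  by move: lo; rewrite /lowers ql leNgt alpha_lt1.
rewrite cst addnS; apply/eqP; rewrite eq_le (occupancy_ge0 (occ tT')) andbT.
have qzS : q s (B + cnt s).+2 = 0 by exact: zero_above qz _.
rewrite -qzS; apply: (step_zero s0 st tT stp).
  by rewrite 2!ltnS /top_level -addnA leq_add2l (leq_trans ch)// leq_addr.
by apply: route_eq0_flat; rewrite qz qzS.
Qed.

End invariants.

(** ** Mass balance with noise *)

Section noise.
Variables (eta : R) (Lmax : nat).
Hypotheses
  (arrival_noise : forall t, 0 <= t <= T ->
    `|(cnt t)%:R - n%:R * Lam t| <= n%:R * eta)
  (departure_noise : forall i t, (i < Lmax)%N -> 0 <= t <= T ->
    `|(N i.+1 (departure_clock t i))%:R - departure_clock t i| <= n%:R * eta).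

Lemma count_increment s t : 0 <= s -> s <= t -> t <= T ->
  `|n%:R^-1 * ((cnt t)%:R - (cnt s)%:R) - oint lam s t| <= 2 * eta.
Proof.
move=> s0 st tT.
have hs : `|(cnt s)%:R - n%:R * Lam s| <= n%:R * eta by apply: arrival_noise; lra.
have ht : `|(cnt t)%:R - n%:R * Lam t| <= n%:R * eta by apply: arrival_noise; lra.
rewrite -(ler_pM2l nR) norm_scaled.
rewrite [n%:R * (_ - oint _ _ _)]mulrBr mulVKf ?gt_eqF//.
move: ht; rewrite (LamB s0 st tT) mulrDr; move: hs.
rewrite !ler_norml; set x := n%:R * Lam s; set y := n%:R * oint _ _ _.
by rewrite mulrCA; set z := n%:R * eta => *; lra.
Qed.

Lemma band_increment a b s t : (a <= b)%N -> (b <= Lmax)%N ->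
  0 <= s -> s <= t -> t <= T ->
  `|band a b t - band a b s
    - n%:R^-1 * \sum_((cnt s).+1 <= j < (cnt t).+1) (band_routes a b j)%:R
    + oint (fun x => mu * (band a b x + a%:R * q x a.+1 - b%:R * q x b.+1)) s t|
  <= 2 * (b - a)%:R * eta.
Proof.
move=> ab bL s0 st tT.
have -> : oint (fun x => mu * (band a b x + a%:R * q x a.+1 - b%:R * q x b.+1)) s t
   = \sum_(a <= i < b) oint (dep_rate i) s t.
  transitivity (oint (fun x => \sum_(a <= i < b) dep_rate i x) s t).
    by apply: eq_oint => x _; rewrite band_rate.
  under eq_fun do rewrite -{1}(add0n a) big_addn.
  rewrite (@oint_sum _ T)//.
  by rewrite -[in RHS](add0n a) big_addn.
have -> : n%:R^-1 * \sum_((cnt s).+1 <= j < (cnt t).+1) (band_routes a b j)%:R =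
    \sum_(a <= i < b) (n%:R^-1 * \sum_((cnt s).+1 <= j < (cnt t).+1)
      (route Delta (U j) (qpre j) (lpre j) i.+1)%:R) :> R.
  rewrite -mulr_sumr exchange_big/=; congr (_ * _).
  by apply: eq_bigr => j _; rewrite /band_routes natr_sum.
rewrite /band -!sumrB -big_split/=.
have -> : 2 * (b - a)%:R * eta = \sum_(a <= i < b) (2 * eta).
  by rewrite big_const_nat iter_addr_0 -[RHS]mulr_natr; ring.
apply: le_trans (ler_norm_sum _ _ _) _; rewrite !big_nat.
apply: ler_sum => i /andP[ai ib].
have iL : (i < Lmax)%N by lia.
have hs : `|(N i.+1 (departure_clock s i))%:R - departure_clock s i| <= n%:R * eta.
  by apply: departure_noise => //; lra.
have ht : `|(N i.+1 (departure_clock t i))%:R - departure_clock t i| <= n%:R * eta.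
  by apply: departure_noise => //; lra.
rewrite state_increment//.
set X := (X in X - _ - X); rewrite [X in `|X|](_ : _ = oint (dep_rate i) s t -
  n%:R^-1 * ((N i.+1 (departure_clock t i))%:R
                 - (N i.+1 (departure_clock s i))%:R)); last ring.
rewrite -(ler_pM2l nR) norm_scaled.
rewrite [n%:R * (oint _ _ _ - _)]mulrBr mulVKf ?gt_eqF//.
move: ht; rewrite (dep_clockB i s0 st tT); move: hs.
rewrite !ler_norml; set y := n%:R * oint _ _ _.
by rewrite [n%:R * (2 * eta)]mulrCA; set z := n%:R * eta => *; lra.
Qed.

Let bbandM a b := bounded_measurable_band a b.

Lemma sum_routes_le_count b s t : 0 <= s -> s <= t -> t <= T ->
  n%:R^-1 * \sum_((cnt s).+1 <= j < (cnt t).+1) (band_routes 0 b j)%:R <=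
  oint lam s t + 2 * eta.
Proof.
move=> s0 st tT; have := count_increment s0 st tT.
rewrite ler_norml => /andP[_ h].
have := sum_band_routes_le 0 b s0 st tT; move=> *; lra.
Qed.

(** The total mass gains at most the arrivals and loses exactly mu times itself,
    so its excess over u has a feedback of rate mu. *)
Lemma total_mass_upper (u : R -> R) b d : (b <= Lmax)%N ->
  (forall t, 0 <= t <= T -> q t b.+1 = 0) ->
  bounded_measurable T u ->
  (forall r s, 0 <= r -> r <= s -> s <= T ->
    oint (fun x => lam x - mu * u x) r s <= u s - u r) ->
  0 <= d -> band 0 b 0 <= u 0 + d ->
  forall t, 0 <= t <= T -> band 0 b t <= u t + d + 2 * b.+1%:R * eta.
Proof.
move=> bL qb0 uM udrift d0 init t tT.
rewrite -addrA -lerBlDl.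
apply: (feedback_comparison (T := T) (mu := mu) (g := fun t => band 0 b t - u t)
  (r0 := 0) (r1 := T)) => //.
- exact: bounded_measurableB.
- move=> r s r0 rs sT.
  have rate : oint (fun x => mu * (band 0 b x + 0%:R * q x 1%N - b%:R * q x b.+1)) r s
      = mu * oint (band 0 b) r s.
    rewrite -(@ointZ _ T)//; apply: eq_oint => x /andP[rx xs].
    by rewrite qb0 ?mul0r ?mulr0 ?addr0 ?subr0//; apply/andP; split; lra.
  have := band_increment (leq0n b) bL r0 rs sT.
  rewrite rate subn0 ler_norml => /andP[_ inc].
  have := sum_routes_le_count b r0 rs sT.
  have := udrift r s r0 rs sT.
  have muM : bounded_measurable T (fun x => mu * u x) by exact: bounded_measurableZ.
  rewrite (ointB lamM muM)// (ointZ mu uM)// (ointB (bbandM 0 b) uM)//.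
  rewrite -(natr1 b) mulrBr; move: inc.
  set z := mu * oint (band 0 b) r s; set w := mu * oint u r s => inc h1 h2.
  by lra.
- by rewrite lerBlDl.
Qed.

(** ** Settling of the threshold *)

Section window.
Variables (k m : nat) (r0 r1 : R).
Hypotheses (Delta_gt0 : (0 < Delta)%N) (kE : k = (m * Delta)%N)
  (kL : (k <= Lmax)%N) (r0_ge0 : 0 <= r0) (r1_le : r1 <= T)
  (ldvd : forall t, 0 <= t <= T -> exists j, l t = (j * Delta)%N).

Let wT t : r0 <= t <= r1 -> 0 <= t <= T.
Proof. by move=> /andP[h1 h2]; rewrite (le_trans r0_ge0 h1) (le_trans h2). Qed.

Let wocc t (tw : r0 <= t <= r1) : occupancy (q t) := sol_occupancy sol (wT tw).

Let multiple_le t : r0 <= t <= r1 -> (k < l t + Delta)%N -> (k <= l t)%N.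
Proof.
move=> /wT/ldvd[j ->]; rewrite kE -mulSnr ltn_pmul2r// ltnS => h.
by rewrite leq_mul2r h orbT.
Qed.

(** The level k + Delta is at most alpha full.  So every arrival that finds the
    threshold above k, hence at least at k + Delta, lowers it; and it can not be
    raised from k, because the level k + Delta misses more than one pool. *)
Lemma threshold_descends (H : nat) : alpha < 1 ->
  (l r0 <= H)%N ->
  (forall t, r0 <= t <= r1 -> q t (k + Delta)%N <= alpha) ->
  (forall t, r0 <= t <= r1 -> n%:R * q t (k + Delta)%N < n%:R - 1) ->
  forall t, r0 <= t <= r1 -> (l t <= maxn k (H - (cnt t - cnt r0)))%N.
Proof.
move=> al1 lH qal qn; apply: (arrival_induction (L := 0)
  (Q := fun t => (l t <= maxn k (H - (cnt t - cnt r0)))%N)) => //.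
  move=> t tw e; have /andP[r0t tr1] := tw.
  rewrite -(@threshold_const r0 t)//; last exact: wT.
    by rewrite e subnn subn0 leq_max lH orbT.
  by rewrite r0_ge0 (le_trans r0t)// (le_trans tr1).
move=> s t r0s st tr1 stp IH.
have sw : r0 <= s <= r1 by rewrite r0s (le_trans st).
have r0s_cnt : (cnt r0 <= cnt s)%N.
  by rewrite arrival_count_mono// (le_trans st)// (le_trans tr1).
have qs := wocc sw; have [cst _ _] := stp.
have [lk|kl] := leqP (l s) k.
  rewrite leq_max; apply/orP; left.
  have [[/andP[_ full] ->]|[_ e]|[_ _ ->]//] := threshold_cases al1 stp.
    rewrite leqNgt; apply/negP => klt.
    have lsk : l s = k by apply/eqP; rewrite eqn_leq lk multiple_le.
    by move: full; rewrite lsk leNgt qn.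
  by apply: leq_trans lk; rewrite e leq_addr.
have lo : lowers (q s) (l s).
  rewrite /lowers (le_trans _ (qal s sw))//; apply: (occupancy_antitone qs).
  have [j ej] := ldvd (wT sw); move: kl; rewrite ej kE ltn_pmul2r// => mj.
  by rewrite -mulSnr leq_mul2r mj orbT.
have [[/andP[/eqP ql _] _]|[_ e]|[_ /negP//]] := threshold_cases al1 stp.
  by move: lo; rewrite /lowers ql leNgt al1.
move: IH; rewrite leq_max leqNgt kl /= e cst subSn// => IH.
rewrite leq_max; apply/orP; right.
move: IH Delta_gt0; move: (l t) (cnt s - cnt r0)%N; clear => a c; lia.
Qed.

Hypotheses (lk : forall t, r0 <= t <= r1 -> (l t <= k)%N)
  (open_high : forall t, r0 <= t <= r1 -> q t (l t + Delta)%N < 1).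

Lemma band_le t : r0 <= t <= r1 -> band 0 k t <= k%:R.
Proof.
move=> tw; rewrite -[k in leRHS]subn0 -[leRHS]mulr1 mulr_natl -sumr_const_nat.
by apply: ler_sum => i _; exact: (occupancy_le1 (wocc tw) _).
Qed.

Lemma band_full t : r0 <= t <= r1 -> q t k = 1 -> band 0 k t = k%:R.
Proof.
move=> tw qk; apply/eqP; rewrite eq_le band_le//=.
rewrite -[k in leLHS]subn0 -[leLHS]mulr1 mulr_natl -sumr_const_nat.
rewrite /band big_nat [leRHS]big_nat; apply: ler_sum => i /andP[_ ik].
by rewrite -qk; exact: (occupancy_antitone (wocc tw) ik).
Qed.

Lemma band_ge_level t : r0 <= t <= r1 -> (0 < k)%N ->
  band 0 k t <= k%:R - 1 + q t k.
Proof.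
move=> tw k0; rewrite /band -(prednK k0) big_nat_recr//= lerD2r.
rewrite -natr1 addrK -[k.-1 in leRHS]subn0 -[leRHS]mulr1 mulr_natl.
by rewrite -sumr_const_nat; apply: ler_sum => i _; exact: (occupancy_le1 (wocc tw) _).
Qed.

(** If l + Delta <= k, all tasks go to the levels up to l + Delta.  Otherwise l = k,
    as both are multiples of Delta; the level k is not full because band 0 k < k,
    and the tasks go to levels up to l.  The first arrival is not counted: it may
    still see the state at time r, when the band may be full. *)
Lemma full_routing r t : r0 <= r -> r <= t -> t <= r1 ->
  (forall x, r <= x <= t -> (cnt r < cnt x)%N -> band 0 k x < k%:R) ->
  (cnt t - cnt r).-1%:R <=
  \sum_((cnt r).+1 <= j < (cnt t).+1) (band_routes 0 k j)%:R :> R.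
Proof.
move=> r0r rt tr1 notfull.
have r_ge0 : 0 <= r by exact: le_trans r0r.
have tT : t <= T by exact: le_trans r1_le.
have [crt|ctr] := ltnP (cnt r) (cnt t); last first.
  have -> : (cnt t - cnt r)%N = 0%N by apply/eqP; rewrite subn_eq0.
  by rewrite big_geq.
rewrite big_ltn ?ltnS// ler_wpDl// -natr_sum ler_nat.
rewrite -subn1 -subnDA addn1 -subSS -[leqLHS]muln1 -sum_nat_const_nat.
rewrite big_nat [leqRHS]big_nat; apply: leq_sum => -[|j] // /andP[rj jt].
have crj : (cnt r <= j)%N by apply: ltnW; rewrite -ltnS.
have [x [/andP[rx xt] cx _ _ hro]] := arrival_prestate k r_ge0 rt tT crj jt.
have xw : r0 <= x <= r1 by rewrite (le_trans r0r)// (le_trans xt).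
have nf : band 0 k x < k%:R.
  by apply: notfull; rewrite ?rx ?xt// cx -ltnS.
rewrite /band_routes (eq_big_nat _ _ (F2 := fun i =>
  route Delta (U j.+1) (q x) (l x) i.+1 : nat)); last first.
  by move=> i /andP[_ ib]; rewrite hro.
rewrite (sum_route_eq1 (wocc xw) (U01 _)) ?open_high//.
have [hk|kh] := leqP (l x + Delta)%N k; [by right|left].
have elk : l x = k by apply/eqP; rewrite eqn_leq lk// multiple_le.
rewrite elk; split => //; rewrite lt_neqAle (occupancy_le1 (wocc xw)) andbT.
by apply/eqP => qk; move: nf; rewrite (band_full xw qk) ltxx.
Qed.

(** The noise of the arrivals and of the departures from k levels, and the one task
    that [full_routing] does not count. *)
Definition fill_error : R := 2 * k.+1%:R * eta + n%:R^-1.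

Lemma fill_drift r t : r0 <= r -> r <= t -> t <= r1 ->
  (forall x, r <= x <= t -> (cnt r < cnt x)%N -> band 0 k x < k%:R) ->
  oint lam r t - mu * oint (band 0 k) r t - fill_error <=
  band 0 k t - band 0 k r.
Proof.
move=> r0r rt tr1 notfull.
have r_ge0 : 0 <= r by exact: le_trans r0r.
have tT : t <= T by exact: le_trans r1_le.
have bM := bbandM 0 k.
have rate : oint (fun x => mu * (band 0 k x + 0%:R * q x 1%N - k%:R * q x k.+1)) r t
    <= mu * oint (band 0 k) r t.
  rewrite -(@ointZ _ T)//; apply: (@le_oint _ T) => //.
  - apply: bounded_measurableZ; apply: bounded_measurableB.
      by apply: bounded_measurableD => //; apply: bounded_measurableZ;
        exact: bounded_measurable_state.
    by apply: bounded_measurableZ; exact: bounded_measurable_state.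
  - exact: bounded_measurableZ.
  - move=> x /andP[rx xt]; have xw : r0 <= x <= r1.
      by apply/andP; split; lra.
    rewrite ler_pM2l// mul0r addr0 gerBl mulr_ge0//.
    exact: (occupancy_ge0 (wocc xw) _).
have := band_increment (leq0n k) kL r_ge0 rt tT.
rewrite subn0 ler_norml => /andP[inc _].
have := count_increment r_ge0 rt tT.
rewrite ler_norml => /andP[cinc _].
have := full_routing r0r rt tr1 notfull.
rewrite -(ler_pM2l (_ : 0 < n%:R^-1)) ?invr_gt0 ?nR// => routes.
have : n%:R^-1 * ((cnt t)%:R - (cnt r)%:R) - n%:R^-1 <=
   n%:R^-1 * ((cnt t - cnt r).-1)%:R :> R.
  rewrite -[X in _ - X <= _]mulr1 -mulrBr ler_wpM2l ?invr_ge0//.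
  rewrite -natrB ?arrival_count_mono// lerBlDr natr1 ler_nat; exact: leqSpred.
move: routes inc cinc rate; rewrite /fill_error -(natr1 k).
set S := n%:R^-1 * \sum_(_ <= _ < _) _; set A := n%:R^-1 * (_ - _).
set Bk := n%:R^-1 * _; set I := oint (fun x => mu * _) r t.
set z := mu * oint (band 0 k) r t => *.
lra.
Qed.

(** If the levels up to k were never full, their mass would satisfy
    v' >= mu (rmin - v) up to noise; comparison with the solution
    rmin (1 - e^(- mu (t - r0))) then makes it exceed k at r1. *)
Lemma level_fills rmin : r0 <= r1 -> (forall t, r0 <= t <= r1 -> mu * rmin <= lam t) ->
  k%:R + fill_error < rmin * (1 - expR (- (mu * (r1 - r0)))) ->
  exists2 x, r0 <= x <= r1 & band 0 k x = k%:R.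
Proof.
move=> r01 lammin big; apply: contrapT => never.
have notfull x : r0 <= x <= r1 -> band 0 k x < k%:R.
  move=> xw; rewrite lt_neqAle band_le// andbT; apply/eqP => e.
  by apply: never; exists x.
pose z t := rmin * (1 - expR (- mu * (t - r0))).
have zM : bounded_measurable T z.
  apply: bounded_measurableZ; apply: bounded_measurableB.
    exact: bounded_measurable_cst.
  apply: bounded_measurable_continuous => x.
  apply: continuous_comp; last exact: continuous_expR.
  apply: cvgM; first exact: cvg_cst.
  by apply: cvgB; [exact: cvg_id|exact: cvg_cst].
have zero : band 0 k r0 >= 0.
  apply: sumr_ge0 => i _; apply: occupancy_ge0; apply: wocc.
  by rewrite lexx.
have := feedback_comparison (T := T) (mu := mu)
  (g := fun t => z t - band 0 k t) (r0 := r0) (r1 := r1) (eta := 0)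
  (eps := fill_error).
move=> /(_ (bounded_measurableB zM (bbandM 0 k)) mu_gt0 r0_ge0 r1_le (lexx 0)).
have drift r s : r0 <= r -> r <= s -> s <= r1 ->
    z s - band 0 k s - (z r - band 0 k r) <=
    fill_error - mu * oint (fun t => z t - band 0 k t) r s.
  move=> r0r rs sr1.
  have r_ge0 : 0 <= r by exact: le_trans r0r.
  have sT : s <= T by exact: le_trans r1_le.
  have nf x : r <= x <= s -> (cnt r < cnt x)%N -> band 0 k x < k%:R.
    by move=> /andP[rx xs] _; apply: notfull; apply/andP; split; lra.
  have := fill_drift r0r rs sr1 nf.
  rewrite (ointB zM (bbandM 0 k))// mulrBr.
  have zdrift : z s - z r = mu * rmin * (s - r) - mu * oint z r s.
    rewrite -oint_cst// -(ointZ mu zM)// -(@ointB _ T) //; last 2 first.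
    - exact: bounded_measurable_cst.
    - exact: bounded_measurableZ.
    rewrite [RHS](_ : _ = oint (fun x => - rmin * (- mu * expR (- mu * (x - r0)))) r s).
      rewrite (@ointZ _ T)//; last first.
        apply: bounded_measurableZ; apply: bounded_measurable_continuous => x.
        apply: continuous_comp; last exact: continuous_expR.
        apply: cvgM; first exact: cvg_cst.
        by apply: cvgB; [exact: cvg_id|exact: cvg_cst].
      by rewrite oint_expR// /z; ring.
    by apply: eq_oint => x _; rewrite /z; ring.
  have lamr : mu * rmin * (s - r) <= oint lam r s.
    rewrite -oint_cst//; apply: (@le_oint _ T) => //.
      exact: bounded_measurable_cst.
    by move=> x /andP[rx xs]; apply: lammin; apply/andP; split; lra.
  move: zdrift lamr; set X := mu * rmin * _; set Y := mu * oint z r s.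
  by set W := mu * oint (band 0 k) r s => *; lra.
move=> /(_ drift); rewrite /z subrr mulr0 expR0 subrr mulr0 sub0r oppr_le0.
move=> /(_ zero r1); rewrite r01 lexx => /(_ isT); rewrite add0r mulNr.
have := band_le (_ : r0 <= r1 <= r1); rewrite r01 lexx => /(_ isT).
by move=> *; lra.
Qed.

(** Start at the last arrival count c for which the levels are full at some time y.
    After the next arrival they are not full, so all tasks go to them at a rate
    at least mu k, while at most mu k departs.  What is lost since y is only the
    error term. *)
Lemma level_stays_full x : r0 <= x <= r1 -> band 0 k x = k%:R ->
  (forall t, r0 <= t <= r1 -> mu * k%:R <= lam t) ->
  forall t, x <= t <= r1 -> k%:R - fill_error <= band 0 k t.
Proof.
move=> xw bx lammin t /andP[xt tr1]; have /andP[r0x xr1] := xw.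
(* the last such count, rather than the last such time, exists for free *)
pose P c := `[< exists2 y, x <= y <= t & cnt y = c /\ band 0 k y = k%:R >].
have exP : exists c, P c by exists (cnt x); apply/asboolP; exists x; rewrite ?lexx.
have tT : t <= T by exact: le_trans r1_le.
have x_ge0 : 0 <= x by exact: le_trans r0x.
have ubP c : P c -> (c <= cnt t)%N.
  move=> /asboolP[y /andP[xy yt] [<- _]]; apply: arrival_count_mono => //.
  exact: le_trans xy.
have [c /asboolP[y /andP[xy yt] [cy by_]] cmax] := ex_maxnP exP ubP.
have r0y : r0 <= y by exact: le_trans xy.
have nf w : y <= w <= t -> (cnt y < cnt w)%N -> band 0 k w < k%:R.
  move=> /andP[yw wt] cw; have ww : r0 <= w <= r1 by apply/andP; split; lra.
  rewrite lt_neqAle band_le// andbT; apply/eqP => bw.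
  have : (cnt w <= c)%N.
    by apply: cmax; apply/asboolP; exists w => //; apply/andP; split; lra.
  by rewrite -cy leqNgt cw.
have := fill_drift r0y yt tr1 nf; rewrite by_.
have y_ge0 : 0 <= y by exact: le_trans xy.
have : mu * oint (band 0 k) y t <= oint lam y t.
  rewrite -(@ointZ _ T)//; apply: (@le_oint _ T) => //.
    exact: bounded_measurableZ.
  move=> w /andP[yw wt]; have ww : r0 <= w <= r1 by apply/andP; split; lra.
  by apply: le_trans (lammin w ww); rewrite ler_pM2l// band_le.
set z := mu * _ => *; lra.
Qed.

(** At x the level l + Delta is not full although the level k is, so l = k.
    Afterwards k stays more than alpha full, which forbids a decrease, and an
    increase would violate the bound l <= k. *)
Lemma threshold_settles x : r0 <= x <= r1 -> band 0 k x = k%:R ->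
  (forall t, r0 <= t <= r1 -> mu * k%:R <= lam t) ->
  0 <= fill_error -> alpha < 1 - fill_error ->
  forall t, x <= t <= r1 -> l t = k.
Proof.
move=> xw bx lammin err0 al; have /andP[r0x xr1] := xw.
have al1 : alpha < 1 by lra.
have x_ge0 : 0 <= x by exact: le_trans r0x.
have level t : x <= t <= r1 -> alpha < q t k.
  move=> tw; have /andP[xt tr1] := tw.
  have tw0 : r0 <= t <= r1 by apply/andP; split; lra.
  have [k0|k0] := posnP k; first by rewrite k0; have [-> _] := wocc tw0.
  have := level_stays_full xw bx lammin tw; have := band_ge_level tw0 k0; lra.
have qx : q x k = 1.
  have [k0|k0] := posnP k; first by rewrite k0; have [-> _] := wocc xw.
  apply/eqP; rewrite eq_le (occupancy_le1 (wocc xw))/=.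
  by have := band_ge_level xw k0; rewrite bx; lra.
apply: (arrival_induction (L := 0) (Q := fun t => l t = k)) => //.
  move=> t /andP[xt tr1] e.
  rewrite -(@threshold_const x t)//; last 2 first.
  - exact: wT xw.
  - by apply: wT; apply/andP; split; lra.
  apply/eqP; rewrite eqn_leq lk//= multiple_le// ltnNge; apply/negP => hk.
  have := open_high xw; rewrite ltNge -qx.
  by rewrite (occupancy_antitone (wocc xw) hk).
move=> s t xs st tr1 stp IH.
have tw : r0 <= t <= r1 by apply/andP; split; lra.
have sw : x <= s <= r1 by apply/andP; split; lra.
have [[_ e]|[lo _]|[_ _ ->]//] := threshold_cases al1 stp.
  have := lk tw; rewrite e IH -[leqRHS]addn0 leq_add2l leqn0 => /eqP D0.
  by move: Delta_gt0; rewrite D0.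
by move: lo; rewrite /lowers IH leNgt level.
Qed.

End window.

(** No task is sent above the level K = l + Delta, which is not full, and the
    departure rate mu (v + K q(K+1)) of the levels above K is at least mu v. *)
Lemma upper_band_decays K b r0 r1 : (K <= b)%N -> (b <= Lmax)%N -> 0 <= r0 -> r1 <= T ->
  (forall t, r0 <= t <= r1 -> q t b.+1 = 0) ->
  (forall t, r0 <= t <= r1 -> (l t + Delta = K)%N /\ q t K < 1) ->
  forall t, r0 <= t <= r1 ->
    band K b t <= band K b r0 * expR (- (mu * (t - r0))) + 2 * b%:R * eta.
Proof.
move=> Kb bL r00 r1T qb0 hK t tw.
rewrite -lerBlDl -[leRHS]add0r.
pose A := band K b r0.
have zM : bounded_measurable T (fun t => A * expR (- mu * (t - r0))).
  apply: bounded_measurableZ; apply: bounded_measurable_continuous => x.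
  apply: continuous_comp; last exact: continuous_expR.
  apply: cvgM; first exact: cvg_cst.
  by apply: cvgB; [exact: cvg_id|exact: cvg_cst].
have -> : - (mu * (t - r0)) = - mu * (t - r0) by rewrite mulNr.
rewrite -/A.
apply: (feedback_comparison (T := T) (mu := mu)
  (g := fun t => band K b t - A * expR (- mu * (t - r0))) (r0 := r0) (r1 := r1)) => //.
- exact: bounded_measurableB.
- move=> r s r0r rs sr1.
  have r_ge0 : 0 <= r by exact: le_trans r0r.
  have sT : s <= T by exact: le_trans r1T.
  have noarr : \sum_((cnt r).+1 <= j < (cnt s).+1) (band_routes K b j)%:R = 0 :> R.
    rewrite big_nat big1// => -[|j] // /andP[rj js].
    have [x [/andP[rx xs] _ _ _ hro]] := arrival_prestate b r_ge0 rs sT rj js.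
    have xw : r0 <= x <= r1 by apply/andP; split; lra.
    have xT : 0 <= x <= T by apply/andP; split; lra.
    have [eK qK] := hK x xw.
    rewrite /band_routes big_nat big1// => i /andP[Ki ib].
    rewrite hro// (route_eq0_above_high _ (sol_occupancy sol xT))//.
      by rewrite eK.
    by rewrite eK.
  have rate : mu * oint (band K b) r s <= oint (fun x =>
      mu * (band K b x + K%:R * q x K.+1 - b%:R * q x b.+1)) r s.
    rewrite -(@ointZ _ T)//; apply: (@le_oint _ T) => //.
    + exact: bounded_measurableZ.
    + apply: bounded_measurableZ; apply: bounded_measurableB.
        by apply: bounded_measurableD => //; apply: bounded_measurableZ;
          exact: bounded_measurable_state.
      by apply: bounded_measurableZ; exact: bounded_measurable_state.
    + move=> x /andP[rx xs]; have xw : r0 <= x <= r1 by apply/andP; split; lra.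
      have xT : 0 <= x <= T by apply/andP; split; lra.
      rewrite ler_pM2l// qb0// mulr0 subr0 lerDl mulr_ge0//.
      exact: (occupancy_ge0 (sol_occupancy sol xT) _).
  have := band_increment Kb bL r_ge0 rs sT.
  rewrite noarr mulr0 subr0 ler_norml => /andP[_ inc].
  have zdrift : A * expR (- mu * (s - r0)) - A * expR (- mu * (r - r0)) =
      - (mu * oint (fun t => A * expR (- mu * (t - r0))) r s).
    rewrite -[RHS]mulNr -(ointZ _ zM)//.
    rewrite [RHS](_ : _ = oint (fun x => A * (- mu * expR (- mu * (x - r0)))) r s).
      rewrite (@ointZ _ T)//; last first.
        apply: bounded_measurableZ; apply: bounded_measurable_continuous => x.
        apply: continuous_comp; last exact: continuous_expR.
        apply: cvgM; first exact: cvg_cst.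
        by apply: cvgB; [exact: cvg_id|exact: cvg_cst].
      by rewrite oint_expR//; ring.
    by apply: eq_oint => x _; ring.
  rewrite (ointB (bbandM K b) zM)// [mu * (_ - oint _ _ _)]mulrBr.
  have eta0 : 2 * (b - K)%:R * eta <= 2 * b%:R * eta.
    have e0 : 0 <= eta.
      rewrite -(pmulr_rge0 _ nR); apply: le_trans (arrival_noise (_ : 0 <= (0:R) <= T)).
        exact: normr_ge0.
      by rewrite lexx ltW.
    by rewrite ler_wpM2r// ler_wpM2l// ler_nat leq_subr.
  move: zdrift rate inc eta0.
  set X := mu * oint (band K b) r s; set Y := mu * oint _ r s.
  by set Z := 2 * (b - K)%:R * eta => *; lra.
- by rewrite subrr mulr0 expR0 mulr1 subrr.
Qed.

(** The schedule: from s0 on the fluid mass stays below (m+1) Delta; between s0 and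
    s1 there are enough arrivals to end the start-up phase and to bring the
    threshold down to m Delta; between s1 and s2 the first m Delta levels fill
    up.  All levels above b are empty at all times, and adding K1 to the top
    level ensures K1 <= b. *)
Lemma settled_system (B K m : nat) (u : R -> R) (d rmin s0 s1 s2 r1 : R)
    (k := (m * Delta)%N) (K1 := (m.+1 * Delta)%N)
    (b := (top_level B K + K1)%N) :
  (0 < Delta)%N -> (1 < n)%N -> alpha + n%:R^-1 < 1 ->
  qn0 B.+1 = 0 -> (ln0 <= B)%N -> (exists k, ln0 = (k * Delta)%N) ->
  B%:R + n%:R^-1 * (cnt T)%:R <= K%:R :> R ->
  (b <= Lmax)%N -> 0 <= eta ->
  bounded_measurable T u ->
  (forall r s, 0 <= r -> r <= s -> s <= T ->
    oint (fun x => lam x - mu * u x) r s <= u s - u r) ->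
  0 <= d -> band 0 b 0 <= u 0 + d ->
  0 <= s0 -> s0 <= s1 -> s1 <= s2 -> s2 <= r1 -> r1 <= T ->
  (level_bound B K < cnt s1 - cnt s0)%N ->
  (forall t, s0 <= t <= r1 ->
    u t + d + 2 * b.+1%:R * eta <= K1%:R * alpha) ->
  (forall t, s1 <= t <= r1 -> mu * rmin <= lam t) -> k%:R <= rmin ->
  k%:R + fill_error k < rmin * (1 - expR (- (mu * (s2 - s1)))) ->
  alpha < 1 - fill_error k ->
  forall t, s2 <= t <= r1 ->
  [/\ l t = k, forall i, (i <= k)%N -> `|1 - q t i| <= fill_error k &
      forall M, \sum_(K1 <= i < M) q t i.+1 <=
        (u s2 + d + 2 * b.+1%:R * eta) * expR (- (mu * (t - s2)))
        + 2 * b%:R * eta].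
Proof.
move=> D0 n1 agap qB lB ldvd0 massK bL eta0 uM udrift d0 init.
move=> s00 s01 s12 s2r1 r1T cnts ulow lammin krmin fill al.
have al1 : alpha < 1 by apply: lt_trans agap; rewrite ltrDl invr_gt0 nR.
have inv t : 0 <= t <= T -> q t (top_level B K).+1 = 0 /\
    ((level_bound B K < cnt t)%N -> q t (l t + Delta)%N < 1).
  by move=> tT; apply: invariant.
have ldvd t : 0 <= t <= T -> exists j, l t = (j * Delta)%N by exact: threshold_dvd.
have qb0 t c : (b <= c)%N -> 0 <= t <= T -> q t c.+1 = 0.
  move=> bc tT; have [qt _] := inv t tT; have qo := sol_occupancy sol tT.
  apply/eqP; rewrite eq_le (occupancy_ge0 qo) andbT -qt.
  by apply: (occupancy_antitone qo); rewrite ltnS (leq_trans _ bc)// leq_addr.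
have tT t : 0 <= t -> t <= r1 -> 0 <= t <= T by move=> t0 tr; rewrite t0 (le_trans tr).
have mass t : 0 <= t <= T -> band 0 b t <= u t + d + 2 * b.+1%:R * eta.
  by apply: total_mass_upper => // t'; exact: qb0.
have K10 : (0 < K1)%N by rewrite muln_gt0.
have K1R : 0 < K1%:R :> R by rewrite ltr0n.
have kK1 : (k + Delta)%N = K1 by rewrite /K1 mulSnr.
have band0 t a c : 0 <= t <= T -> 0 <= band a c t.
  move=> tt; apply: sumr_ge0 => i _.
  exact: (occupancy_ge0 (sol_occupancy sol tt)).
have qK1 t : s0 <= t <= r1 -> q t K1 <= alpha.
  move=> tw; have /andP[s0t tr1] := tw.
  have tt := tT t (le_trans s00 s0t) tr1.
  rewrite -(ler_pM2l K1R); apply: le_trans (ulow t tw); apply: le_trans (mass t tt).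
  apply: (le_trans (level_le_band K1 tt)); rewrite /band.
  rewrite [leRHS](big_cat_nat (n := K1)) ?leq_addl//= lerDl.
  exact: band0.
have lk t : s1 <= t <= r1 -> (l t <= k)%N.
  move=> /andP[s1t tr1].
  have h := threshold_descends D0 (erefl k) s00 r1T ldvd (H := level_bound B K) al1.
  have s0r1 : s0 <= r1 by lra.
  have thr : (l s0 <= level_bound B K)%N.
    by apply: threshold_le => //; exact: tT.
  have {}h := h thr.
  have {}h : (l t <= maxn k (level_bound B K - (cnt t - cnt s0)))%N.
    apply: h => [x xw|x xw|]; rewrite ?kK1 ?qK1//.
      apply: (@le_lt_trans _ _ (n%:R * alpha)); first by rewrite ler_pM2l// qK1.
      rewrite ltrBrDr -(ltr_pM2l (_ : 0 < n%:R^-1)) ?invr_gt0// mulrDr mulKf ?gt_eqF//.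
      by rewrite mulr1 mulVf ?gt_eqF.
    by rewrite (le_trans s01).
  rewrite (leq_trans h)// geq_max leqnn/=.
  rewrite (_ : (_ - (_ - _))%N = 0%N)//; apply/eqP; rewrite subn_eq0.
  apply: (leq_trans (ltnW cnts)); rewrite leq_sub2r// arrival_count_mono//.
    by lra.
  by lra.
have op t : s1 <= t <= r1 -> q t (l t + Delta)%N < 1.
  move=> /andP[s1t tr1]; have [|_ h] := inv t; first by apply: tT => //; lra.
  apply: h; apply: (leq_trans cnts); apply: (leq_trans (leq_subr _ _)).
  by rewrite arrival_count_mono//; lra.
have s10 : 0 <= s1 by lra.
have kLmax : (k <= Lmax)%N.
  by apply: leq_trans bL; apply: leq_trans (leq_addl _ _); rewrite -kK1 leq_addr.
have [x xw bx] : exists2 x, s1 <= x <= s2 & band 0 k x = k%:R.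
  apply: (level_fills D0 (erefl k) kLmax s10 _ ldvd _ _ (rmin := rmin)) => //.
  - by rewrite (le_trans s2r1).
  - by move=> t /andP[s1t ts2]; apply: lk; rewrite s1t (le_trans ts2).
  - by move=> t /andP[s1t ts2]; apply: op; rewrite s1t (le_trans ts2).
  - by move=> t /andP[s1t ts2]; apply: lammin; rewrite s1t (le_trans ts2).
have xw1 : s1 <= x <= r1 by move/andP: xw => [h1 h2]; rewrite h1 (le_trans h2).
have lamk t : s1 <= t <= r1 -> mu * k%:R <= lam t.
  by move=> tw; apply: le_trans (lammin t tw); rewrite ler_pM2l.
have err0 : 0 <= fill_error k.
  by rewrite addr_ge0 ?invr_ge0// !mulr_ge0.
have full := level_stays_full D0 (erefl k) kLmax s10 r1T ldvd lk op xw1 bx lamk.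
have settled := threshold_settles D0 (erefl k) kLmax s10 r1T ldvd lk op xw1 bx
  lamk err0 al.
have xt t : s2 <= t <= r1 -> x <= t <= r1.
  by move=> /andP[s2t ->]; move/andP: xw => [_ xs2]; rewrite (le_trans xs2).
move=> t tw; have /andP[s2t tr1] := tw.
have tt : 0 <= t <= T by apply: tT => //; lra.
have qo := sol_occupancy sol tt.
split; first exact: settled (xt t tw).
  move=> i ik; have qik := occupancy_antitone qo ik.
  have qi1 := occupancy_le1 qo i.
  rewrite ger0_norm ?subr_ge0//.
  have [k0|k0] := posnP k; last first.
    have s1t : s1 <= t <= r1 by rewrite (le_trans s12).
    have := band_ge_level s10 r1T s1t k0; have := full t (xt t tw); lra.
  have -> : i = 0%N by move: ik; rewrite k0 leqn0 => /eqP.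
  by have [-> _] := qo; rewrite subrr.
move=> M; have K1b : (K1 <= b)%N by exact: leq_addl.
have s20 : 0 <= s2 by lra.
have decay : band K1 b t <= band K1 b s2 * expR (- (mu * (t - s2))) + 2 * b%:R * eta.
  apply: (upper_band_decays K1b bL s20 r1T) => // y /andP[s2y yr1].
    by apply: qb0 => //; apply: tT => //; lra.
  have yw : s1 <= y <= r1 by apply/andP; split; lra.
  have ly : l y = k by apply: settled; apply: xt; rewrite s2y.
  by have := op y yw; rewrite ly kK1.
apply: (@le_trans _ _ (band K1 b t)).
  rewrite /band; have [Mb|bM] := leqP M b.
    have [K1M|MK1] := leqP K1 M; last by rewrite big_geq ?(ltnW MK1)//; exact: band0.
    by rewrite [leRHS](big_cat_nat (n := M))//= lerDl; exact: band0.
  rewrite (big_cat_nat (n := b)) ?(ltnW bM)//= [X in _ + X <= _]big_nat.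
  by rewrite [X in _ + X <= _]big1 ?addr0// => i /andP[bi _]; exact: qb0.
apply: (le_trans decay); rewrite lerD2r ler_wpM2r ?expR_ge0//.
have s2T : 0 <= s2 <= T by apply: tT => //; lra.
apply: le_trans (mass s2 s2T); rewrite /band.
rewrite [leRHS](big_cat_nat (n := K1))//= lerDr.
exact: band0.
Qed.

End noise.

End system_path.

(** * The settling schedule *)
Section settling.
Context {R : realType}.
Variables (T mu : R) (Delta m : nat) (lam : R -> R) (q0 : nat -> R) (a b : R).
Hypotheses (T_gt0 : 0 < T) (mu_gt0 : 0 < mu) (Delta_gt0 : (0 < Delta)%N)
  (lamM : bounded_measurable T lam)
  (lam_ge0 : forall t, 0 <= t <= T -> 0 <= lam t)
  (a_ge0 : 0 <= a) (a_le_b : a <= b) (b_le_T : b <= T).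

Local Notation u := (fluid_mass mu lam q0).
Local Notation rmin := (load_min mu lam a b).
Local Notation rmax := (load_max mu lam a b).

Let abT t : a <= t <= b -> 0 <= t <= T.
Proof. by move=> /andP[h1 h2]; rewrite (le_trans a_ge0 h1) (le_trans h2). Qed.

Lemma load_min_le t : a <= t <= b -> mu * rmin <= lam t.
Proof.
move=> tab; rewrite mulrC -ler_pdivlMr//; apply: ge_inf; last first.
  by exists t => //=; rewrite in_itv.
exists 0 => _ [s /=] + <-; rewrite in_itv/= => /abT/lam_ge0 l0.
by rewrite divr_ge0// ltW.
Qed.

Lemma load_max_ge t : a <= t <= b -> lam t <= rmax * mu.
Proof.
move=> tab; rewrite -ler_pdivrMr//; apply: ub_le_sup; last first.
  by exists t => //=; rewrite in_itv.
have [_ [M lamle]] := lamM.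
exists (M / mu) => _ [s /=] + <-; rewrite in_itv/= => /abT/lamle l0.
by rewrite ler_pM2r ?invr_gt0// (le_trans (ler_norm _)).
Qed.

(** The settling time is the wait until u, relaxing exponentially towards at most
    rmax, is below (m+1) Delta, plus the time base in which
    rmin (1 - e^(- mu t)) reaches m Delta.  The excess of sigma over it is cut
    into three equal parts del, which make all the inequalities strict: one for u
    to move away from (m+1) Delta, one for the threshold to descend, and one for
    the levels to fill. *)
Lemma settling_schedule (sigma : R) : load_bounded mu lam q0 a b m Delta ->
  settling_time mu lam q0 a b m Delta < sigma -> sigma < b - a ->
  exists s0 s1 kappa : R,
  [/\ [/\ a <= s0, s0 < s1 & s1 <= a + sigma], 0 < kappa,
      forall t, s0 <= t <= b -> u t <= (m.+1 * Delta)%:R - kappa &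
      (m * Delta)%:R < rmin * (1 - expR (- (mu * (a + sigma - s1))))].
Proof.
move=> [krmin rmm rmaxK _]; set k : R := (m * Delta)%:R in krmin *.
set K1 : R := (m.+1 * Delta)%:R in rmaxK *.
rewrite /settling_time -/k -/K1.
set base := mu^-1 * ln (rmin / (rmin - k)).
have k0 : 0 <= k by exact: ler0n.
have rmin0 : 0 < rmin by lra.
have base_exp : expR (- (mu * base)) = (rmin - k) / rmin.
  rewrite /base mulVKf ?gt_eqF// expRN lnK ?invf_div// posrE divr_gt0//.
  by rewrite subr_gt0.
have base0 : 0 <= base.
  rewrite /base mulr_ge0 ?invr_ge0 ?(ltW mu_gt0)// ln_ge0// ler_pdivlMr ?subr_gt0//.
  lra.
pose wait := if rmax < u a then
  mu^-1 * Num.max (ln ((u a - rmax) / (K1 - rmax))) 0 else 0.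
have wait0 : 0 <= wait.
  rewrite /wait; case: ifP => // _.
  by rewrite mulr_ge0 ?invr_ge0 ?(ltW mu_gt0)// le_max lexx orbT.
have -> : (if rmax < u a then base + mu^-1 *
    Num.max (ln ((u a - rmax) / (K1 - rmax))) 0 else base) = base + wait.
  by rewrite /wait; case: ifP => //; rewrite addr0.
move=> sig1 sig2; pose del := (sigma - (base + wait)) / 3.
have del0 : 0 < del by rewrite /del; lra.
have edel : expR (- (mu * del)) < 1 by rewrite expR_lt1 oppr_lt0 mulr_gt0.
pose kappa := (K1 - rmax) * (1 - expR (- (mu * del))).
exists (a + wait + del), (a + wait + del + del), kappa; split.
- split; [lra|lra|]; rewrite /del; lra.
- by rewrite mulr_gt0// subr_gt0.
- move=> t /andP[s0t tb].
  have at_ : a <= t by lra.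
  have tT : t <= T by exact: le_trans b_le_T.
  have := @fluid_mass_upper _ T mu lam q0 mu_gt0 lamM rmax a t a_ge0 at_ tT.
  have lmax x : a <= x <= t -> lam x <= rmax * mu.
    by move=> /andP[ax xt]; apply: load_max_ge; rewrite ax (le_trans xt).
  move=> /(_ lmax) => hu; apply: (le_trans hu).
  have e0 : 0 < expR (- (mu * (t - a))) by exact: expR_gt0.
  have ede : 0 < expR (- (mu * del)) by exact: expR_gt0.
  have [ur|ru] := leP (u a) rmax.
    have : (u a - rmax) * expR (- (mu * (t - a))) <= 0.
      by rewrite mulr_le0_ge0 ?(ltW e0)// subr_le0.
    have : 0 <= (K1 - rmax) * expR (- (mu * del)).
      by rewrite mulr_ge0 ?(ltW ede)// subr_ge0 ltW.
    by rewrite /kappa => *; lra.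
  suff : (u a - rmax) * expR (- (mu * (t - a))) <=
      (K1 - rmax) * expR (- (mu * del)) by rewrite /kappa => *; lra.
  have wait_exp : expR (- (mu * wait)) <= (K1 - rmax) / (u a - rmax).
    rewrite /wait ru mulVKf ?gt_eqF//.
    have X0 : 0 < (u a - rmax) / (K1 - rmax) by rewrite divr_gt0// subr_gt0.
    rewrite -[leRHS]invf_div -[X in _ <= X^-1]lnK ?posrE// -expRN ler_expR lerN2.
    by rewrite le_max lexx.
  apply: (@le_trans _ _ ((u a - rmax) * (expR (- (mu * wait)) * expR (- (mu * del))))).
    rewrite ler_pM2l ?subr_gt0// -expRD ler_expR -opprD -mulrDr lerN2 ler_pM2l//.
    lra.
  rewrite mulrA ler_pM2r// mulrC -ler_pdivlMr ?subr_gt0//.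
- have -> : a + sigma - (a + wait + del + del) = base + del by rewrite /del; field.
  rewrite [mu * (base + del)]mulrDr opprD expRD base_exp.
  have : (rmin - k) * expR (- (mu * del)) < rmin - k.
    by rewrite gtr_pMr ?subr_gt0.
  rewrite mulrBr mulr1 [rmin * _]mulrA [rmin * (_ / _)]mulrCA mulfV ?gt_eqF// mulr1.
  by move=> *; lra.
Qed.

End settling.

(** * Large systems *)
Lemma common_lower_bound (R : realType) (s : seq R) :
  (forall x, x \in s -> 0 < x) -> exists2 e, 0 < e & forall x, x \in s -> e <= x.
Proof.
elim: s => [|y s IH] pos; first by exists 1.
have [x xs|e e0 es] := IH; first by apply: pos; rewrite inE xs orbT.
have y0 : 0 < y by apply: pos; rewrite inE eqxx.
exists (Num.min e y); first by rewrite lt_min e0.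
by move=> x; rewrite inE => /orP[/eqP ->|/es ex]; rewrite ge_min ?lexx ?ex ?orbT.
Qed.

Lemma limn_einf_gt0 (R : realType) (f : nat -> R) :
  (0 < limn_einf (fun n => (f n)%:E))%E ->
  exists2 c, 0 < c & \forall n \near \oo, c <= f n.
Proof.
rewrite limn_einf_lim => h.
have [c /andP[c0 cl]] : exists c : R, (0 < c%:E < limn (einfs (fun n => (f n)%:E)))%E.
  move: h; case: (limn _) => [r|_|//].
    rewrite lte_fin => r0; exists (r / 2); rewrite !lte_fin; apply/andP; split; lra.
  by exists 1; rewrite lte_fin ltr01 ltry.
exists c; first by rewrite -lte_fin.
have [n0 cn] : exists n0, (c%:E < einfs (fun n => (f n)%:E) n0)%E.
  apply: contrapT => /forallNP never; move: cl; rewrite ltNge => /negP; apply.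
  apply: lime_le; first exact: is_cvg_einfs.
  by apply: nearW => n; rewrite leNgt; apply/negP; exact: never.
exists n0 => // n /= n0n; rewrite -lee_fin (le_trans (ltW cn))//.
by apply: ereal_inf_lbound; exists n.
Qed.

Section sample_path_asymptotics.
Context {R : realType}.
Variables (T mu : R) (Delta : nat) (alpha : nat -> R) (lam : R -> R).
Variables (N : nat -> R -> nat) (U : nat -> R).
Variables (qn0 : nat -> nat -> R) (ln0 : nat -> nat) (q0 : nat -> R) (B : nat).
Variables (q : nat -> R -> nat -> R) (l : nat -> R -> nat).
Hypotheses (T_gt0 : 0 < T) (mu_gt0 : 0 < mu) (Delta_gt0 : (0 < Delta)%N).
Hypotheses (lamM : bounded_measurable T lam)
  (lam_ge0 : forall t, 0 <= t <= T -> 0 <= lam t).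
Hypotheses (N_mono : forall i s t, 0 <= s -> s <= t -> (N i s <= N i t)%N)
  (N_start : forall i, N i 0 = 0%N)
  (N_right : forall x, 0 <= x -> N 0%N y @[y --> x^'+] --> N 0%N x)
  (N_jump : unit_jumps (N 0%N))
  (N_noise : forall i, subdiffusive (N i))
  (U01 : forall j, (0 < j)%N -> 0 <= U j < 1).
Hypotheses (sol : forall n, (0 < n)%N ->
    system_solution T mu Delta (alpha n) lam n N U (q n) (l n) (qn0 n) (ln0 n))
  (qn0_occ : forall n, (0 < n)%N -> occupancy (qn0 n))
  (qn0_lattice : forall n, (0 < n)%N -> forall i, exists k : nat, n%:R * qn0 n i = k%:R)
  (ln0_dvd : forall n, (0 < n)%N -> exists k, ln0 n = (k * Delta)%N)
  (qn0_cvg : forall i, qn0 n i @[n --> \oo] --> q0 i)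
  (qn0_B : forall n, (0 < n)%N -> qn0 n B.+1 = 0)
  (ln0_B : forall n, (0 < n)%N -> (ln0 n <= B)%N).

Local Notation u := (fluid_mass mu lam q0).
Local Notation cnt := (arrival_count lam ^~ N).

Lemma initial_limit_above i : (B < i)%N -> q0 i = 0.
Proof.
move=> Bi; have <- : limn (fun n => qn0 n i) = q0 i by apply: cvg_lim => //; exact: qn0_cvg.
apply: cvg_lim => //; apply: cvg_near_cst.
near=> n; have n0 : (0 < n)%N by near: n; exact: nbhs_infty_gt.
apply/eqP; rewrite eq_le (occupancy_ge0 (qn0_occ n0)) andbT -(qn0_B n0).
exact: (occupancy_antitone (qn0_occ n0)).
Unshelve. all: by end_near. Qed.

Lemma initial_massE c : (B <= c)%N ->
  limn (fun k => \sum_(1 <= i < k) q0 i) = \sum_(0 <= i < c) q0 i.+1.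
Proof.
move=> Bc; apply: cvg_lim => //; apply: cvg_near_cst; near=> k.
have ck : (c < k)%N by near: k; exact: nbhs_infty_gt.
rewrite (big_cat_nat (n := c.+1))//= big_add1/= [X in _ + X]big_nat.
rewrite [X in _ + X]big1 ?addr0// => i /andP[ci _].
by rewrite initial_limit_above// (leq_ltn_trans Bc).
Unshelve. all: by end_near. Qed.

Lemma initial_mass_ge0 : 0 <= limn (fun k => \sum_(1 <= i < k) q0 i).
Proof.
rewrite (initial_massE (leqnn B)); apply: sumr_ge0 => i _.
have <- : limn (fun n => qn0 n i.+1) = q0 i.+1 
  by apply: cvg_lim => //; exact: qn0_cvg.
apply: limr_ge; first by apply/cvg_ex; exists (q0 i.+1); exact: qn0_cvg.
near=> n; have n0 : (0 < n)%N by near: n; exact: nbhs_infty_gt.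
exact: (occupancy_ge0 (qn0_occ n0)).
Unshelve. all: by end_near. Qed.

(** The initial mass converges because it is a sum over the finitely many levels
    up to B. *)
Lemma initial_band_cvg c : (B <= c)%N -> forall d, 0 < d ->
  \forall n \near \oo, \sum_(0 <= i < c) qn0 n i.+1 <= u 0 + d.
Proof.
move=> Bc d d0.
have -> : u 0 = \sum_(0 <= i < c) q0 i.+1.
  rewrite /fluid_mass integral_closed0 addr0 mulr0 oppr0 expR0 mulr1.
  exact: initial_massE.
have : (fun n => \sum_(0 <= i < c) qn0 n i.+1) @ \oo --> \sum_(0 <= i < c) q0 i.+1.
  elim: c {Bc} => [|c IH].
    by under eq_fun do rewrite big_geq//; rewrite big_geq//; exact: cvg_cst.
  under eq_fun do rewrite big_nat_recr//=.
  by rewrite big_nat_recr//=; apply: cvgD.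
move=> /cvgr_le; apply; lra.
Qed.

(** All the Poisson clocks are read at times of order n: the rates of the arrivals
    and of the departures from the first L levels are bounded. *)
Lemma eventually_noise_le (gamma e : R) (L : nat) : 0 <= gamma < 2^-1 -> 0 < e ->
  \forall n \near \oo, [/\ (0 < n)%N,
    forall t, 0 <= t <= T ->
      `|(cnt n t)%:R - n%:R * \int[lebesgue_measure]_(s in `[0, t]) lam s| <=
      n%:R * (e * n%:R `^ (- gamma)) &
    forall i t, (i < L)%N -> 0 <= t <= T ->
      `|(N i.+1 (departure_clock mu n (q n) t i))%:R -
        departure_clock mu n (q n) t i| <= n%:R * (e * n%:R `^ (- gamma))].
Proof.
move=> gam e0.
pose LT := \int[lebesgue_measure]_(s in `[0, T]) lam s.
have LamE t : 0 <= t <= T -> LT = \int[lebesgue_measure]_(s in `[0, t]) lam s + oint lam t T.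
  by move=> /andP[t0 tT]; rewrite -(oint_closedB lamM t0 tT (lexx T)) addrC subrK.
have Lam_ge0 t : 0 <= t <= T -> 0 <= \int[lebesgue_measure]_(s in `[0, t]) lam s.
  move=> /andP[t0 tT]; apply: Rintegral_ge0 => s /=; rewrite in_itv/= => /andP[s0 st].
  by rewrite lam_ge0// s0 (le_trans st).
have LT0 : 0 <= LT by apply: Lam_ge0; rewrite lexx ltW.
have powE (n : nat) : (0 < n)%N ->
    e * n%:R `^ (1 - gamma) = n%:R * (e * n%:R `^ (- gamma)) :> R.
  move=> n0; rewrite powRD ?powRr1// 1?mulrCA//.
  by apply/implyP => _; rewrite pnatr_eq0 -lt0n.
have near_dep : \forall n \near \oo, forall i, (i < L)%N -> forall x,
    0 <= x <= (mu * L%:R * T) * n%:R ->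
    `|(N i.+1 x)%:R - x| <= e * n%:R `^ (1 - gamma).
  have C0 : 0 <= mu * L%:R * T by rewrite !mulr_ge0// ltW.
  move: (mu * L%:R * T) C0 => C C0.
  elim: L => [|L IH]; first exact: nearW.
  apply: filterS2 IH (N_noise L.+1 gam C0 e0) => n IH hL i.
  by rewrite ltnS leq_eqVlt => /predU1P[->//|]; exact: IH.
have n_gt0 : \forall n \near \oo, (0 < n)%N by exact: nbhs_infty_gt.
apply: filterS3 n_gt0 (N_noise 0%N gam LT0 e0) near_dep => n n0 arr dep; split => //.
  move=> t tT; rewrite -powE// /arrival_count; apply: arr.
  rewrite mulr_ge0 ?Lam_ge0//= mulrC ler_wpM2r// (LamE t tT) lerDl oint_ge0//.
  by case/andP: tT => t0 tT x /andP[tx xT]; rewrite lam_ge0//; lra.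
move=> i t iL tT; rewrite -powE//; apply: dep => //.
have /andP[-> h] := departure_clock_itv T_gt0 mu_gt0 n0 (sol n0) i tT.
apply: (le_trans h); rewrite mulrC ler_wpM2r// ler_wpM2r ?(ltW T_gt0)//.
by rewrite ler_pM2l// ler_nat.
Qed.

Variables (m : nat) (a b sigma gamma0 : R).
Hypotheses (a_ge0 : 0 <= a) (a_le_b : a <= b) (b_le_T : b <= T)
  (bounded : load_bounded mu lam q0 a b m Delta)
  (sigma_gt : settling_time mu lam q0 a b m Delta < sigma)
  (sigma_lt : sigma < b - a)
  (gamma0_itv : 0 < gamma0 < 2^-1)
  (alpha_cvg : alpha n @[n --> \oo] --> (1 : R))
  (alpha_rate : (0 < limn_einf (fun n => (n%:R `^ gamma0 * (1 - alpha n))%:E))%E).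

(** Multiplied by n^gamma, the noise is at most e, chosen small enough for all the
    error terms of [settled_system].  In particular n^gamma [fill_error] ends up
    below c0 <= n^gamma (1 - alpha_n), where gamma0 <= gamma is used. *)
Lemma eventually_settled (gamma eps : R) : gamma0 <= gamma -> gamma < 2^-1 ->
  0 < eps ->
  \forall n \near \oo, forall t, a + sigma <= t <= b ->
  [/\ l n t = (m * Delta)%N,
      forall i, (i <= m * Delta)%N -> n%:R `^ gamma * `|1 - q n t i| <= eps &
      forall M, \sum_(m.+1 * Delta <= i < M)
        q n t i.+1 * expR (mu * (t - (a + sigma))) <= u (a + sigma) + eps].
Proof.
move=> g0g g2 eps0.
have [ha hab hbT hsig] := And4 a_ge0 a_le_b b_le_T sigma_lt.
have s2b : a + sigma <= b by lra.
(* Linear facts, isolated from the many hypotheses that follow: [third] bounds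
   [fill_error] and the others serve [al_gap], [counts] and the mass bounds. *)
have third (c x y z : R) : 0 < c -> x * (8 * y) <= c -> z <= c / 4 ->
    2 * y * x + z < c by move=> *; lra.
have gap_arith (x y z : R) : x < 1 - y -> z <= y -> x + z < 1 by move=> *; lra.
have half (x y z w : R) : 0 < x -> x <= y -> z <= x / 8 -> - (2 * z) <= w - y -> x / 2 <= w.
  by move=> *; lra.
have count_arith (x y z w : R) : 2 * x <= y * z -> y * (z / 2) <= w -> x <= w.
  by move=> *; lra.
have mass_arith (x y z v w c : R) : 0 < c -> x <= y - c -> z <= c / 4 ->
    w <= v -> v * 16 <= c -> x + z + 2 * w <= y - c / 4 by move=> *; lra.
have tail_arith (x y v w v1 w1 c : R) : 0 < c -> 16 * v <= c -> y <= c / 4 -> w <= v ->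
    v1 <= w1 -> w1 <= v -> x + y + 2 * v1 + 2 * w <= x + c by move=> *; lra.
have /andP[gamma0_gt0 _] := gamma0_itv.
have g_ge0 : 0 <= gamma by exact: le_trans (ltW gamma0_gt0) g0g.
have g_itv : 0 <= gamma < 2^-1 by rewrite g2 g_ge0.
have [s0 [s1 [kap [[as0 s01 s1s] kap0 ulow fill]]]] :=
  settling_schedule mu_gt0 lamM a_ge0 b_le_T bounded sigma_gt sigma_lt.
have [c0 c0_gt0 near_c0] := limn_einf_gt0 alpha_rate.
have [krmin _ _ _] := bounded.
have lammin := load_min_le mu_gt0 lam_ge0 a_ge0 b_le_T.
set k := (m * Delta)%N in fill krmin *.
set K1 := (m.+1 * Delta)%N in ulow *.
set rmin := load_min mu lam a b in fill krmin lammin.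
have rmin0 : 0 < rmin by apply: le_lt_trans krmin.
have K10 : 0 < K1%:R :> R by rewrite ltr0n muln_gt0.
have ab_ge0 : 0 <= s0 by lra.
have s1b : s1 <= b by lra.
set gap := rmin * _ in fill.
pose LT := \int[lebesgue_measure]_(s in `[0, T]) lam s.
pose K := Num.bound `|B%:R + LT + 1|.
have massK : B%:R + LT + 1 <= K%:R.
  by apply: (le_trans (ler_norm _)); apply: ltW; exact: archi_boundP.
pose bt := (top_level Delta B K + K1)%N.
pose E := expR (mu * T).
have E1 : 1 <= E by rewrite /E -expR0 ler_expR mulr_ge0// ltW.
pose th := Num.min (Num.min (c0 / 4) (eps / 4)) ((gap - k%:R) / 4).
have th0 : 0 < th by rewrite !lt_min !divr_gt0// subr_gt0.
pose d := Num.min (kap / 4) (eps / 4).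
have d0 : 0 < d by rewrite lt_min !divr_gt0.
pose del := mu * rmin * (s1 - s0).
have del0 : 0 < del by rewrite /del !mulr_gt0// subr_gt0.
have [e e0 es] : exists2 e : R, 0 < e & forall x, x \in [:: 1; c0 / (8 * k.+1%:R);
  eps / (8 * k.+1%:R); (gap - k%:R) / (8 * k.+1%:R); del / 8;
  kap / (16 * bt.+1%:R); eps / (16 * bt.+1%:R * E)] -> e <= x.
  apply: common_lower_bound => x; rewrite !inE.
  have E0 : 0 < E by lra.
  by case/or4P => [/eqP->|/eqP->|/eqP->|/or4P[] /eqP->];
    rewrite ?divr_gt0 ?mulr_gt0 ?subr_gt0 ?ltr0n.
have near_noise := eventually_noise_le bt g_itv e0.
have near_init : \forall n \near \oo, \sum_(0 <= i < bt) qn0 n i.+1 <= u 0 + d.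
  apply: initial_band_cvg => //.
  by rewrite /bt /top_level -!addnA leq_addr.
pose H := level_bound B K.
have g1 : 0 < 1 - gamma by lra.
near=> n => t tw.
have [n0 arr dep] : [/\ (0 < n)%N,
    forall t, 0 <= t <= T ->
      `|(cnt n t)%:R - n%:R * \int[lebesgue_measure]_(s in `[0, t]) lam s| <=
      n%:R * (e * n%:R `^ (- gamma)) &
    forall i t, (i < bt)%N -> 0 <= t <= T ->
      `|(N i.+1 (departure_clock mu n (q n) t i))%:R -
        departure_clock mu n (q n) t i| <= n%:R * (e * n%:R `^ (- gamma))].
  by near: n.
set eta := e * n%:R `^ (- gamma) in arr dep.
have init_n : \sum_(0 <= i < bt) qn0 n i.+1 <= u 0 + d by near: n.
have c0n : c0 <= n%:R `^ gamma0 * (1 - alpha n) by near: n.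
have n_gt1 : (1 < n)%N by near: n; exact: nbhs_infty_gt.
have n_th : th^-1 <= n%:R `^ (1 - gamma) by near: n; exact: near_powR_ge.
have n_del : 2 * H.+1%:R / del <= n%:R by near: n; exact: nbhs_infty_ger.
have al_n : 1 - kap / (4 * K1%:R) <= alpha n.
  near: n; apply: (cvgr_ge _ alpha_cvg).
  by rewrite gtrBl divr_gt0// mulr_gt0.
have nR : 0 < n%:R :> R by rewrite ltr0n.
have n1 : 1 <= n%:R :> R by rewrite (ler_nat _ 1).
pose x := n%:R `^ gamma.
have x0 : 0 < x by exact: powR_gt0.
have x1 : 1 <= x by have := ler_powR n1 g_ge0; rewrite powRr0.
have xeta : x * eta = e.
  by rewrite /x /eta mulrCA powRN mulfV ?mulr1// gt_eqF.
have eta0 : 0 <= eta by rewrite mulr_ge0 ?powR_ge0// ltW.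
have eta_e : eta <= e by rewrite -xeta ler_peMl.
have xn : x * n%:R^-1 <= th.
  have -> : x * n%:R^-1 = (n%:R `^ (1 - gamma))^-1.
    rewrite -powRN opprB powRD ?powR_inv1 ?ltW//.
    by apply/implyP => _; rewrite gt_eqF.
  by rewrite -[th]invrK lef_pV2 ?posrE ?powR_gt0 ?invr_gt0.
have n_inv : n%:R^-1 <= th.
  by apply: le_trans xn; rewrite ler_peMl ?invr_ge0.
have ninv0 : 0 < n%:R^-1 :> R by rewrite invr_gt0.
have [[th_c0 th_eps] th_gap] : (th <= c0 / 4 /\ th <= eps / 4) /\
    th <= (gap - k%:R) / 4.
  by rewrite /th !ge_min !lexx !orbT.
have [d_kap d_eps] : d <= kap / 4 /\ d <= eps / 4.
  by rewrite /d !ge_min !lexx !orbT.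
have alx : c0 <= x * (1 - alpha n).
  have : 0 < n%:R `^ gamma0 * (1 - alpha n) by exact: lt_le_trans c0n.
  rewrite pmulr_rgt0 ?powR_gt0// => al0; apply: (le_trans c0n).
  by rewrite ler_wpM2r ?(ltW al0)// ler_powR.
have k1 : 0 < k.+1%:R :> R by rewrite ltr0n.
have b1 : 0 < bt.+1%:R :> R by rewrite ltr0n.
have e_1 : e <= 1 by apply: es; rewrite !inE eqxx.
have e_c0 : e * (8 * k.+1%:R) <= c0.
  by rewrite -ler_pdivlMr ?mulr_gt0//; apply: es; rewrite !inE eqxx !orbT.
have e_eps : e * (8 * k.+1%:R) <= eps.
  by rewrite -ler_pdivlMr ?mulr_gt0//; apply: es; rewrite !inE eqxx !orbT.
have e_gap : e * (8 * k.+1%:R) <= gap - k%:R.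
  by rewrite -ler_pdivlMr ?mulr_gt0//; apply: es; rewrite !inE eqxx !orbT.
have e_del : e <= del / 8 by apply: es; rewrite !inE eqxx !orbT.
have e_kap : e * (16 * bt.+1%:R) <= kap.
  by rewrite -ler_pdivlMr ?mulr_gt0//; apply: es; rewrite !inE eqxx !orbT.
have e_epsE : e * (16 * bt.+1%:R * E) <= eps.
  rewrite -ler_pdivlMr; first by apply: es; rewrite !inE eqxx !orbT.
  by rewrite !mulr_gt0// (lt_le_trans ltr01 E1).
have err_x : x * fill_error n eta k <= 2 * k.+1%:R * e + th.
  by rewrite /fill_error mulrDr mulrCA xeta lerD2l.
have err_small : fill_error n eta k <= 2 * k.+1%:R * e + th.
  by rewrite /fill_error lerD// ler_wpM2l// mulr_ge0.
have al_err : alpha n < 1 - fill_error n eta k.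
  rewrite ltrBrDl -ltrBrDr -(ltr_pM2l x0); apply: le_lt_trans err_x _.
  by apply: lt_le_trans alx; exact: third.
have al_gap : alpha n + n%:R^-1 < 1.
  have h : 0 <= 2 * k.+1%:R * eta by do 2 apply: mulr_ge0 => //.
  have : n%:R^-1 <= fill_error n eta k by rewrite /fill_error lerDr.
  exact: gap_arith.
have mass_n : B%:R + n%:R^-1 * (cnt n T)%:R <= K%:R :> R.
  apply: le_trans massK; rewrite -addrA lerD2l.
  have TT : 0 <= T <= T by rewrite lexx ltW.
  have := arr T TT; rewrite -/LT ler_norml => /andP[_ h].
  rewrite -(ler_pM2l nR) mulVKf ?gt_eqF// mulrDr mulr1.
  rewrite lerBlDl in h; apply: (le_trans h); rewrite lerD2l -[leRHS]mulr1.
  by rewrite ler_pM2l// (le_trans eta_e).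
have counts : (level_bound B K < cnt n s1 - cnt n s0)%N.
  have s1T : s1 <= T by exact: le_trans b_le_T.
  have := count_increment n0 lamM arr ab_ge0 (ltW s01) s1T.
  rewrite ler_norml => /andP[inc _].
  have del_le : del <= oint lam s0 s1.
    rewrite /del -oint_cst ?(ltW s01)//; apply: (@le_oint _ T) => //.
      exact: bounded_measurable_cst.
    move=> y /andP[y1 y2]; apply: lammin.
    by rewrite (le_trans as0 (ltW y1)) (le_trans y2).
  rewrite -(ltr_nat R) natrB ?(arrival_count_mono n0 lamM lam_ge0 N_mono ab_ge0 (ltW s01) s1T)//.
  rewrite -/H (lt_le_trans (_ : H%:R < H.+1%:R)) ?ltr_nat//.
  move: n_del; rewrite ler_pdivrMr// => n_del; apply: (count_arith _ _ _ _ n_del).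
  rewrite -[leRHS](mulVKf (lt0r_neq0 nR)) ler_pM2l//.
  exact: (half _ _ _ _ del0 del_le (le_trans eta_e e_del) inc).
have [lt_ qt_ bt_] : [/\ l n t = k,
    forall i, (i <= k)%N -> `|1 - q n t i| <= fill_error n eta k &
    forall M, \sum_(K1 <= i < M) q n t i.+1 <=
      (u (a + sigma) + d + 2 * bt.+1%:R * eta) *
        expR (- (mu * (t - (a + sigma)))) + 2 * bt%:R * eta].
  apply: (settled_system T_gt0 mu_gt0 n0 lamM lam_ge0 N_mono N_start N_right
    N_jump U01 (sol n0) (qn0_lattice n0) arr dep (B := B) (K := K) (m := m)
    (u := u) (d := d) (rmin := rmin) (s0 := s0) (s1 := s1) (s2 := a + sigma)
    (r1 := b)) => //.
  - exact: qn0_B.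
  - exact: ln0_B.
  - exact: ln0_dvd.
  - apply: bounded_measurable_fluid_mass => //; first exact: ltW.
    exact: initial_mass_ge0.
  - move=> r s; apply: fluid_mass_drift => //; first exact: ltW.
    exact: initial_mass_ge0.
  - exact: ltW.
  - rewrite /band; under eq_bigr do rewrite (state0 T_gt0 N_start (sol n0)).
    exact: init_n.
  - exact: ltW.
  - move=> y yw.
    have : K1%:R * (1 - kap / (4 * K1%:R)) <= K1%:R * alpha n by rewrite ler_pM2l.
    rewrite (_ : K1%:R * _ = K1%:R - kap / 4); last by field; rewrite gt_eqF.
    apply: le_trans; rewrite -[2 * _ * _]mulrA.
    apply: (mass_arith _ _ _ (bt.+1%:R * e) _ _ kap0 (ulow y yw) d_kap).
      by rewrite ler_pM2l.
    by apply: le_trans e_kap; rewrite [leLHS](_ : _ = e * (16 * bt.+1%:R))//; ring.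
  - move=> y /andP[y1 y2]; apply: lammin.
    by rewrite (le_trans as0 (le_trans (ltW s01) y1)).
  - exact: ltW.
  - apply: (le_lt_trans (_ : _ <= k%:R + (2 * k.+1%:R * e + th))).
      by rewrite lerD2l.
    by rewrite addrC -ltrBrDr; apply: third => //; rewrite subr_gt0.
split => //.
  move=> i ik; apply: (@le_trans _ _ (x * fill_error n eta k)).
    by rewrite ler_pM2l// qt_.
  by apply: (le_trans err_x); apply/ltW; exact: third.
move=> M; rewrite -mulr_suml; set E' := expR (mu * _).
have E'0 : 0 < E' by exact: expR_gt0.
have E'E : E' <= E.
  rewrite ler_expR ler_pM2l// lerBlDl; have /andP[_ tb] := tw.
  rewrite (le_trans tb)// (le_trans hbT)// lerDr.
  exact: (le_trans ab_ge0 (le_trans (ltW s01) s1s)).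
have EE : expR (- (mu * (t - (a + sigma)))) * E' = 1 by rewrite mulrC expRxMexpNx_1.
apply: (@le_trans _ _ (((u (a + sigma) + d + 2 * bt.+1%:R * eta) *
        expR (- (mu * (t - (a + sigma)))) + 2 * bt%:R * eta) * E')).
  by rewrite ler_wpM2r// ltW.
rewrite mulrDl -mulrA EE mulr1.
have : bt.+1%:R * eta <= bt.+1%:R * e by rewrite ler_pM2l.
have : bt.+1%:R * e <= bt.+1%:R * e * E by rewrite ler_peMr// mulr_ge0// ltW.
have : bt%:R * eta * E' <= bt.+1%:R * e * E.
  apply: ler_pM => //; [by rewrite mulr_ge0|exact: ltW|].
  by apply: ler_pM => //; rewrite ler_nat.
move=> h1 h2 h3; rewrite -(mulrA 2 bt.+1%:R) -(mulrA 2 bt%:R) -(mulrA 2 (bt%:R * eta)).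
apply: (tail_arith _ _ (bt.+1%:R * e * E) _ _ (bt.+1%:R * e)) => //.
by apply: le_trans e_epsE; rewrite [leLHS](_ : _ = e * (16 * bt.+1%:R * E))//; ring.
Unshelve. all: by end_near. Qed.

End sample_path_asymptotics.

(** * From large systems to limits *)
Section suprema.
Context {R : realType}.

Lemma limn_esup_le_fin (v : nat -> \bar R) (c : R) :
  (forall eps, 0 < eps -> \forall n \near \oo, (v n <= (c + eps)%:E)%E) ->
  (limn_esup v <= c%:E)%E.
Proof.
move=> near_le; apply/lee_addgt0Pr => e e0; rewrite -EFinD limn_esup_lim.
have [n0 _ vle] := near_le e e0.
apply: lime_le; first exact: is_cvg_esups.
exists n0 => // n /= n0n; apply: ge_ereal_sup => _ [j /= nj <-].
by apply: vle => /=; exact: leq_trans nj.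
Qed.

Lemma cvg_sup_itv0 (f : nat -> R -> R) (r s : R) : r <= s ->
  (forall n t, 0 <= f n t) ->
  (forall eps, 0 < eps -> \forall n \near \oo, forall t, r <= t <= s ->
    f n t <= eps) ->
  ereal_sup [set (f n t)%:E | t in `[r, s]] @[n --> \oo] --> (0%E : \bar R).
Proof.
move=> rs f0 near_le; apply: limn_esup_le_cvg.
  apply: limn_esup_le_fin => eps /near_le; apply: filterS => n fle.
  apply: ge_ereal_sup => _ [t /= tw <-]; rewrite add0r lee_fin.
  by apply: fle; move: tw; rewrite in_itv.
move=> n; apply: (@le_trans _ _ (f n r)%:E); first by rewrite lee_fin.
by apply: ereal_sup_ubound; exists r => //=; rewrite in_itv/= lexx.
Qed.

End suprema.

Lemma ae_exists (R : realType) d (O : measurableType d) (P : probability O R)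
  (Q : O -> Prop) : {ae P, forall w, Q w} -> exists w, Q w.
Proof.
move=> [A [mA PA QA]]; apply: contrapT => /forallNP nQ.
have AT : A = setT by apply/seteqP; split => // w _; apply: QA; exact: nQ.
have := probability_setT P; rewrite -AT [P A]PA => /esym/eqP.
by rewrite eqe oner_eq0.
Qed.

Lemma ae_regular_primitives (R : realType) (d1 d2 d3 : measure_display)
  (O1 : measurableType d1) (O2 : measurableType d2) (O3 : measurableType d3)
  (P1 : probability O1 R) (P2 : probability O2 R) (P3 : probability O3 R)
  (N : nat -> R -> O1 -> nat) (U : nat -> {RV P2 >-> R}) (Delta B : nat)
  (qn0 : nat -> nat -> {RV P3 >-> R}) (ln0 : nat -> {RV P3 >-> nat})
  (q0 : nat -> R) : independent_unit_poisson P1 N -> iid_uniform U ->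
  initial_conditions Delta B qn0 ln0 q0 ->
  {ae ((P1 \x P2) \x P3)%E, forall w,
  [/\ forall i, subdiffusive (fun t => N i t w.1.1),
      unit_jumps (fun t => N 0%N t w.1.1),
      forall j, (0 < j)%N -> 0 <= U j w.1.2 < 1,
      forall i, qn0 n i w.2 @[n --> \oo] --> q0 i &
      forall n, (0 < n)%N -> qn0 n B.+1 w.2 = 0 /\ (ln0 n w.2 <= B)%N]}.
Proof.
move=> [NP _] U_iid init.
have noise := ae_fst P3 (ae_fst P2 (ae_foralln (fun i => ae_subdiffusive (NP i)))).
have jumps := ae_fst P3 (ae_fst P2 (ae_unit_jumps (NP 0%N))).
have unif := ae_fst P3 (ae_snd P1 (ae_uniform_unit_interval U_iid)).
have icvg := ae_snd (P1 \x P2)%E (init_cvg init).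
have ibnd := ae_snd (P1 \x P2)%E (init_bounded init).
by near=> w; split; near: w.
Unshelve. all: by end_near. Qed.

(* The null sets of a completed measure are the subsets of measurable null
   sets, so {ae (P1 \x P2) \x P3, _} says "on a set of probability one" for the
   completion of the product of the three probability spaces. *)
Theorem theorem2 (R : realType)
  (d1 d2 d3 : measure_display)
  (O1 : measurableType d1) (O2 : measurableType d2) (O3 : measurableType d3)
  (P1 : probability O1 R) (P2 : probability O2 R) (P3 : probability O3 R)
  (T mu : R) (Delta : nat) (alpha : nat -> R) (lam : R -> R)
  (T_gt0 : 0 < T) (mu_gt0 : 0 < mu) (Delta_gt0 : (0 < Delta)%N)
  (alpha_01 : forall n, (0 < n)%N -> 0 < alpha n < 1)
  (lam_measurable : measurable_fun `[0, T] lam)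
  (lam_ge0 : forall t : R, 0 <= t <= T -> 0 <= lam t)
  (lam_bounded : exists M : R, forall t : R, 0 <= t <= T -> lam t <= M)
  (N : nat -> R -> O1 -> nat) (U : nat -> {RV P2 >-> R})
  (qn0 : nat -> nat -> {RV P3 >-> R}) (ln0 : nat -> {RV P3 >-> nat})
  (q0 : nat -> R) (B : nat)
  (N_poisson : independent_unit_poisson P1 N)
  (U_iid : iid_uniform U)
  (init : initial_conditions Delta B qn0 ln0 q0)
  (q : nat -> (O1 * O2) * O3 -> R -> nat -> R)
  (l : nat -> (O1 * O2) * O3 -> R -> nat)
  (solves : {ae ((P1 \x P2) \x P3)%E, forall w, forall n, (0 < n)%N ->
     system_solution T mu Delta (alpha n) lam n
       (fun i t => N i t w.1.1) (fun j => U j w.1.2) (q n w) (l n w)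
       (fun i => qn0 n i w.2) (ln0 n w.2)})
  (alpha_rate : exists gamma0 : R, [/\ 0 < gamma0 < 2^-1,
     alpha n @[n --> \oo] --> (1 : R)
   & (0 < limn_einf (fun n => (n%:R `^ gamma0 * (1 - alpha n))%:E))%E])
  (m : nat) (a b sigma : R)
  (a_ge0 : 0 <= a) (a_le_b : a <= b) (b_le_T : b <= T)
  (bounded : load_bounded mu lam q0 a b m Delta)
  (sigma_gt : settling_time mu lam q0 a b m Delta < sigma)
  (sigma_lt : sigma < b - a) :
  exists c : R, [/\ 0 < c, c = fluid_mass mu lam q0 (a + sigma) &
    {ae ((P1 \x P2) \x P3)%E, forall w,
      [/\ ereal_sup [set `|(l n w t)%:R - (m * Delta)%:R|%:E
                    | t in `[a + sigma, b]] @[n --> \oo] --> (0%E : \bar R),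
          forall i, (i <= m * Delta)%N ->
          forall gamma : R, 0 <= gamma < 2^-1 ->
          ereal_sup [set (n%:R `^ gamma * `|1 - q n w t i|)%:E
                    | t in `[a + sigma, b]] @[n --> \oo] --> (0%E : \bar R)
        & (limn_esup (fun n => ereal_sup
             [set \sum_((m.+1 * Delta).+1 <= i <oo)
                    (q n w t i * expR (mu * (t - (a + sigma))))%:E
             | t in `[(a + sigma)%R, b]]) <= c%:E)%E]}].
Proof.
have lamM : bounded_measurable T lam.
  split=> //; have [M lamle] := lam_bounded.
  by exists M => t tT; rewrite ger0_norm ?lam_ge0// lamle.
have [gamma0 [gamma0_itv alpha_cvg rate]] := alpha_rate.
have [s0 [s1 [_ [[as0 s01 s1s] _ _ _]]]] :=
  settling_schedule mu_gt0 lamM a_ge0 b_le_T bounded sigma_gt sigma_lt.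
have sigma_gt0 : 0 < sigma by lra.
have s2T : a + sigma <= T by lra.
have s2b : a + sigma <= b by lra.
have almost := ae_regular_primitives N_poisson U_iid init.
have mass0 : 0 <= limn (fun k => \sum_(1 <= i < k) q0 i).
  have /ae_exists[w [cw bw]] : {ae P3, forall w,
      (forall i, qn0 n i w @[n --> \oo] --> q0 i) /\
      (forall n, (0 < n)%N -> qn0 n B.+1 w = 0 /\ (ln0 n w <= B)%N)}.
    exact: filterI (init_cvg init) (init_bounded init).
  apply: (initial_mass_ge0 (qn0 := fun n i => qn0 n i w) (B := B)) => //.
  - by move=> n n0; exact: (init_occupancy init w n0).
  - by move=> n /bw[].
exists (fluid_mass mu lam q0 (a + sigma)); split => //.
  have [krmin _ _ _] := bounded.
  have rmin0 : 0 < load_min mu lam a b by apply: le_lt_trans krmin.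
  have aas : a <= a + sigma by rewrite lerDl ltW.
  apply: lt_le_trans (fluid_mass_lower mu_gt0 lamM lam_ge0 mass0
    (rmin := load_min mu lam a b) a_ge0 aas s2T _); last first.
    move=> x /andP[ax xs]; rewrite mulrC; apply: (load_min_le mu_gt0 lam_ge0) => //.
    by rewrite ax (le_trans xs).
  rewrite mulr_gt0// subr_gt0 expR_lt1 oppr_lt0 mulr_gt0// addrC addKr//.
apply: filterS2 solves almost => w solw [noise jump unif icvg ibnd].
have settled g eps : gamma0 <= g -> g < 2^-1 -> 0 < eps -> _ :=
  @eventually_settled R T mu Delta alpha lam
  (fun i t => N i t w.1.1) (fun j => U j w.1.2) (fun n i => qn0 n i w.2)
  (fun n => ln0 n w.2) q0 B (fun n => q n w) (fun n => l n w) T_gt0 mu_gt0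
  Delta_gt0 lamM lam_ge0
  (fun i => poisson_monotone (N_poisson.1 i) w.1.1)
  (fun i => poisson_start (N_poisson.1 i) w.1.1)
  (poisson_right_continuous (N_poisson.1 0%N) (w := w.1.1))
  jump noise unif solw
  (fun n n0 => init_occupancy init w.2 n0)
  (fun n n0 i => init_lattice init w.2 i n0)
  (fun n n0 => init_threshold init w.2 n0)
  icvg (fun n n0 => (ibnd n n0).1) (fun n n0 => (ibnd n n0).2)
  m a b sigma gamma0 a_ge0 a_le_b b_le_T bounded sigma_gt sigma_lt
  gamma0_itv alpha_cvg rate g eps.
have /andP[gamma0_gt0 gamma0_lt] := gamma0_itv.
split.
- apply: cvg_sup_itv0 => // eps eps0.
  apply: filterS (settled gamma0 eps (lexx _) gamma0_lt eps0) => n h t /h[-> _ _].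
  by rewrite subrr normr0 ltW.
- move=> i ik gamma /andP[g0 g2].
  apply: cvg_sup_itv0 => // eps eps0.
  have gm2 : Num.max gamma0 gamma < 2^-1 by rewrite gt_max gamma0_lt.
  have gm0 : gamma0 <= Num.max gamma0 gamma by rewrite le_max lexx.
  have n_gt0 : \forall n \near \oo, (0 < n)%N by exact: nbhs_infty_gt.
  apply: filterS2 n_gt0 (settled _ eps gm0 gm2 eps0) => n n0 h t /h[_ /(_ i ik) qi _].
  apply: le_trans qi; rewrite ler_wpM2r// ler_powR ?(ler_nat _ 1)//.
  by rewrite le_max lexx orbT.
- apply: limn_esup_le_fin => eps eps0.
  have n_gt0 : \forall n \near \oo, (0 < n)%N by exact: nbhs_infty_gt.
  apply: filterS2 n_gt0 (settled gamma0 eps (lexx _) gamma0_lt eps0) => n n0 h.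
  apply: ge_ereal_sup => _ [t /= tw <-].
  have /h[_ _ partial] : a + sigma <= t <= b by move: tw; rewrite in_itv.
  apply: lime_le.
    apply: is_cvg_nneseries => i _ _.
    have tT : 0 <= t <= T.
      by move: tw; rewrite in_itv/= => /andP[ts tb]; apply/andP; split; lra.
    have [_ /(_ i)[/andP[qi _] _]] := sol_occupancy (solw n n0) tT.
    by rewrite lee_fin mulr_ge0// expR_ge0.
  apply: nearW => M; rewrite sumEFin lee_fin big_add1; exact: partial.
Qed.
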